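(* Let $m\ge 1$ be an integer, let $\beta>1$ be real, let $M\in O(m)$, let $\eta_1,\dots,\eta_m$ be a basis of $\mathbb{R}^m$ generating the lattice $\mathcal{L}=\sum_{i=1}^m\mathbb{Z}\eta_i$, let $\xi\in\mathbb{R}^m$, and let $\mathcal{X}=\{\xi+\sum_{i=1}^m x_i\eta_i \mid x_i\in[0,1)\}$. Let $T:\mathcal{X}\to\mathcal{X}$ be the associated rotational beta transformation $T(z)=\beta Mz-d(z)$, where $d(z)$ is the unique element of $\mathcal{L}$ with $\beta Mz\in\mathcal{X}+d(z)$. Assume that for every $z\in\mathcal{X}$ there exists $n\in\mathbb{N}$ such that $2r(T^{-n}(z)+\mathcal{L})\le\beta\, w(\mathcal{X})$, and assume that there is an $\eta\in\mathcal{L}$ such that $$\beta M\mathcal{X}\subset\bigcup_{j\in\mathbb{Z}}(\mathcal{X}+j\eta).$$ If $\beta>2$, then $(\mathcal{X},T)$ has a unique ACIM, and this ACIM is equivalent to the $m$-dimensional Lebesgue measure on $\mathcal{X}$.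
   Context: An ACIM of $(\mathcal{X},T)$ is a $T$-invariant Borel probability measure on $\mathcal{X}$ that is absolutely continuous with respect to $m$-dimensional Lebesgue measure. Equivalent means mutually absolutely continuous. A strip is the closed region between two parallel hyperplanes of co-dimension one in $\mathbb{R}^m$; its width is the distance between the two hyperplanes. The width $w(A)$ of a nonempty set $A\subset\mathbb{R}^m$ is the minimum width of strips containing $A$ ($\infty$ if there is none). For $P\subseteq\mathbb{R}^m$, the covering radius is $r(P)=\sup_{x\in\mathbb{R}^m}\inf_{y\in P}\|x-y\|$, with value $\infty$ if no such real value exists (in particular for $P=\emptyset$). $T^{-n}(z)=\{y\in\mathcal{X}\mid T^n(y)=z\}$ and $T^{-n}(z)+\mathcal{L}=\{y+d\mid y\in T^{-n}(z),\ d\in\mathcal{L}\}$. Here $\mathbb{N}$ includes $0$, and $T^{0}$ is the identity. *)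

(* Defs.v *)
From HB Require Import structures.
From mathcomp Require Import all_boot all_order all_algebra.
From mathcomp Require Import all_classical all_reals all_analysis.

Set Implicit Arguments.
Unset Strict Implicit.
Unset Printing Implicit Defensive.

Import Order.TTheory GRing.Theory Num.Theory.
Import numFieldNormedType.Exports.

Local Open Scope classical_set_scope.
Local Open Scope ring_scope.

(* R^m, as column vectors, with its Borel sigma-algebra. *)
Definition borelRm (R : realType) (m : nat) :=
  g_sigma_algebraType (@open 'cV[R]_m).

HB.instance Definition _ (R : realType) (m : nat) :=
  Measurable.on (borelRm R m).

Section cons_measure.
Context d (T : measurableType d) (R : realType) (n : nat).
Variables (lambda : {sigma_finite_measure set T -> \bar R})
  (mu : {sigma_finite_measure set (n.-tuple T) -> \bar R}).

Definition pair_cons (p : T * n.-tuple T) : n.+1.-tuple T :=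
  [tuple of p.1 :: p.2].

Lemma measurable_pair_cons : measurable_fun [set: T * n.-tuple T] pair_cons.
Proof. exact: measurable_cons measurable_fst measurable_snd. Qed.

Definition cons_measure : set (n.+1.-tuple T) -> \bar R :=
  pushforward (lambda \x mu)%E pair_cons.

HB.instance Definition _ := Measure.copy cons_measure
  (measure_function_pushforward__canonical__measure_function_Measure _
     measurable_pair_cons).

Let cons_measure_sigma_finite :
  sigma_finite [set: n.+1.-tuple T] cons_measure.
Proof.
pose f (t : n.+1.-tuple T) : T * n.-tuple T := (thead t, [tuple of behead t]).
have mf : measurable_fun [set: n.+1.-tuple T] f.
  apply: measurable_fun_pair; first exact: measurable_tnth.
  exact: measurable_behead.
have fK p : f (pair_cons p) = p.
  case: p => x t; rewrite /f /pair_cons/= theadE; congr pair.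
  exact: val_inj.
have /sigma_finiteP[F [TF ndF Foo]] := sigma_finiteT lambda.
have /sigma_finiteP[G [TG ndG Goo]] := sigma_finiteT mu.
exists (fun k => f @^-1` (F k `*` G k)).
  rewrite -preimage_bigcup (_ : \bigcup_k _ = setT)// -subTset => -[x y] _.
  have : [set: T] x by [].
  have : [set: n.-tuple T] y by [].
  rewrite TF TG => -[l _ Gy] [k _ Fx]; exists (maxn k l) => //; split => /=.
    by move: x Fx; exact/subsetPset/ndF/leq_maxl.
  by move: y Gy; exact/subsetPset/ndG/leq_maxr.
move=> k; have [mF Fk] := Foo k; have [mG Gk] := Goo k; split.
  by rewrite -[X in measurable X]setTI; apply: mf => //; exact: measurableX.
rewrite /cons_measure /pushforward -comp_preimage.
rewrite (_ : f \o pair_cons = id); last by apply/funext => p; exact: fK.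
by rewrite preimage_id product_measure1E// lte_mul_pinfty// ge0_fin_numE.
Qed.

HB.instance Definition _ := Measure_isSigmaFinite.Build _ _ _ cons_measure
  cons_measure_sigma_finite.

End cons_measure.

(* The n-fold product of the Lebesgue measure of the line. *)
Fixpoint lebesgue_tuple (R : realType) (n : nat) :
    {sigma_finite_measure set (n.-tuple (measurableTypeR R)) -> \bar R} :=
  match n with
  | 0 => \d_([tuple] : 0.-tuple (measurableTypeR R))
  | n'.+1 => cons_measure lebesgue_measure (lebesgue_tuple R n')
  end.

Lemma lebesgue_tuple_box (R : realType) (n : nat)
    (A : 'I_n -> set (measurableTypeR R)) : (forall i, measurable (A i)) ->
  lebesgue_tuple R n [set t | forall i, A i (tnth t i)] =
  (\prod_(i < n) lebesgue_measure (A i))%E.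
Proof.
elim: n A => [|n IHn] A mA.
  rewrite big_ord0 /= /dirac indicE mem_set//= => -[]//.
rewrite big_ord_recl -IHn//= /cons_measure /pushforward.
rewrite -product_measure1E//; last first.
  rewrite (_ : mkset _ = \bigcap_(i in [set: 'I_n])
      ((fun t : n.-tuple (measurableTypeR R) => tnth t i) @^-1`
         A (lift ord0 i))); last first.
    by apply/seteqP; split => [t At i _|t At i]; [exact: At|exact: At i I].
  apply: fin_bigcap_measurable => [|i _]; first exact: finite_finset.
  by rewrite -[X in measurable X]setTI; exact: measurable_tnth.
congr (product_measure1 _ _ _); apply/seteqP; split => [[x t] /= At|[x t]].
  by split => [|i]; [exact: (At ord0)|have := At (lift ord0 i); rewrite tnthS].
move=> [/= Ax At] i; case: (unliftP ord0 i) => [j ->|->]//.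
by rewrite tnthS.
Qed.

Section lebesgue_Rm.
Context (R : realType) (m : nat).
Local Notation T := (measurableTypeR R).

Definition col_of_tuple (t : m.-tuple T) : borelRm R m :=
  \col_(i < m) tnth t i.

Lemma measurable_col_of_tuple : measurable_fun [set: m.-tuple T] col_of_tuple.
Proof.
apply: (@measurability _ _ _ (borelRm R m) setT col_of_tuple
  (@open 'cV[R]_m) erefl).
move=> _ [U oU <-]; rewrite setTI.
pose B (qk : 'cV[rat]_m * nat) : set (m.-tuple T) :=
  \bigcap_(i in [set: 'I_m])
    ((fun t : m.-tuple T => tnth t i) @^-1`
       ball (ratr (qk.1 i ord0) : R) qk.2.+1%:R^-1).
pose F qk := if `[< B qk `<=` col_of_tuple @^-1` U >] then B qk else set0.
have mB qk : measurable (B qk).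
  apply: fin_bigcap_measurable => [|i _]; first exact: finite_finset.
  rewrite -[X in measurable X]setTI; apply: measurable_tnth => //.
  exact: measurable_realfun.measurable_ball.
have -> : col_of_tuple @^-1` U = \bigcup_qk F qk.
  apply/seteqP; split => [t Ut|t [qk _]]; last first.
    by rewrite /F; case: ifPn => // /asboolP sB; exact: sB.
  have /nbhs_ballP[e /= e0 eU] : nbhs (col_of_tuple t : 'cV[R]_m) U.
    exact: open_nbhs_nbhs.
  have [k ke] : exists k : nat, k.+1%:R^-1 < e / 2 :> R.
    have /ltr_add_invr[k] : 0 < e / 2 by rewrite divr_gt0.
    by rewrite add0r; exists k.
  pose q : 'cV[rat]_m := \col_i
    xget 0 [set r : rat | ball (ratr r : R) k.+1%:R^-1 (tnth t i)].
  have qP i : ball (ratr (q i ord0) : R) k.+1%:R^-1 (tnth t i).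
    rewrite mxE; apply: (@xgetPex _ 0
      [set r : rat | ball (ratr r : R) k.+1%:R^-1 (tnth t i)]).
    have [|r] := @rat_in_itvoo R (tnth t i) (tnth t i + k.+1%:R^-1).
      by rewrite ltrDl invr_gt0 ltr0n.
    rewrite in_itv/= => /andP[r1 r2]; exists r => /=.
    by rewrite /ball/= ger0_norm ?subr_ge0 ?ltW// ltrBlDl.
  exists (q, k) => //; rewrite /F; case: ifPn => [_ i _|/asboolP]; first exact: qP.
  case=> s Bs; apply: eU; split => // i j; rewrite !mxE.
  apply: (@le_ball _ _ _ (k.+1%:R^-1 + k.+1%:R^-1)).
    by rewrite (splitr e) lerD// ltW.
  apply: (@ball_triangle _ _ (ratr (q i ord0) : R)); first exact/ball_sym/qP.
  exact: Bs i I.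
apply: countable_bigcupT_measurable; first exact: countableP.
by move=> qk; rewrite /F; case: ifP.
Qed.

Definition lebesgue_Rm : set (borelRm R m) -> \bar R :=
  pushforward (lebesgue_tuple R m) col_of_tuple.

HB.instance Definition _ := Measure.copy lebesgue_Rm
  (measure_function_pushforward__canonical__measure_function_Measure _
     measurable_col_of_tuple).


Lemma lebesgue_Rm_box (A : 'I_m -> set T) : (forall i, measurable (A i)) ->
  lebesgue_Rm [set x : 'cV[R]_m | forall i, A i (x i ord0)] =
  (\prod_(i < m) lebesgue_measure (A i))%E.
Proof.
move=> mA; rewrite /lebesgue_Rm /pushforward -lebesgue_tuple_box//.
congr (lebesgue_tuple R m _); apply/seteqP.
by split => t /= tA i; have := tA i; rewrite mxE.
Qed.

End lebesgue_Rm.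

Section euclidean.
Context (R : realType) (m : nat).
Implicit Types (u x y : 'cV[R]_m) (A B P : set 'cV[R]_m).

Definition dotp x y : R := \sum_(i < m) x i ord0 * y i ord0.

(* The norm of the library on matrices is the sup norm. *)
Definition enorm x : R := Num.sqrt (dotp x x).

Definition orthogonal_mx (M : 'M[R]_m) := M^T *m M = 1%:M.

Definition set_dist A B : \bar R :=
  ereal_inf [set (enorm (x - y))%:E | x in A & y in B].

Definition hyperplane u (c : R) : set 'cV[R]_m := [set x | dotp u x = c].

Definition strip u (a b : R) : set 'cV[R]_m := [set x | a <= dotp u x <= b].

Definition strip_width u (a b : R) : \bar R :=
  set_dist (hyperplane u a) (hyperplane u b).

Definition width A : \bar R :=
  ereal_inf [set w | exists u (a b : R),
    [/\ u != 0, a <= b, A `<=` strip u a b & w = strip_width u a b]].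

Definition covering_radius P : \bar R :=
  ereal_sup (range (fun x => ereal_inf [set (enorm (x - y))%:E | y in P])).

Definition minkowski_sum A B : set 'cV[R]_m := [set x + y | x in A & y in B].

Definition translate A (d : 'cV[R]_m) : set 'cV[R]_m := [set x + d | x in A].

End euclidean.

Section rotational_beta.
Context (R : realType) (m : nat).
Variables (beta : R) (M : 'M[R]_m) (eta : m.-tuple 'cV[R]_m) (xi : 'cV[R]_m).

Definition lattice : set 'cV[R]_m :=
  [set \sum_(i < m) (k i)%:~R *: tnth eta i | k in [set: 'I_m -> int]].

Definition fundamental_domain : set 'cV[R]_m :=
  [set xi + \sum_(i < m) x i *: tnth eta i |
    x in [set x : 'I_m -> R | forall i, 0 <= x i < 1]].

Local Notation X := fundamental_domain.

Lemma translate_fundamental_domain_unique (w : 'cV[R]_m) :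
  basis_of fullv eta ->
  exists! d, lattice d /\ translate X d w.
Proof.
move=> eta_basis; have eta_free := basis_free eta_basis.
have etaE (x : 'I_m -> R) : \sum_(i < m) x i *: tnth eta i =
    \sum_(i < m) x i *: eta`_i.
  by apply: eq_bigr => i _; rewrite (tnth_nth 0).
have coordE (v : 'cV[R]_m) : v = \sum_(i < m) coord eta i v *: tnth eta i.
  by rewrite (etaE (fun i => coord eta i v)) -(coord_basis eta_basis) ?memvf.
pose c i := coord eta i (w - xi).
exists (\sum_(i < m) (Num.floor (c i))%:~R *: tnth eta i); split.
  split; first by exists (fun i => Num.floor (c i)).
  exists (xi + \sum_(i < m) (c i - (Num.floor (c i))%:~R) *: tnth eta i).
    exists (fun i => c i - (Num.floor (c i))%:~R) => // i /=.
    have /andP[cl cg] := floor_itv (c i).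
    by rewrite subr_ge0 cl ltrBlDl -[1]/(1%:~R) -intrD.
  rewrite -addrA -big_split/=.
  under eq_bigr do rewrite -scalerDl subrK.
  by rewrite -coordE addrC subrK.
move=> d [[k _ <-{d}] [_ [x x01 <-] wE]].
apply: eq_bigr => i _; congr (_%:~R *: _).
have -> : c i = x i + (k i)%:~R.
  rewrite /c -wE addrAC [xi + _]addrC addrK -big_split/=.
  under eq_bigr do rewrite -scalerDl.
  by rewrite (etaE (fun i => x i + (k i)%:~R)) coord_sum_free.
by apply/floor_def; rewrite lerDr intrD addrC ltrD2l; exact: x01.
Qed.

Definition digit (z : 'cV[R]_m) : 'cV[R]_m :=
  xget 0 [set d | lattice d /\ translate X d (beta *: (M *m z))].

(* The formula defines a map on all of R^m, which sends R^m into X; only its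
   restriction to X matters below. *)
Definition rotbeta (z : 'cV[R]_m) : 'cV[R]_m := beta *: (M *m z) - digit z.

Definition iter_fiber (n : nat) (z : 'cV[R]_m) : set 'cV[R]_m :=
  [set y | X y /\ iter n rotbeta y = z].

(* Borel probability measures on X are the Borel probability measures on R^m
   that give full mass to X. *)
Definition is_ACIM (mu : probability (borelRm R m) R) :=
  [/\ mu X = 1%E,
      forall A : set (borelRm R m), measurable A ->
        mu (X `&` rotbeta @^-1` A) = mu A
    & mu `<< @lebesgue_Rm R m].

Definition lebesgue_on_domain : set (borelRm R m) -> \bar R :=
  fun A => lebesgue_Rm (A `&` X).

End rotational_beta.

(* Main.v *)
(* Write A z = beta M z.  The tube condition makes a single coordinate of A z
   decide the digit of z, so T is, on X, the map A cut along one family of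
   parallel hyperplanes.

   Growth.  Cut a convex set into the pieces of continuity of T^n and map it by
   T^n.  One step of T expands distances to the boundary of the pieces by
   beta, whereas the cuts at most double the volume of the points lying within
   a given distance of the boundary.  As beta > 2, the volume of the points
   whose image under T^n is within eps of the boundary of its piece stays
   O(eps), uniformly in n.

   Existence.  The growth estimate gives |X /\ T^-n A| <= C eps + K_eps |A|, so
   that limits of Cesaro means along a free ultrafilter are countably additive
   and absolutely continuous.

   Spreading.  Let C be forward invariant of positive volume.  By density and
   the growth estimate, images of a cube contain balls of a fixed radius almost
   filled by C, hence in the limit a ball filled by C up to a null set.  A ball
   of radius r is cut by one hyperplane family only, and A multiplies r by
   beta > 2, so its image contains a ball of radius min (w / 2, beta r / 2),
   where w is at least the width of X; iterating, C fills a ball of radius w / 2.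
   The covering hypothesis then says that the images of slightly larger balls
   cover X, whence X \ C is null.

   Applied to the complement of the preimages of a null set this gives the
   equivalence, and applied to the positive part of a Hahn decomposition of the
   difference of two ACIMs it gives uniqueness. *)
Require Import Defs.
From HB Require Import structures.
From mathcomp Require Import all_boot all_order all_algebra.
From mathcomp Require Import all_classical all_reals all_analysis.
From mathcomp Require Import ring lra.

Set Implicit Arguments.
Unset Strict Implicit.
Unset Printing Implicit Defensive.

Import Order.TTheory GRing.Theory Num.Theory.
Import numFieldNormedType.Exports.

Local Open Scope classical_set_scope.
Local Open Scope ring_scope.

(** The growth estimate involves neither surface areas nor a count of pieces. The deep points next
    to a new cut are pushed away from it through successive bands. Those that stay deep throughout
    occupy a small share of the volume; the others land among points that were shallow already.
    Points come from two sides, the cuts below and above, but by convexity no shallow point receives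
    both, so the shallow volume at most doubles, up to an error proportional to the depth. The
    factor 2 thus reflects the two sides of a single family of cuts; it competes with the factor
    [beta] gained because depth [eps] in the next image only needs depth [eps / beta] in the present
    one.

    The same estimate serves two purposes. Started from [X] it gives uniform integrability. Started
    from a tiny dyadic cube, its initial coefficient is huge but is damped by [(2 / beta) ^+ n], so
    that half of the cube ends up at a depth which does not depend on the cube. This is why
    arbitrarily good density cubes all produce balls of one and the same radius. *)

Section continuity.
Context (R : realType) (m : nat).
Implicit Types x y : 'cV[R]_m.

Lemma norm_cV_le x (e : R) : 0 <= e -> (forall i, `|x i ord0| <= e) -> `|x| <= e.
Proof.
move=> e0 xe; rewrite [leLHS]/Num.norm/= mx_normrE; apply: bigmax_le => //.
by move=> [i j] _ /=; rewrite (ord1 j).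
Qed.

Lemma le_norm_cV x i : `|x i ord0| <= `|x|.
Proof.
by rewrite [leRHS]/Num.norm/= mx_normrE (le_bigmax _ (fun ij => `|x ij.1 ij.2|) (i, ord0)).
Qed.

Lemma lipschitz_continuous (V W : normedModType R) (f : V -> W) (C : R) :
  (forall u v : V, `|f u - f v| <= C * `|u - v|) -> continuous f.
Proof.
move=> fC x; apply/cvgrPdist_lt => e e0.
have C0 : 0 < `|C| + 1 by rewrite ltr_wpDl.
near=> y; apply: (le_lt_trans (fC x y)).
apply: (@le_lt_trans _ _ ((`|C| + 1) * `|x - y|)).
  by rewrite ler_wpM2r// (le_trans (ler_norm C))// lerDl.
rewrite -ltr_pdivlMl//; near: y.
by apply: cvgr_dist_lt => //; rewrite mulrC divr_gt0.
Unshelve. all: end_near. Qed.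

Lemma linear_cV_lipschitz (W : normedModType R) (f : {linear 'cV[R]_m -> W}) :
  exists2 C : R, 0 < C & forall x, `|f x| <= C * `|x|.
Proof.
exists (\sum_i `|f (delta_mx i ord0)| + 1) => [|x].
  by rewrite ltr_wpDl// sumr_ge0.
have {1}-> : x = \sum_i x i ord0 *: delta_mx i ord0.
  by rewrite [LHS]matrix_sum_delta; apply: eq_bigr => i _; rewrite big_ord1.
rewrite linear_sum/= (le_trans (ler_norm_sum _ _ _))//.
rewrite mulrDl mulr_suml ler_wpDr ?mul1r// ler_sum// => i _.
by rewrite linearZ normrZ mulrC ler_wpM2l// le_norm_cV.
Qed.

Lemma linear_cV_continuous (W : normedModType R) (f : {linear 'cV[R]_m -> W}) :
  continuous f.
Proof.
have [C _ fC] := linear_cV_lipschitz f.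
by apply: (@lipschitz_continuous _ _ _ C) => x y; rewrite -linearB.
Qed.

End continuity.

Section borel.
Context (R : realType) (m : nat).
Local Notation mble := (@measurable _ (borelRm R m)).

Lemma measurable_open (U : set 'cV[R]_m) : open U -> mble U.
Proof. by move=> oU; exact: sub_sigma_algebra. Qed.

Lemma measurable_preimage (f : 'cV[R]_m -> 'cV[R]_m) (B : set 'cV[R]_m) :
  continuous f -> mble B -> mble (f @^-1` B).
Proof.
move=> cf mB; have mf : measurable_fun setT (f : borelRm R m -> borelRm R m).
  apply: (@measurability _ _ (borelRm R m) (borelRm R m) setT f
    (@open 'cV[R]_m) erefl).
  move=> _ [U oU <-]; rewrite setTI; apply: measurable_open.
  by move/continuousP : cf; exact.
by rewrite -[X in measurable X]setTI; exact: mf.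
Qed.

Lemma measurable_lt (f : 'cV[R]_m -> R) (a : R) :
  continuous f -> mble [set x | f x < a].
Proof.
move=> /continuousP cf; apply: measurable_open.
by have := cf _ (@open_lt R a).
Qed.

Lemma measurable_ge (f : 'cV[R]_m -> R) (a : R) :
  continuous f -> mble [set x | a <= f x].
Proof.
move=> cf; rewrite (_ : mkset _ = ~` [set x | f x < a]).
  by apply: measurableC; exact: measurable_lt.
by apply/seteqP; split => x /=; rewrite leNgt => /negP.
Qed.

Lemma measurable_itvco (f : 'cV[R]_m -> R) (a b : R) :
  continuous f -> mble [set x | a <= f x < b].
Proof.
move=> cf; rewrite (_ : mkset _ = [set x | a <= f x] `&` [set x | f x < b]).
  by apply: measurableI; [exact: measurable_ge|exact: measurable_lt].
by apply/seteqP; split => x /= /andP.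
Qed.

Lemma measurable_floor (f : 'cV[R]_m -> R) (z : int) :
  continuous f -> mble [set x | Num.floor (f x) = z].
Proof.
move=> cf; rewrite (_ : mkset _ = [set x | z%:~R <= f x < (z + 1)%:~R]).
  exact: measurable_itvco.
apply/seteqP; split => x /=; last by move/floor_def.
by move=> <-; exact: floor_itv.
Qed.

End borel.

(** * Countable partitions into measurable fibers *)

Section fibers.
Context d (T : measurableType d) (R : realType) (mu : {measure set T -> \bar R}).
Context (I : countType) (f : T -> I).
Hypothesis mf : forall i, measurable (f @^-1` [set i]).

Lemma countable_fun_measurable (S : set I) : measurable (f @^-1` S).
Proof.
rewrite (_ : f @^-1` S = \bigcup_i (f @^-1` [set i] `&` f @^-1` S)).
  apply: countable_bigcupT_measurable => [|i]; first exact: countableP.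
  have [Si|nSi] := pselect (S i).
    by rewrite setIidl// => x /= ->.
  by rewrite (_ : _ `&` _ = set0)// -subset0 => x [/= ->].
by apply/seteqP; split => [x Sx|x [i _ []]//]; exists (f x).
Qed.

(** Indexing by [pickle] turns an arbitrary countable index type into a series over the naturals;
    numbers that code no index contribute empty sets. *)
Lemma measure_fibers (A : set T) : measurable A ->
  mu A = (\sum_(0 <= n <oo) mu (A `&` [set x | pickle (f x) = n]))%E.
Proof.
move=> mA; rewrite -measure_semi_bigcup//=.
- congr (mu _); apply/seteqP; split => [x Ax|x [n _ []]//].
  by exists (pickle (f x)).
- move=> n; apply: measurableI => //.
  exact: (countable_fun_measurable [set i | pickle i = n]).
- by move=> i j _ _ [x [[_ <-] [_ <-]]].
- apply: bigcup_measurable => n _; apply: measurableI => //.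
  exact: (countable_fun_measurable [set i | pickle i = n]).
Qed.

Lemma pickle_fiber n : (exists i, [set x | pickle (f x) = n] = f @^-1` [set i]) \/
  [set x | pickle (f x) = n] = set0.
Proof.
have [[i fi]|nfi] := pselect (exists i : I, pickle i = n); last first.
  by right; apply/seteqP; split => // x fx; apply: nfi; exists (f x).
left; exists i; rewrite -fi; apply/seteqP; split => x /=; last by move=> ->.
exact: (pcan_inj pickleK).
Qed.

(** Used directly to pass from cells to [X], and contrapositively to pick out a cube or a cell on
    which a comparison holds. *)
Lemma le_measure_fibers (q : R) (A B : set T) :
  0 <= q -> measurable A -> measurable B ->
  (forall i, mu (A `&` f @^-1` [set i]) <= q%:E * mu (B `&` f @^-1` [set i]))%E ->
  (mu A <= q%:E * mu B)%E.
Proof.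
move=> q0 mA mB AB; rewrite (measure_fibers mA) (measure_fibers mB).
rewrite -nneseriesZl//; apply: lee_nneseries => [*|n _]; first exact: measure_ge0.
have [[i ->]|->] := pickle_fiber n; first exact: AB.
by rewrite !setI0 measure0 mule0.
Qed.

End fibers.

Lemma measure_fibers_scale d (T : measurableType d) (R : realType)
    (mu nu : {measure set T -> \bar R}) (I : countType) (f : T -> I)
    (q : R) (A : set T) :
  (forall i, measurable (f @^-1` [set i])) -> measurable A ->
  (forall i, mu (A `&` f @^-1` [set i]) = q%:E * nu (A `&` f @^-1` [set i]))%E ->
  mu A = (q%:E * nu A)%E.
Proof.
move=> mf mA AB; rewrite (measure_fibers mu mf mA) (measure_fibers nu mf mA).
rewrite -nneseriesZl//; apply: eq_eseriesr => n _.
have [[i ->]|->] := pickle_fiber f n; first exact: AB.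
by rewrite !setI0 !measure0 mule0.
Qed.

(** * Dyadic cubes *)

Section dyadic.
Context (R : realType) (m : nat) (c : 'I_m -> 'cV[R]_m -> R) (K : R).
Hypothesis c_cont : forall i, continuous (c i).
Hypothesis c_inv : forall x y (e : R), 0 <= e ->
  (forall i, `|c i x - c i y| <= e) -> `|x - y| <= K * e.
Local Notation mble := (@measurable _ (borelRm R m)).
Implicit Types x y : 'cV[R]_m.

(** The coordinates [c] stay abstract because two systems are used: the standard ones, in which the
    volume of a cube is computed, and the lattice ones, in which [X] is itself a cube of level 0. *)
Definition dkey (k : nat) x : {ffun 'I_m -> int} :=
  [ffun i => Num.floor (2 ^+ k * c i x)].

Lemma measurable_dkey k v : mble (dkey k @^-1` [set v]).
Proof.
rewrite (_ : dkey k @^-1` [set v] = \bigcap_(i in [set: 'I_m])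
    [set x | Num.floor (2 ^+ k * c i x) = v i]).
  apply: fin_bigcap_measurable => [|i _]; first exact: finite_finset.
  apply: (@measurable_floor _ _ (fun x => 2 ^+ k * c i x)) => x.
  exact: (cvgM (cvg_cst _) (@c_cont i x)).
apply/seteqP; split => [x /= <- i _|x vx]; first by rewrite ffunE.
by apply/ffunP => i; rewrite ffunE; exact: vx.
Qed.

Lemma dkey_measurable k (S : set {ffun 'I_m -> int}) : mble (dkey k @^-1` S).
Proof.
exact: (@countable_fun_measurable _ (borelRm R m) _ _ (measurable_dkey k)).
Qed.

Lemma dkey_nest k l x y : (k <= l)%N -> dkey l x = dkey l y -> dkey k x = dkey k y.
Proof.
move=> kl lxy; apply/ffunP => i; rewrite !ffunE.
have {lxy} : Num.floor (2 ^+ l * c i x) = Num.floor (2 ^+ l * c i y).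
  by move/ffunP : lxy => /(_ i); rewrite !ffunE.
(* The floor at level [k] is determined by the one at level [l]: an integer lower bound at level [k]
   becomes [2 ^+ (l - k)] times that bound at level [l]. *)
have floor_scale a (z : int) :
    (z <= Num.floor (2 ^+ k * a)) = (2 ^+ (l - k) * z <= Num.floor (2 ^+ l * a : R)).
  rewrite !floor_ge_int ?num_real// intrM -(subnK kl) exprD addnK rmorphXn/=.
  by rewrite -mulrA ler_pM2l// exprn_gt0.
move=> xy; apply/eqP; rewrite eq_le.
by rewrite floor_scale -xy -floor_scale lexx floor_scale xy -floor_scale lexx.
Qed.

Lemma dkey_open_nd (U : set 'cV[R]_m) :
  nondecreasing_seq (fun k => [set x | forall y, dkey k y = dkey k x -> U y]).
Proof.
move=> k l kl; apply/subsetPset => x Ux y yx; apply: Ux.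
exact: dkey_nest yx.
Qed.

Lemma dkey_open (U : set 'cV[R]_m) : open U ->
  U = \bigcup_k [set x | forall y, dkey k y = dkey k x -> U y].
Proof.
move=> oU; apply/seteqP; split => [x Ux|x [k _ /(_ x)]]; last exact.
have /nbhs_ballP[e /= e0 eU] : nbhs x U by exact: open_nbhs_nbhs.
have [k ke] : exists k : nat, (`|K| + 1) / e < 2 ^+ k.
  have a0 : 0 <= (`|K| + 1) / e by rewrite divr_ge0 ?addr_ge0// ltW.
  exists (Num.bound ((`|K| + 1) / e)); apply: lt_trans (archi_boundP a0) _.
  by rewrite -natrX ltr_nat ltn_expl.
exists k => // y kyx; apply: eU; rewrite -ball_normE/=.
have k0 : 0 < 2 ^+ k :> R by rewrite exprn_gt0.
apply: (@le_lt_trans _ _ (K * (2 ^+ k)^-1)).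
  apply: c_inv => [|i]; first by rewrite invr_ge0 ltW.
  have : Num.floor (2 ^+ k * c i y) = Num.floor (2 ^+ k * c i x).
    by move/ffunP : kyx => /(_ i); rewrite !ffunE.
  move=> fyx.
  have /andP[x1 x2] := floor_itv (2 ^+ k * c i x).
  have /andP[y1 y2] := floor_itv (2 ^+ k * c i y).
  rewrite fyx in y1 y2; rewrite intrD in x2 y2.
  rewrite -(ler_pM2l k0) divff ?gt_eqF// -{1}(ger0_norm (ltW k0)) -normrM mulrBr.
  by rewrite ler_norml; apply/andP; split; lra.
rewrite ltr_pdivrMr// mulrC.
move: ke; rewrite ltr_pdivrMr// => ke; apply: le_lt_trans ke.
by rewrite (le_trans (ler_norm K))// lerDl.
Qed.

(** Two dyadic cubes are nested or disjoint, so with the empty set they form a pi-system; it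
    generates the Borel sets because an open set is a countable union of cubes contained in it. *)
Lemma dyadic_measure_unique (mu nu : {measure set (borelRm R m) -> \bar R}) :
  (forall k v, mu (dkey k @^-1` [set v]) = nu (dkey k @^-1` [set v])) ->
  (forall k v, mu (dkey k @^-1` [set v]) < +oo)%E ->
  forall A : set (borelRm R m), measurable A -> mu A = nu A.
Proof.
move=> munu muoo A mA.
pose G : set (set (borelRm R m)) :=
  [set A | A = set0 \/ exists k v, A = dkey k @^-1` [set v]].
(* The cubes of level 0 exhaust the space; naturals that decode to no index give the empty set. *)
pose g n : set (borelRm R m) :=
  if @unpickle {ffun 'I_m -> int} n is Some v then dkey 0 @^-1` [set v] else set0.
have Gm B : G B -> mble B.
  by case=> [->|[k [v ->]]]; [exact: measurable0|exact: measurable_dkey].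
apply: (measure_unique G g) => //.
- apply/seteqP; split; last first.
    by apply: smallest_sub => //; exact: sigma_algebra_measurable.
  apply: smallest_sub; first exact: smallest_sigma_algebra.
  move=> U /= /dkey_open ->.
  apply: (@bigcupT_measurable _ (g_sigma_algebraType G)) => k.
  rewrite (_ : mkset _ = \bigcup_(v : {ffun 'I_m -> int})
     (if `[< dkey k @^-1` [set v] `<=` U >] then dkey k @^-1` [set v] else set0)).
    apply: (@countable_bigcupT_measurable _ (g_sigma_algebraType G)).
      exact: countableP.
    move=> v; case: ifPn => // _; apply: sub_sigma_algebra.
    by right; exists k, v.
  apply/seteqP; split => [x xU|x [v _]].
    exists (dkey k x) => //; case: ifPn => // /asboolP; apply => y /= yx.
    exact: xU.
  by case: ifPn => // /asboolP vU /= -> y yx; exact: vU.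
- move=> B C [->|[k [v ->]]]; first by move=> _; rewrite set0I; left.
  move=> [->|[l [w ->]]]; first by rewrite setI0; left.
  wlog kl : k v l w / (k <= l)%N.
    by move=> H; case: (leqP k l) => [|/ltnW] kl; [|rewrite setIC]; exact: H.
  have [[y /= [yv yw]]|] := pselect ((dkey k @^-1` [set v] `&` dkey l @^-1` [set w]) !=set0).
    right; exists l, w; apply: setIidr => x /=; rewrite -yw => xy.
    by rewrite (dkey_nest kl xy).
  by move/nonemptyPn; left.
- by move=> n; rewrite /g; case: unpickle => [v|]; [right; exists 0%N, v|left].
- apply/seteqP; split => // x _; exists (pickle (dkey 0 x)) => //.
  by rewrite /g pickleK.
- by move=> B [->|[k [v ->]]//]; rewrite !measure0.
- by move=> n; rewrite /g; case: unpickle => [v|]; [exact: muoo|rewrite measure0].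
Qed.

Section approximation.
Context (mu : {measure set (borelRm R m) -> \bar R}) (W : set 'cV[R]_m).
Hypotheses (mW : mble W) (Woo : (mu W < +oo)%E).

(** The Borel sets with this property form a sigma-algebra containing the open sets. The finite mass
    of [W] provides continuity from above, which handles open sets and countable unions. *)
Lemma dyadic_approx (A : set (borelRm R m)) (e : R) : measurable A -> 0 < e ->
  exists k S, (mu (W `&` ((A `\` dkey k @^-1` S) `|` (dkey k @^-1` S `\` A))) <= e%:E)%E.
Proof.
move=> mA; move: e.
pose P (A : set (borelRm R m)) := measurable A /\ forall e : R, 0 < e -> exists k S,
  (mu (W `&` ((A `\` dkey k @^-1` S) `|` (dkey k @^-1` S `\` A))) <= e%:E)%E.
suff : P A by case.
move: A mA; have mWB (B : set (borelRm R m)) : measurable B -> measurable (W `&` B : set (borelRm R m)).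
  exact: measurableI.
have mS k S := dkey_measurable k S.
have PU A B : P A -> P B -> P (A `|` B).
  move=> [mA PA] [mB PB]; split; first exact: measurableU.
  move=> e e0; have e20 : 0 < e / 2 by rewrite divr_gt0.
  have [k [S Sk]] := PA _ e20; have [l [S' Sl]] := PB _ e20.
  (* Two approximations of different levels are brought to a common finer level before their union
     is taken. *)
  have lift k' l' (S0 : set {ffun 'I_m -> int}) : (k' <= l')%N -> exists S1,
      dkey k' @^-1` S0 = dkey l' @^-1` S1.
    move=> kl; exists [set dkey l' x | x in dkey k' @^-1` S0].
    apply/seteqP; split => [x Sx|x [y /= Sy /(dkey_nest kl) <-//]]; by exists x.
  have [S1 S1E] := lift k (maxn k l) S (leq_maxl _ _).
  have [S2 S2E] := lift l (maxn k l) S' (leq_maxr _ _).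
  exists (maxn k l), (S1 `|` S2); rewrite preimage_setU -S1E -S2E.
  rewrite (splitr e) EFinD; apply: le_trans (leeD Sk Sl).
  apply: le_trans (measureU2 _ _ _); last 2 first.
  - by apply: mWB; apply: measurableU; apply: measurableD.
  - by apply: mWB; apply: measurableU; apply: measurableD.
  apply: le_measure; rewrite ?inE.
  - by apply: mWB; apply: measurableU; apply: measurableD => //; exact: measurableU.
  - by apply: measurableU; apply: mWB; apply: measurableU; apply: measurableD.
  by move=> x /=; tauto.
apply: smallest_sub; last first.
  move=> U oU; split; first exact: measurable_open.
  move=> e e0.
  pose F k := W `&` (U `\` [set x | forall y, dkey k y = dkey k x -> U y]).
  have FE k : [set x | forall y, dkey k y = dkey k x -> U y] =
      dkey k @^-1` [set v | forall y, dkey k y = v -> U y] by [].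
  have mF k : mble (F k).
    by apply: mWB; apply: measurableD; [exact: measurable_open|rewrite FE].
  have : mu (F k) @[k --> \oo] --> mu (\bigcap_k F k).
    apply: nonincreasing_cvg_mu => //.
    - by rewrite (le_lt_trans _ Woo)// le_measure ?inE//; exact: subIsetl.
    - exact: bigcapT_measurable.
    - move=> k l kl; apply/subsetPset; apply: setIS; apply: setDS.
      by apply/subsetPset; exact: dkey_open_nd.
  rewrite (_ : \bigcap_k F k = set0); last first.
    rewrite -subset0 => x Fx; have [_ [Ux _]] := Fx 0%N I.
    by move: (Ux); rewrite {1}(dkey_open oU) => -[k _ ?]; have [_ []] := Fx k I.
  rewrite measure0 => /fine_cvgP[[N _ N1]] /cvgrPdist_le/(_ e e0)[N' _ N2].
  pose k := maxn N N'; exists k, [set v | forall y, dkey k y = v -> U y].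
  rewrite (_ : _ `\` U = set0); last first.
    by rewrite -subset0 => x [/= /(_ x erefl)].
  rewrite setU0 -FE -/(F k).
  have := N2 k (leq_maxr _ _); rewrite /= sub0r normrN => H.
  by rewrite -(fineK (N1 k (leq_maxl _ _))) lee_fin (le_trans (ler_norm _)).
split.
- split; first exact: measurable0.
  move=> e e0; exists 0%N, set0; rewrite preimage_set0 set0D set0U setI0 measure0.
  by rewrite lee_fin ltW.
- move=> A [mA PA]; split; first exact: measurableD.
  move=> e /PA[k [S SA]]; exists k, (~` S); rewrite (_ : _ `|` _ =
    (A `\` dkey k @^-1` S) `|` (dkey k @^-1` S `\` A))//.
  apply/seteqP; split => x /=; rewrite /setT; have := pselect (A x);
    have := pselect (S (dkey k x)); tauto.
- suff H (F : (set (borelRm R m))^nat) : (forall n, P (F n)) -> P (\bigcup_k F k).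
    exact: H.
  move=> PF; have mF k : measurable (F k) by have [] := PF k.
  have mUF : measurable (\bigcup_k F k) by exact: bigcupT_measurable.
  split=> // e e0.
  pose B n := \bigcup_(i < n) F i.
  have PB n : P (B n).
    elim: n => [|n IHn]; rewrite /B.
      rewrite bigcup_mkord big_ord0; split; first exact: measurable0.
      move=> e' e'0; exists 0%N, set0; rewrite preimage_set0 set0D set0U setI0 measure0.
      by rewrite lee_fin ltW.
    by rewrite bigcup_mkord big_ord_recr/= -bigcup_mkord; exact: PU.
  have mB n : measurable (B n) by have [] := PB n.
  have e20 : 0 < e / 2 by rewrite divr_gt0.
  pose D n := W `&` (\bigcup_k F k `\` B n).
  have mD n : measurable (D n : set (borelRm R m)).
    by apply: mWB; exact: measurableD.
  have : mu (D k) @[k --> \oo] --> mu (\bigcap_k D k).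
    apply: nonincreasing_cvg_mu => //.
    - by rewrite (le_lt_trans _ Woo)// le_measure ?inE//; exact: subIsetl.
    - exact: bigcapT_measurable.
    - move=> k l kl; apply/subsetPset; apply: setIS; apply: setDS.
      by move=> x [i /= ik Fi]; exists i => //=; exact: leq_trans kl.
  rewrite (_ : \bigcap_k D k = set0); last first.
    rewrite -subset0 => x Dx; have [_ [[k _ Fk] _]] := Dx 0%N I.
    by have [_ [_ []]] := Dx k.+1 I; exists k => /=.
  rewrite measure0 => /fine_cvgP[[N _ N1]] /cvgrPdist_le/(_ _ e20)[N' _ N2].
  pose n := maxn N N'.
  have [k [S SB]] := (PB n).2 _ e20; exists k, S.
  have De : (mu (D n) <= (e / 2)%:E)%E.
    have := N2 n (leq_maxr _ _); rewrite /= sub0r normrN => H.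
    by rewrite -(fineK (N1 n (leq_maxl _ _))) lee_fin (le_trans (ler_norm _)).
  rewrite (splitr e) EFinD; apply: le_trans (leeD De SB).
  apply: le_trans (measureU2 _ _ _) => //; last first.
    by apply: mWB; apply: measurableU; apply: measurableD.
  apply: le_measure; rewrite ?inE.
  - by apply: mWB; apply: measurableU; apply: measurableD.
  - apply: measurableU => //; apply: mWB; apply: measurableU; exact: measurableD.
  have BF : B n `<=` \bigcup_k F k by move=> x [i _ Fi]; exists i.
  move=> x /= [Wx]; have := BF x; have := pselect (B n x); rewrite /D/=; tauto.
Qed.

(** A weak form of the Lebesgue density theorem. If every cube lost more than the proportion [d], a
    union of cubes approximating [A] up to [e] would have mass at most [e / d], too small to carry
    [A]. *)
Lemma dyadic_density (A : set (borelRm R m)) (d : R) :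
  measurable A -> (0 < mu (W `&` A))%E -> 0 < d ->
  exists k v, (0 < mu (W `&` dkey k @^-1` [set v]))%E /\
    (mu (W `&` dkey k @^-1` [set v] `\` A) <= d%:E * mu (W `&` dkey k @^-1` [set v]))%E.
Proof.
move=> mA A0 d0; apply: contrapT => nH.
have mS k S := dkey_measurable k S.
have H k v : (mu (W `&` dkey k @^-1` [set v]) <=
    (d^-1)%:E * mu (W `&` dkey k @^-1` [set v] `\` A))%E.
  have [v0|v0] := leP (mu (W `&` dkey k @^-1` [set v])) 0%E.
    by rewrite (le_trans v0)// mule_ge0// lee_fin invr_ge0 ltW.
  rewrite muleC lee_pdivlMr// muleC leNgt; apply/negP => /ltW vA.
  by apply: nH; exists k, v.
pose a := fine (mu (W `&` A)).
have aE : mu (W `&` A) = a%:E.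
  rewrite fineK// ge0_fin_numE//; apply: (le_lt_trans _ Woo).
  by apply: le_measure; rewrite ?inE//; exact: measurableI.
have a0 : 0 < a by rewrite -lte_fin -aE.
have d1 : 0 < d^-1 by rewrite invr_gt0.
(* With this choice [(d^-1 + 1) * e] is half of [a], whereas the failure of the claim would make it
   at least [a]. *)
pose e := a / (2 * (d^-1 + 1)).
have e0 : 0 < e by rewrite divr_gt0// mulr_gt0// addr_gt0.
have [k [S SA]] := dyadic_approx mA e0.
pose D := dkey k @^-1` S.
have mD : mble D by exact: mS.
have mWDA : mble (W `&` D `\` A) by apply: measurableD => //; exact: measurableI.
have h1 : (mu (W `&` D) <= (d^-1)%:E * mu (W `&` D `\` A))%E.
  apply: (@le_measure_fibers _ (borelRm R m) _ mu _ (dkey k)) => //.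
  - exact: ltW.
  - exact: measurableI.
  move=> v; have [Sv|nSv] := pselect (S v); last first.
    rewrite (_ : W `&` D `&` _ = set0) ?measure0 ?mule_ge0 ?lee_fin ?(ltW d1)//.
    by rewrite -subset0 => x [[_ /= Sx]] /= xv; apply: nSv; rewrite -xv.
  rewrite (_ : W `&` D `&` _ = W `&` dkey k @^-1` [set v]); last first.
    apply/seteqP; split => x /=; first tauto.
    by move=> [Wx xv]; split => //; split => //; rewrite /D/= xv.
  rewrite (_ : (W `&` D `\` A) `&` _ = W `&` dkey k @^-1` [set v] `\` A)//.
  apply/seteqP; split => x /=; first tauto.
  move=> [[Wx xv] nA]; split => //; split => //; split => //.
  by rewrite /D/= xv.
have mE : mble (W `&` ((A `\` D) `|` (D `\` A))).
  by apply: measurableI => //; apply: measurableU; apply: measurableD.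
have h2 : (mu (W `&` D `\` A) <= e%:E)%E.
  by apply: le_trans SA; apply: le_measure; rewrite ?inE// => x /=; tauto.
have h3 : (mu (W `&` A) <= mu (W `&` D) + e%:E)%E.
  apply: le_trans (leeD (le_refl _) SA).
  apply: le_trans (measureU2 _ _ _) => //; last exact: measurableI.
  apply: le_measure; rewrite ?inE; [exact: measurableI| |].
    by apply: measurableU => //; exact: measurableI.
  by move=> x /=; have := pselect (D x); tauto.
have h4 : (mu (W `&` A) <= (d^-1 * e + e)%:E)%E.
  rewrite (le_trans h3)// EFinD leeD2r// (le_trans h1)// EFinM.
  by rewrite lee_pmul// lee_fin ltW.
move: h4; rewrite aE lee_fin -[X in _ * _ + X]mul1r -mulrDl /e.
have : 0 < d^-1 + 1 by rewrite addr_gt0.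
move: (d^-1 + 1) => w w0; rewrite (_ : w * (a / (2 * w)) = a / 2); last first.
  by field; rewrite gt_eqF.
by rewrite leNgt => /negP; apply; lra.
Qed.

End approximation.

End dyadic.

(** * Lebesgue measure under translations and linear maps *)

Section euclidean_norm.
Context (R : realType) (m : nat).
Implicit Types (x y z g : 'cV[R]_m).

Lemma dotpC x y : dotp x y = dotp y x.
Proof. by apply: eq_bigr => i _; rewrite mulrC. Qed.

Lemma dotpDl x y z : dotp (x + y) z = dotp x z + dotp y z.
Proof. by rewrite -big_split/=; apply: eq_bigr => i _; rewrite mxE mulrDl. Qed.

Lemma dotpZl a x z : dotp (a *: x) z = a * dotp x z.
Proof. by rewrite mulr_sumr; apply: eq_bigr => i _; rewrite mxE mulrA. Qed.

Lemma dotpDr x y z : dotp z (x + y) = dotp z x + dotp z y.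
Proof. by rewrite dotpC dotpDl !(dotpC z). Qed.

Lemma dotpZr a x z : dotp z (a *: x) = a * dotp z x.
Proof. by rewrite dotpC dotpZl dotpC. Qed.

Lemma dotp_ge0 x : 0 <= dotp x x.
Proof. by apply: sumr_ge0 => i _; rewrite -expr2 sqr_ge0. Qed.

Lemma enorm_ge0 x : 0 <= enorm x. Proof. exact: sqrtr_ge0. Qed.

Lemma sqr_enorm x : enorm x ^+ 2 = dotp x x.
Proof. by rewrite sqr_sqrtr// dotp_ge0. Qed.

Lemma enormZ a x : enorm (a *: x) = `|a| * enorm x.
Proof.
by rewrite /enorm dotpZl dotpZr mulrA -expr2 sqrtrM ?sqr_ge0// sqrtr_sqr.
Qed.

Lemma enormN x : enorm (- x) = enorm x.
Proof. by rewrite -scaleN1r enormZ normrN1 mul1r. Qed.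

Lemma norm_le_enorm x : `|x| <= enorm x.
Proof.
apply: norm_cV_le => [|i]; first exact: enorm_ge0.
rewrite -sqrtr_sqr /enorm ler_sqrt ?dotp_ge0// /dotp (bigD1 i)//= expr2 lerDl.
by apply: sumr_ge0 => j _; rewrite -expr2 sqr_ge0.
Qed.

Lemma dotp_le x y : dotp x y <= enorm x * enorm y.
Proof.
have [x0|x0] := eqVneq (enorm x) 0.
  have -> : x = 0.
    by apply/eqP; rewrite -normr_eq0 eq_le normr_ge0 andbT -x0 norm_le_enorm.
  by rewrite /dotp big1 ?mulr_ge0 ?enorm_ge0// => i _; rewrite mxE mul0r.
have [y0|y0] := eqVneq (enorm y) 0.
  have -> : y = 0.
    by apply/eqP; rewrite -normr_eq0 eq_le normr_ge0 andbT -y0 norm_le_enorm.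
  by rewrite /dotp big1 ?mulr_ge0 ?enorm_ge0// => i _; rewrite mxE mulr0.
have xy0 : 0 < enorm x * enorm y by rewrite mulr_gt0 ?lt_def ?x0 ?y0 ?enorm_ge0.
(* This square expands to twice the product of the norms times the difference between the right and
   the left side of the inequality. *)
have := dotp_ge0 (enorm y *: x + (- enorm x) *: y).
rewrite !(dotpDl, dotpDr, dotpZl, dotpZr) -!sqr_enorm (dotpC y x) => H.
rewrite -(ler_pM2l xy0); move: H.
move: (enorm x) (enorm y) (dotp x y) => a b c; nra.
Qed.

Lemma ler_enormD x y : enorm (x + y) <= enorm x + enorm y.
Proof.
rewrite -(@ler_pXn2r _ 2)// ?nnegrE ?addr_ge0 ?enorm_ge0//.
rewrite sqr_enorm !(dotpDl, dotpDr) sqrrD !sqr_enorm (dotpC y x).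
have := dotp_le x y; lra.
Qed.

Lemma dotp_norm_le x y : `|dotp x y| <= enorm x * enorm y.
Proof.
rewrite ler_norml dotp_le andbT lerNl.
by have := dotp_le (- x) y; rewrite enormN -scaleN1r dotpZl mulN1r.
Qed.

Lemma enorm_le_norm x : enorm x <= m%:R * `|x|.
Proof.
rewrite -(@ler_pXn2r _ 2)// ?nnegrE ?mulr_ge0 ?enorm_ge0//.
rewrite sqr_enorm exprMn; apply: (@le_trans _ _ (\sum_(i < m) `|x| ^+ 2)).
  apply: ler_sum => i _; rewrite -expr2 -(real_normK (num_real (x i ord0))).
  by rewrite ler_pXn2r ?nnegrE// le_norm_cV.
rewrite sumr_const card_ord -[leLHS]mulr_natl ler_wpM2r ?sqr_ge0//.
by rewrite expr2 -natrM ler_nat; case: (m) => // n; rewrite leq_pmulr.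
Qed.

Lemma enorm_lipschitz x y : `|enorm x - enorm y| <= m%:R * `|x - y|.
Proof.
apply: le_trans (enorm_le_norm _); rewrite ler_norml; apply/andP; split.
  rewrite lerNl opprB lerBlDl -(enormN (x - y)) opprB.
  by rewrite -[leLHS]/(enorm y) -{1}(subrKC x y) ler_enormD.
by rewrite lerBlDl -{1}(subrKC y x) ler_enormD.
Qed.

Definition eball y (r : R) : set 'cV[R]_m := [set x | enorm (x - y) < r].

Lemma eball_open y r : open (eball y r).
Proof.
have cf : continuous (fun x : 'cV[R]_m => enorm (x - y)).
  apply: (@lipschitz_continuous _ _ _ _ m%:R) => u v.
  by apply: le_trans (enorm_lipschitz _ _) _; rewrite opprB addrA subrK.
by move/continuousP : cf => /(_ _ (@open_lt R r)).
Qed.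

End euclidean_norm.

Section lebesgue.
Context (R : realType) (m : nat).
Local Notation V := ('cV[R]_m).
Local Notation mble := (@measurable _ (borelRm R m)).
Local Notation lam := (@lebesgue_Rm R m).

Let c (i : 'I_m) (x : V) : R := x i ord0.

Let c_cont i : continuous (c i).
Proof. exact: coord_continuous. Qed.

Let c_inv (x y : V) (e : R) : 0 <= e -> (forall i, `|c i x - c i y| <= e) ->
  `|x - y| <= 1 * e.
Proof.
move=> e0 xy; rewrite mul1r; apply: norm_cV_le => // i; rewrite !mxE.
exact: xy.
Qed.

Lemma translation_continuous (t : V) : continuous (fun x : V => x + t).
Proof.
apply: (@lipschitz_continuous _ _ _ _ 1) => u v.
by rewrite mul1r opprD addrACA subrr addr0.
Qed.

Lemma lebesgue_dyadic k v (t : V) :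
  lam ((fun x => x + t) @^-1` (dkey c k @^-1` [set v])) = ((2 ^+ k)^-1 ^+ m)%:E.
Proof.
have k0 : 0 < 2 ^+ k :> R by rewrite exprn_gt0.
pose A (i : 'I_m) : set (measurableTypeR R) :=
  `[(v i)%:~R / 2 ^+ k - t i ord0, ((v i)%:~R + 1) / 2 ^+ k - t i ord0[%classic.
have -> : (fun x => x + t) @^-1` (dkey c k @^-1` [set v]) =
    [set x : V | forall i, A i (x i ord0)].
  apply/seteqP; split => [x /= xv i|x /= H].
    rewrite /A/= in_itv/= -xv ffunE /c mxE lerBlDr ltrBrDr.
    rewrite ler_pdivrMr// ltr_pdivlMr// (mulrC (_ + _) (2 ^+ k)).
    have := floor_itv (2 ^+ k * (x i ord0 + t i ord0)).
    by rewrite intrD.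
  apply/ffunP => i; rewrite ffunE /c mxE; apply/floor_def; rewrite intrD.
  have := H i; rewrite /A/= in_itv/= lerBlDr ltrBrDr ler_pdivrMr// ltr_pdivlMr//.
  by rewrite mulrC.
rewrite lebesgue_Rm_box; last by move=> i; exact: measurable_itv.
rewrite (eq_bigr (fun=> ((2 ^+ k)^-1)%:E)); last first.
  move=> i _; rewrite /A lebesgue_measure_itv/= lte_fin ltrD2r ltr_pM2r ?invr_gt0//.
  by rewrite ltrDl ltr01 -EFinB; congr EFin; field; rewrite gt_eqF.
by rewrite prodEFin prodr_const card_ord.
Qed.

Lemma lebesgue_dyadic0 k v : lam (dkey c k @^-1` [set v]) = ((2 ^+ k)^-1 ^+ m)%:E.
Proof.
rewrite -(lebesgue_dyadic k v 0); congr (lam _); apply/seteqP.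
by split => x /=; rewrite addr0.
Qed.

Let pushf (f : V -> V) (cf : continuous f) :
  {nu : {measure set (borelRm R m) -> \bar R} | forall A, nu A = lam (f @^-1` A)}.
Proof.
have mf : measurable_fun setT (f : borelRm R m -> borelRm R m).
  by move=> _ A mA; rewrite setTI; exact: measurable_preimage.
by exists (measure_function_pushforward__canonical__measure_function_Measure
  (@lebesgue_Rm R m) mf).
Qed.

(** Translates of dyadic cubes are boxes with the same sides, so both measures agree on the
    cubes. *)
Lemma lebesgue_translate (t : V) (A : set V) : mble A ->
  lam ((fun x => x + t) @^-1` A) = lam A.
Proof.
move=> mA; have [nu nuE] := pushf (@translation_continuous t).
rewrite -nuE; apply: (dyadic_measure_unique c_cont c_inv) => // k v.
  by rewrite nuE lebesgue_dyadic; exact/esym/lebesgue_dyadic0.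
by rewrite nuE lebesgue_dyadic ltry.
Qed.

Let Q : set V := dkey c 0 @^-1` [set [ffun=> 0]].

(** No cubes are counted: all cubes of level [k] have the same [mu]-mass and the same volume, so
    [mu] is a fixed multiple of [lam] on each of them. Summing over those that make up [Q]
    identifies the factor, since [Q] has volume 1. *)
Lemma translation_invariant_lebesgue (mu : {measure set (borelRm R m) -> \bar R}) :
  (forall t A, mble A -> mu ((fun x : V => x + t) @^-1` A) = mu A) ->
  (mu Q < +oo)%E ->
  forall A, mble A -> mu A = (mu Q * lam A)%E.
Proof.
move=> muT muQ A mA.
have mc k v := measurable_dkey c_cont k v.
have muC k v : mu (dkey c k @^-1` [set v]) = mu (dkey c k @^-1` [set [ffun=> 0]]).
  rewrite -(muT (\col_i ((v i)%:~R / 2 ^+ k)))//; congr (mu _).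
  have k0 : 0 < 2 ^+ k :> R by rewrite exprn_gt0.
  have E (x : V) i : 2 ^+ k * c i (x + \col_i ((v i)%:~R / 2 ^+ k)) = 2 ^+ k * c i x + (v i)%:~R.
    by rewrite /c !mxE; field; rewrite gt_eqF.
  apply/seteqP; split => [x /= xv|x /= /ffunP xv]; apply/ffunP => i.
    have : dkey c k (x + \col_i ((v i)%:~R / 2 ^+ k)) i = v i by rewrite xv.
    rewrite !ffunE E => fv; apply/floor_def.
    by have := floor_itv (2 ^+ k * c i x + (v i)%:~R); rewrite fv intrD; lra.
  have := xv i; rewrite !ffunE E => fv; apply/floor_def.
  by have := floor_itv (2 ^+ k * c i x); rewrite fv !intrD; lra.
have kE k v : mu (dkey c k @^-1` [set v]) = (mu Q * lam (dkey c k @^-1` [set v]))%E.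
  have kQ (w : {ffun 'I_m -> int}) : Q `&` dkey c k @^-1` [set w] = set0 \/
      Q `&` dkey c k @^-1` [set w] = dkey c k @^-1` [set w].
    have [[y [Qy yw]]|] := pselect (Q `&` dkey c k @^-1` [set w] !=set0).
      right; apply: setIidr => x /= xw; rewrite /Q/= -Qy.
      by apply: (@dkey_nest _ _ _ 0 k) => //; rewrite xw yw.
    by move/nonemptyPn; left.
  pose w0 : {ffun 'I_m -> int} := [ffun=> 0].
  (* The cube of index 0 shares the origin with [Q], hence lies inside it and inherits its finite
     mass. *)
  have w0oo : (mu (dkey c k @^-1` [set w0]) < +oo)%E.
    have [Q0|Q1] := kQ w0; last first.
      rewrite -Q1; apply: le_lt_trans muQ; apply: le_measure; rewrite ?inE//.
        by apply: measurableI; exact: mc.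
      exact: mc.
    have : (Q `&` dkey c k @^-1` [set w0]) 0.
      by split; apply/ffunP => i; rewrite !ffunE /c mxE mulr0 floor0.
    by rewrite Q0.
  pose a := fine (mu (dkey c k @^-1` [set w0])).
  have aE : mu (dkey c k @^-1` [set w0]) = a%:E by rewrite fineK// ge0_fin_numE.
  have k0 : 0 < 2 ^+ k :> R by rewrite exprn_gt0.
  have -> : mu Q = ((a * (2 ^+ k) ^+ m)%:E * lam Q)%E.
    apply: (measure_fibers_scale (mc k)); first exact: mc.
    move=> w; have [->|->] := kQ w; first by rewrite !measure0 mule0.
    rewrite muC aE [X in (_ * X)%E]lebesgue_dyadic0 -EFinM -mulrA -exprMn.
    by rewrite divff ?gt_eqF// expr1n mulr1.
  rewrite muC aE [X in ((_ * X) * _)%E]lebesgue_dyadic0 expr0 invr1 expr1n mule1.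
  rewrite [X in (_ * X)%E]lebesgue_dyadic0 -EFinM -mulrA -exprMn.
  by rewrite divff ?gt_eqF// expr1n mulr1.
have [q q0 qE] : exists2 q, 0 <= q & mu Q = q%:E.
  by exists (fine (mu Q)); rewrite ?fine_ge0// fineK// ge0_fin_numE.
rewrite qE -[RHS]/(mscale (NngNum q0) lam A).
apply: (dyadic_measure_unique c_cont c_inv) => // k v.
  by rewrite kE qE.
by rewrite kE qE lebesgue_dyadic0 -EFinM ltry.
Qed.

Lemma bounded_lebesgue (A : set V) (B : R) : mble A ->
  (forall x, A x -> `|x| <= B) -> (lam A < +oo)%E.
Proof.
move=> mA AB; pose J (i : 'I_m) : set (measurableTypeR R) := `[- B, B + 1[%classic.
have mI i : measurable (J i) by exact: measurable_itv.
apply: (@le_lt_trans _ _ (lam [set x : V | forall i, J i (x i ord0)])).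
  apply: le_measure; rewrite ?inE//.
    rewrite (_ : mkset _ = \bigcap_(i in [set: 'I_m]) [set x : V | - B <= x i ord0 < B + 1]).
      apply: fin_bigcap_measurable => [|i _]; first exact: finite_finset.
      exact: (measurable_itvco _ _ (@c_cont i)).
    apply/seteqP; split => [x H i _|x H i].
      by have := H i; rewrite /J/= in_itv.
    by have := H i I; rewrite /J/= in_itv.
  move=> x Ax i; rewrite /J/= in_itv/=.
  have : `|x i ord0| <= B by exact: le_trans (le_norm_cV _ _) (AB _ Ax).
  by rewrite ler_norml => /andP[-> h]; rewrite (le_lt_trans h)// ltrDl.
rewrite lebesgue_Rm_box//.
rewrite (eq_bigr (fun=> (if - B < B + 1 then B + 1 + B else 0)%:E)).
  by rewrite prodEFin ltry.
move=> i _; rewrite /J lebesgue_measure_itv/= lte_fin.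
by case: ifP => // _; rewrite -EFinB opprK.
Qed.

Lemma open_lebesgue_gt0 (U : set V) x : open U -> U x -> (0 < lam U)%E.
Proof.
move=> oU Ux; move: (Ux); rewrite {1}(dkey_open c_inv oU) => -[k _ /= kU].
apply: (@lt_le_trans _ _ (lam (dkey c k @^-1` [set dkey c k x]))).
  by rewrite lebesgue_dyadic0 lte_fin exprn_gt0// invr_gt0 exprn_gt0.
apply: le_measure; rewrite ?inE//; first exact: measurable_dkey.
exact: measurable_open.
Qed.

(** The measure of preimages under [L] is translation invariant, hence a multiple of Lebesgue
    measure. No determinant is computed: [kappa] is the volume of the preimage of the unit cube,
    finite because this preimage is bounded and positive because it contains a nonempty open set. *)
Lemma lebesgue_linear (L L' : {linear V -> V}) : cancel L L' -> cancel L' L ->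
  exists2 kappa : R, 0 < kappa &
    forall A, mble A -> lam (L @^-1` A) = (kappa%:E * lam A)%E.
Proof.
move=> LK L'K; have cL := @linear_cV_continuous _ _ _ L.
have [mu muE] := pushf cL.
have mQ : mble Q by exact: measurable_dkey.
have [C C0 LC] := linear_cV_lipschitz L'.
have muQ : (mu Q < +oo)%E.
  rewrite muE; apply: (@bounded_lebesgue _ C); first exact: measurable_preimage.
  move=> x /= Qx; rewrite -(LK x) (le_trans (LC _))// ler_piMr//; first exact: ltW.
  apply: norm_cV_le => // i; have : Num.floor (2 ^+ 0 * c i (L x)) = 0.
    by move/ffunP : Qx => /(_ i); rewrite !ffunE.
  move=> f0; have := floor_itv (2 ^+ 0 * c i (L x)); rewrite f0 expr0 mul1r.
  by rewrite /c => /andP[x0 x1]; rewrite ger0_norm// ltW.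
have mu0 : (0 < mu Q)%E.
  rewrite muE; pose U : set V := eball (const_mx 2^-1) 2^-1.
  have oU : open U by exact: eball_open.
  apply: (@lt_le_trans _ _ (lam (L @^-1` U))).
    apply: (@open_lebesgue_gt0 _ (L' (const_mx 2^-1))).
      by move/continuousP : cL; exact.
    by rewrite /U /eball/= L'K subrr -(scale0r (0 : V)) enormZ normr0 mul0r; lra.
  apply: le_measure; rewrite ?inE.
  - by apply: measurable_preimage => //; exact: measurable_open.
  - exact: measurable_preimage.
  move=> x /= Ux; apply/ffunP => i; rewrite !ffunE; apply/floor_def.
  rewrite expr0 mul1r /c.
  have := le_lt_trans (le_norm_cV (L x - const_mx 2^-1) i)
    (le_lt_trans (norm_le_enorm _) Ux).
  by rewrite !mxE ltr_norml; lra.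
exists (fine (mu Q)); first by rewrite fine_gt0// mu0.
move=> A mA; rewrite -muE fineK ?ge0_fin_numE//.
apply: translation_invariant_lebesgue => // t B mB.
rewrite !muE (_ : L @^-1` _ = (fun x => x + L' t) @^-1` (L @^-1` B)).
  by apply: lebesgue_translate; exact: measurable_preimage.
by apply/seteqP; split => x /=; rewrite linearD/= L'K.
Qed.

(** Here the factor has to be explicit, since it measures the thin shells between concentric balls
    in [full_measure]. *)
Lemma lebesgue_scale (s : R) A : 0 < s -> mble A ->
  lam ((fun x : V => s *: x) @^-1` A) = ((s^-1 ^+ m)%:E * lam A)%E.
Proof.
move=> s0 mA; have cL : continuous (fun x : V => s *: x).
  by apply: (@lipschitz_continuous _ _ _ _ `|s|) => u v; rewrite -scalerBr normrZ.
have [mu muE] := pushf cL.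
have muQ : mu Q = (s^-1 ^+ m)%:E.
  pose I (i : 'I_m) : set (measurableTypeR R) := `[0, s^-1[%classic.
  rewrite muE (_ : _ @^-1` _ = [set x : V | forall i, I i (x i ord0)]).
    rewrite lebesgue_Rm_box; last by move=> i; exact: measurable_itv.
    rewrite (eq_bigr (fun=> (s^-1)%:E)) ?prodEFin ?prodr_const ?card_ord//.
    by move=> i _; rewrite /I lebesgue_measure_itv/= lte_fin invr_gt0 s0 -EFinB subr0.
  have E x : (0 <= x < s^-1) = (0 <= s * x < 1).
    by rewrite pmulr_rge0// -[X in _ = _ && X]ltr_pdivlMl// mulr1.
  apply/seteqP; split => [x /= /ffunP H i|x /= H].
    have := H i; rewrite !ffunE expr0 mul1r /c mxE /I/= in_itv/= E => f0.
    by have := floor_itv (s * x i ord0); rewrite f0.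
  apply/ffunP => i; rewrite !ffunE expr0 mul1r /c mxE; apply/floor_def.
  by have := H i; rewrite /I/= in_itv/= E.
rewrite -muE -muQ; apply: translation_invariant_lebesgue => //.
  move=> t B mB; rewrite !muE (_ : _ @^-1` (_ @^-1` B) =
      (fun x => x + s^-1 *: t) @^-1` ((fun x : V => s *: x) @^-1` B)).
    by apply: lebesgue_translate; exact: measurable_preimage.
  by apply/seteqP; split => x /=; rewrite scalerDr scalerA divff ?gt_eqF// scale1r.
by rewrite muQ ltry.
Qed.

Lemma lebesgue_eball_scale (y : V) (r s : R) : 0 < s ->
  lam (eball y (s * r)) = ((s ^+ m)%:E * lam (eball y r))%E.
Proof.
move=> s0; have mB y' r' : mble (eball y' r').
  by apply: measurable_open; exact: eball_open.
have E0 r' : lam (eball y r') = lam (eball 0 r').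
  rewrite -(lebesgue_translate y (mB _ _)); congr (lam _).
  by apply/seteqP; split => x; rewrite /eball/= addrK subr0.
rewrite !E0; have := lebesgue_scale s0 (mB 0 (s * r)).
rewrite (_ : _ @^-1` _ = eball 0 r).
  move=> ->; rewrite muleA -EFinM -exprMn divff ?gt_eqF// expr1n mul1e//.
apply/seteqP; split => x; rewrite /eball/= !subr0 enormZ gtr0_norm// ltr_pM2l//.
Qed.

End lebesgue.

(** * Coordinates and digits *)

Section frame.
Context (R : realType) (m : nat) (eta : m.-tuple 'cV[R]_m) (xi : 'cV[R]_m).
Hypothesis eta_basis : basis_of fullv eta.
Local Notation V := ('cV[R]_m).
Local Notation X := (fundamental_domain eta xi).

Definition cvec (f : 'I_m -> R) : V := \sum_(i < m) f i *: tnth eta i.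

(** The dual basis vector. Its inverse length is the distance between the hyperplanes carrying the
    two faces of [X] on which the coordinate [i] is 0 and 1. *)
Definition cgrad (i : 'I_m) : V := \col_j coord eta i (delta_mx j ord0).

Definition cpt (i : 'I_m) (x : V) : R := coord eta i (x - xi).

Lemma cvecE (f : 'I_m -> R) : cvec f = \sum_(i < m) f i *: eta`_i.
Proof. by apply: eq_bigr => i _; rewrite (tnth_nth 0). Qed.

Lemma coord_cvec f i : coord eta i (cvec f) = f i.
Proof. by rewrite cvecE coord_sum_free ?(basis_free eta_basis). Qed.

Lemma cvec_coord x : cvec (fun i => coord eta i x) = x.
Proof. by rewrite cvecE -(coord_basis eta_basis) ?memvf. Qed.

Lemma coord_dotp i x : coord eta i x = dotp (cgrad i) x.
Proof.
rewrite {1}(matrix_sum_delta x) linear_sum; apply: eq_bigr => j _.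
by rewrite big_ord1 linearZ /= mxE mulrC.
Qed.

Lemma cptD i x y : cpt i (x + y) = cpt i x + coord eta i y.
Proof. by rewrite /cpt addrAC linearD. Qed.

Lemma cptB i x y : cpt i (x - y) = cpt i x - coord eta i y.
Proof. by rewrite cptD linearN. Qed.

Lemma cptDcvec i x f : cpt i (x + cvec f) = cpt i x + f i.
Proof. by rewrite cptD coord_cvec. Qed.

Lemma cptBcvec i x f : cpt i (x - cvec f) = cpt i x - f i.
Proof. by rewrite cptB coord_cvec. Qed.

Lemma sub_cpt i x y : cpt i x - cpt i y = coord eta i (x - y).
Proof. by rewrite /cpt -linearB opprB addrA subrK. Qed.

Lemma cpt_conv i x y (t : R) :
  cpt i ((1 - t) *: x + t *: y) = (1 - t) * cpt i x + t * cpt i y.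
Proof.
rewrite /cpt (_ : _ - xi = (1 - t) *: (x - xi) + t *: (y - xi)).
  by rewrite linearD !linearZ.
rewrite !scalerBr addrACA -opprD -scalerDl subrK scale1r//.
Qed.

Lemma coord_le i x : `|coord eta i x| <= enorm (cgrad i) * enorm x.
Proof. by rewrite coord_dotp dotp_norm_le. Qed.

Lemma cpt_continuous i : continuous (cpt i).
Proof.
apply: (@lipschitz_continuous _ _ _ _ (enorm (cgrad i) * m%:R)) => x y.
rewrite sub_cpt (le_trans (coord_le _ _))// -mulrA ler_wpM2l ?enorm_ge0//.
exact: enorm_le_norm.
Qed.

Lemma cpt_inv (x y : V) (e : R) : 0 <= e ->
  (forall i, `|cpt i x - cpt i y| <= e) -> `|x - y| <= (\sum_i `|tnth eta i|) * e.
Proof.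
move=> e0 xy; rewrite -(cvec_coord (x - y)) mulr_suml.
apply: le_trans (ler_norm_sum _ _ _) _; apply: ler_sum => i _.
by rewrite normrZ mulrC ler_wpM2l// -sub_cpt.
Qed.

Lemma domainP x : X x <-> forall i, 0 <= cpt i x < 1.
Proof.
split=> [[f f01 <-] i|H].
  by rewrite /cpt addrAC subrr add0r coord_cvec; exact: f01.
exists (fun i => cpt i x) => //; rewrite -/(cvec _).
by rewrite -[X in _ + X](_ : x - xi = _) ?subrKC// -[LHS]cvec_coord.
Qed.

(** Lets [X] inherit from the dyadic cubes its measurability, its convexity and the initial bound on
    its shallow points. *)
Lemma domain_dkey : X = dkey cpt 0 @^-1` [set [ffun=> 0]].
Proof.
apply/seteqP; split => [x /domainP xX|x /= /ffunP xX].
  by apply/ffunP => i; rewrite !ffunE expr0 mul1r; apply/floor_def; exact: xX.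
apply/domainP => i; have := xX i; rewrite !ffunE expr0 mul1r => f0.
by have := floor_itv (cpt i x); rewrite f0.
Qed.

Lemma domain_measurable : @measurable _ (borelRm R m) X.
Proof. by rewrite domain_dkey; apply: measurable_dkey; exact: cpt_continuous. Qed.

Lemma domain_bounded : exists2 B : R, 0 <= B & forall x, X x -> `|x| <= B.
Proof.
exists ((\sum_i `|tnth eta i|) + `|xi|); first by rewrite addr_ge0// sumr_ge0.
move=> x /domainP xX; rewrite -{1}(subrK xi x) (le_trans (ler_normD _ _))// lerD2r.
rewrite -[leRHS]mulr1; apply: cpt_inv => // i.
rewrite {2}/cpt subrr linear0 subr0.
by have /andP[x0 x1] := xX i; rewrite ger0_norm// ltW.
Qed.

Lemma domain_lebesgue_fin : (lebesgue_Rm X < +oo)%E.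
Proof.
have [B _ BX] := domain_bounded.
by apply: bounded_lebesgue BX; exact: domain_measurable.
Qed.

Lemma domain_lebesgue_gt0 : (0 < @lebesgue_Rm R m X)%E.
Proof.
pose z : V := xi + cvec (fun=> 2^-1).
have cz i : cpt i z = 2^-1 by rewrite /z cptDcvec /cpt subrr linear0 add0r.
pose G := \sum_i enorm (cgrad i) + 1.
have sG0 : 0 <= \sum_i enorm (cgrad i) by apply: sumr_ge0 => i _; exact: enorm_ge0.
have G0 : 0 < G by rewrite ltr_wpDl.
apply: (@lt_le_trans _ _ (lebesgue_Rm (eball z (2 * G)^-1))).
  apply: (@open_lebesgue_gt0 _ _ _ z); first exact: eball_open.
  by rewrite /eball/= subrr -(scale0r (0 : V)) enormZ normr0 mul0r invr_gt0 mulr_gt0.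
apply: le_measure; rewrite ?inE.
- by apply: measurable_open; exact: eball_open.
- exact: domain_measurable.
move=> x zx; apply/domainP => i.
have : `|cpt i x - cpt i z| < 2^-1.
  rewrite sub_cpt; apply: le_lt_trans (coord_le _ _) _.
  apply: (@le_lt_trans _ _ (G * enorm (x - z))).
    rewrite ler_wpM2r ?enorm_ge0// /G (bigD1 i)//= -addrA lerDl addr_ge0//.
    by apply: sumr_ge0 => j _; exact: enorm_ge0.
  by rewrite -ltr_pdivlMl// -invfM mulrC.
by rewrite cz ltr_norml; lra.
Qed.

End frame.

(** * The expanding linear map, digits and itineraries *)

Section dynamics.
Context (R : realType) (m : nat) (beta : R) (M : 'M[R]_m)
  (eta : m.-tuple 'cV[R]_m) (xi : 'cV[R]_m).
Hypotheses (beta1 : 1 < beta) (Morth : orthogonal_mx M)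
  (eta_basis : basis_of fullv eta).
Local Notation V := ('cV[R]_m).
Local Notation X := (fundamental_domain eta xi).
Local Notation T := (rotbeta beta M eta xi).
Local Notation c := (cpt eta xi).
Local Notation mble := (@measurable _ (borelRm R m)).
Local Notation lam := (@lebesgue_Rm R m).

Let beta0 : 0 < beta. Proof. exact: lt_trans beta1. Qed.

Definition rexpand : V -> V := mulmx (beta *: M).
Definition rcontract : V -> V := mulmx (beta^-1 *: M^T).
HB.instance Definition _ := GRing.Linear.on rexpand.
HB.instance Definition _ := GRing.Linear.on rcontract.

Lemma rexpandE z : rexpand z = beta *: (M *m z).
Proof. by rewrite /rexpand scalemxAl. Qed.

Lemma rcontractE z : rcontract z = beta^-1 *: (M^T *m z).
Proof. by rewrite /rcontract scalemxAl. Qed.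

Lemma rexpandK : cancel rexpand rcontract.
Proof.
move=> x; rewrite /rexpand /rcontract mulmxA -scalemxAl -scalemxAr scalerA.
by rewrite mulVf ?gt_eqF// scale1r Morth mul1mx.
Qed.

Lemma rcontractK : cancel rcontract rexpand.
Proof.
move=> x; rewrite /rexpand /rcontract mulmxA -scalemxAl -scalemxAr scalerA.
by rewrite divff ?gt_eqF// scale1r (mulmx1C Morth) mul1mx.
Qed.

Lemma enorm_orth (x : V) : enorm (M *m x) = enorm x.
Proof.
have dE (y z : V) : dotp y z = (y^T *m z) ord0 ord0.
  by rewrite mxE; apply: eq_bigr => i _; rewrite mxE.
by rewrite /enorm !dE trmx_mul mulmxA -(mulmxA x^T) Morth mulmx1.
Qed.

Lemma enorm_orthT (x : V) : enorm (M^T *m x) = enorm x.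
Proof. by rewrite -enorm_orth mulmxA (mulmx1C Morth) mul1mx. Qed.

Lemma enorm_expand x : enorm (rexpand x) = beta * enorm x.
Proof. by rewrite rexpandE enormZ enorm_orth gtr0_norm. Qed.

Lemma iter_expandD n x y :
  iter n rexpand (x + y) = iter n rexpand x + iter n rexpand y.
Proof. by elim: n => //= n ->; rewrite linearD. Qed.

Lemma iter_contractD n x y :
  iter n rcontract (x + y) = iter n rcontract x + iter n rcontract y.
Proof. by elim: n => //= n ->; rewrite linearD. Qed.

Lemma iter_contractZ n a x : iter n rcontract (a *: x) = a *: iter n rcontract x.
Proof. by elim: n => //= n ->; rewrite linearZ. Qed.

Lemma iter_contractN n x : iter n rcontract (- x) = - iter n rcontract x.
Proof. by elim: n => //= n ->; rewrite linearN. Qed.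

Lemma iter_contractK n x : iter n rexpand (iter n rcontract x) = x.
Proof. by elim: n => // n IHn; rewrite iterSr iterS rcontractK. Qed.

Lemma iter_expandK n x : iter n rcontract (iter n rexpand x) = x.
Proof. by elim: n => // n IHn; rewrite iterSr iterS rexpandK. Qed.

(** The digit by its integer coordinates rather than as a vector: these live in a countable type, to
    which the lemmas on fibers apply. *)
Definition dig (z : V) : {ffun 'I_m -> int} := [ffun i => Num.floor (c i (rexpand z))].

Definition dvec (k : {ffun 'I_m -> int}) : V := cvec eta (fun i => (k i)%:~R).

Lemma lattice_dvec k : lattice eta (dvec k).
Proof. by exists (fun i => k i). Qed.

Lemma latticeP d : lattice eta d -> exists k, d = dvec k.
Proof.
by case=> k _ <-; exists [ffun i => k i]; apply: eq_bigr => i _; rewrite ffunE.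
Qed.

Lemma sub_dig_domain z : X (rexpand z - dvec (dig z)).
Proof.
apply/(domainP xi eta_basis) => i; rewrite cptBcvec// ffunE.
by have := floor_itv (c i (rexpand z)); rewrite intrD; lra.
Qed.

Lemma dig_unique z k : X (rexpand z - dvec k) -> dig z = k.
Proof.
move=> /(domainP xi eta_basis) zk; apply/ffunP => i; rewrite ffunE.
by apply/floor_def; have := zk i; rewrite cptBcvec// intrD; lra.
Qed.

Lemma digitE z : digit beta M eta xi z = dvec (dig z).
Proof.
have [d [[ld Xd] du]] :=
  translate_fundamental_domain_unique xi (beta *: (M *m z)) eta_basis.
rewrite /digit; have -> : dvec (dig z) = d.
  apply/esym/du; split; first exact: lattice_dvec.
  by exists (rexpand z - dvec (dig z)); [exact: sub_dig_domain|rewrite subrK rexpandE].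
by case: xgetP => [y _ [ly Xy]|/(_ d)[]//]; exact/esym/du.
Qed.

Lemma rotbetaE z : T z = rexpand z - dvec (dig z).
Proof. by rewrite /rotbeta digitE rexpandE. Qed.

Lemma rotbeta_domain z : X (T z).
Proof. by rewrite rotbetaE; exact: sub_dig_domain. Qed.

Lemma rotbeta_eq z k : X (rexpand z - dvec k) -> T z = rexpand z - dvec k.
Proof. by move=> /dig_unique <-; rewrite rotbetaE. Qed.

Lemma iter_domain n x : X x -> X (iter n T x).
Proof. by case: n => //= n _; exact: rotbeta_domain. Qed.

Lemma rexpand_continuous : continuous rexpand.
Proof. exact: (@linear_cV_continuous _ _ _ rexpand). Qed.

Lemma rcontract_continuous : continuous rcontract.
Proof. exact: (@linear_cV_continuous _ _ _ rcontract). Qed.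

Lemma measurable_dig k : mble (dig @^-1` [set k]).
Proof.
rewrite (_ : dig @^-1` _ = rexpand @^-1` (dkey c 0 @^-1` [set k])).
  apply: measurable_preimage; first exact: rexpand_continuous.
  by apply: measurable_dkey; exact: cpt_continuous.
have E z : dig z = dkey c 0 (rexpand z).
  by apply/ffunP => i; rewrite !ffunE expr0 mul1r.
by apply/seteqP; split => z /=; rewrite E.
Qed.

Lemma rotbeta_measurable (B : set V) : mble B -> mble (T @^-1` B).
Proof.
move=> mB; rewrite (_ : T @^-1` B = \bigcup_(k : {ffun 'I_m -> int})
    (dig @^-1` [set k] `&` rexpand @^-1` ((fun x : V => x + - dvec k) @^-1` (B : set V)))).
  apply: countable_bigcupT_measurable => [|k]; first exact: countableP.
  apply: measurableI; first exact: measurable_dig.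
  apply: measurable_preimage; first exact: rexpand_continuous.
  exact: (@measurable_preimage _ _ (fun x => x + - dvec k) _ (@translation_continuous _ _ _)).
apply/seteqP; split => [z /= Bz|z [k _ [/= <-]]].
  by exists (dig z) => //; split => //=; rewrite -rotbetaE.
by rewrite -rotbetaE.
Qed.

Lemma iter_rotbeta_measurable n (B : set V) : mble B -> mble (iter n T @^-1` B).
Proof.
elim: n B => // n IHn B mB; rewrite (_ : _ @^-1` B = iter n T @^-1` (T @^-1` B))//.
by apply: IHn; exact: rotbeta_measurable.
Qed.

(** Digits are listed latest first. The fibers are the cells, on each of which [iter n T] is
    [iter n rexpand] followed by a fixed translation. *)
Fixpoint itin n (x : V) : seq {ffun 'I_m -> int} :=
  if n is n'.+1 then dig (iter n' T x) :: itin n' x else [::].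

Lemma measurable_itin n s : mble (itin n @^-1` [set s]).
Proof.
elim: n s => [|n IHn] [|k s].
- by rewrite (_ : _ @^-1` _ = setT); [exact: measurableT|apply/seteqP; split].
- by rewrite (_ : _ @^-1` _ = set0); [exact: measurable0|apply/seteqP; split].
- by rewrite (_ : _ @^-1` _ = set0); [exact: measurable0|apply/seteqP; split].
rewrite (_ : _ @^-1` _ = iter n T @^-1` (dig @^-1` [set k]) `&` itin n @^-1` [set s]).
  by apply: measurableI => //; apply: iter_rotbeta_measurable; exact: measurable_dig.
by apply/seteqP; split => [x /= [-> ->]|x [/= -> ->]].
Qed.

Lemma itin_iter n x y : itin n x = itin n y ->
  iter n T y = iter n T x + iter n rexpand (y - x).
Proof.
elim: n => [_|n IHn]/=; first by rewrite addrC subrK.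
move=> [dxy cxy]; rewrite !rotbetaE -dxy (IHn cxy) linearD/=.
by rewrite addrAC.
Qed.

Lemma floor_conv (a b t : R) : 0 <= t <= 1 -> Num.floor a = Num.floor b ->
  Num.floor ((1 - t) * a + t * b) = Num.floor a.
Proof.
move=> t01 ab; apply/floor_def.
have := floor_itv a; have := floor_itv b; rewrite -ab !intrD.
move: ((Num.floor a)%:~R) => z /andP[b1 b2] /andP[a1 a2].
(* The endpoint [t = 1] is treated apart, because the strict upper bound below comes from the weight
   [1 - t] of [a]. *)
case/andP: t01 => t0; rewrite le_eqVlt => /orP[/eqP ->|t1]; first by lra.
have h1 : 0 <= t * (b - z) by rewrite mulr_ge0// subr_ge0.
have h2 : 0 <= (1 - t) * (a - z) by rewrite mulr_ge0// subr_ge0// ltW.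
have h3 : 0 <= t * (z + 1 - b) by rewrite mulr_ge0// subr_ge0 ltW.
have h4 : 0 < (1 - t) * (z + 1 - a) by rewrite mulr_gt0// subr_gt0.
by apply/andP; split; lra.
Qed.

(** Cells are convex by induction: on a cell the image is affine in the point, and prescribing one
    more digit confines affine functions to half-open intervals. *)
Lemma itin_conv n x y (t : R) : 0 <= t <= 1 -> itin n x = itin n y ->
  itin n ((1 - t) *: x + t *: y) = itin n x /\
  iter n T ((1 - t) *: x + t *: y) = (1 - t) *: iter n T x + t *: iter n T y.
Proof.
move=> t01; elim: n => [//|n IHn]/= [dxy /IHn[cE iE]].
have dE : dig (iter n T ((1 - t) *: x + t *: y)) = dig (iter n T x).
  apply/ffunP => i; rewrite !ffunE iE linearD !linearZ/= cpt_conv//.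
  apply: floor_conv => //; move/ffunP : dxy => /(_ i).
  by rewrite !ffunE.
split; first by rewrite cE dE.
rewrite !rotbetaE dE iE -dxy linearD !linearZ/= !scalerBr addrACA -opprD.
by rewrite -scalerDl subrK scale1r.
Qed.

Lemma lebesgue_expand : exists2 kappa : R, 0 < kappa &
  forall A, mble A -> lam (rexpand @^-1` A) = (kappa%:E * lam A)%E.
Proof. exact: (lebesgue_linear rexpandK rcontractK). Qed.

End dynamics.

(** * Growth estimate *)

Section fine_measure.
Context d (T : measurableType d) (R : realType) (mu : {measure set T -> \bar R}).
Implicit Types A B C : set T.

Lemma fine_measure_ge0 A : 0 <= fine (mu A).
Proof. by rewrite fine_ge0. Qed.

Lemma fine_measureK A : (mu A < +oo)%E -> (fine (mu A))%:E = mu A.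
Proof. by move=> Aoo; rewrite fineK// ge0_fin_numE. Qed.

Lemma measure_sub_fin A B : measurable A -> measurable B -> A `<=` B ->
  (mu B < +oo)%E -> (mu A < +oo)%E.
Proof. by move=> mA mB AB; apply: le_lt_trans; apply: le_measure; rewrite ?inE. Qed.

Lemma fine_measure_le A B : measurable A -> measurable B -> A `<=` B ->
  (mu B < +oo)%E -> fine (mu A) <= fine (mu B).
Proof.
move=> mA mB AB Boo; rewrite -lee_fin !fine_measureK//.
  by apply: le_measure; rewrite ?inE.
exact: measure_sub_fin Boo.
Qed.

Lemma fine_measure_leU A B C : measurable A -> measurable B -> measurable C ->
  A `<=` B `|` C -> (mu B < +oo)%E -> (mu C < +oo)%E ->
  fine (mu A) <= fine (mu B) + fine (mu C).
Proof.
move=> mA mB mC ABC Boo Coo; rewrite -lee_fin EFinD !fine_measureK//.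
  apply: (@le_trans _ _ (mu (B `|` C))); last exact: measureU2.
  by apply: le_measure; rewrite ?inE//; exact: measurableU.
apply: (measure_sub_fin mA (measurableU _ _ mB mC) ABC).
by apply: (le_lt_trans (measureU2 mu mB mC)); rewrite lte_add_pinfty.
Qed.

Lemma fine_measure_disjoint A B C : measurable A -> measurable B -> measurable C ->
  A `&` B = set0 -> A `|` B `<=` C -> (mu C < +oo)%E ->
  fine (mu A) + fine (mu B) <= fine (mu C).
Proof.
move=> mA mB mC AB0 ABC Coo.
have Aoo : (mu A < +oo)%E by apply: measure_sub_fin Coo => // x Ax; apply: ABC; left.
have Boo : (mu B < +oo)%E by apply: measure_sub_fin Coo => // x Ax; apply: ABC; right.
rewrite -lee_fin EFinD !fine_measureK// -measureU//.
by apply: le_measure; rewrite ?inE//; exact: measurableU.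
Qed.

Lemma fine_measure_sum A (F : (set T)^nat) n : measurable A ->
  (forall i, measurable (F i)) -> trivIset setT F -> (mu A < +oo)%E ->
  \sum_(i < n) fine (mu (A `&` F i)) <= fine (mu A).
Proof.
move=> mA mF tF Aoo.
suff : \sum_(i < n) fine (mu (A `&` F i)) <= fine (mu (A `&` \bigcup_(i < n) F i)).
  move=> /le_trans; apply; apply: fine_measure_le => //.
  by apply: measurableI => //; exact: bigcup_measurable.
elim: n => [|n IHn]; first by rewrite big_ord0 fine_measure_ge0.
rewrite big_ord_recr/=; apply: le_trans (lerD IHn (le_refl _)) _.
have mU k : measurable (\bigcup_(i < k) F i) by exact: bigcup_measurable.
apply: fine_measure_disjoint.
- exact: measurableI.
- exact: measurableI.
- exact: measurableI.
- rewrite -subset0 => x [[_ [i /= ilt Fi]] [_ Fn]].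
  have := tF i n I I; move/(_ (ex_intro _ x (conj Fi Fn))) => E.
  by rewrite E ltnn in ilt.
- move=> x [[Ax [i /= ilt Fi]]|[Ax Fn]]; split=> //.
    by exists i => //=; rewrite ltnS ltnW.
  by exists n => /=.
- by apply: measure_sub_fin Aoo => //; exact: measurableI.
Qed.

End fine_measure.

Section shift.
Context (R : realType) (m : nat).
Local Notation V := ('cV[R]_m).
Local Notation mble := (@measurable _ (borelRm R m)).
Local Notation lam := (@lebesgue_Rm R m).
Local Notation "\r A" := (fine (lam A)) (at level 10).

(* Translating by [q] moves each band to the next one, so the points of the
   first band that never leave [D] contribute at most [1/N] of the measure of
   [W], while the points that leave [D] inject into its shallow part. *)
Lemma shift_bound (W D : set V) (q : V) (B : (set V)^nat) (N : nat) :
  mble W -> mble D -> D `<=` W -> (lam W < +oo)%E ->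
  (forall i, mble (B i)) -> trivIset setT B -> (0 < N)%N ->
  (forall j x, (j.+1 < N)%N -> D x -> B j x -> W (x + q) /\ B j.+1 (x + q)) ->
  \r (D `&` B 0%N) <= \r ((W `\` D) `&` [set p | D (p - q)]) + \r W / N%:R.
Proof.
move=> mW mD DW Woo mB tB N0 H.
pose S := (W `\` D) `&` [set p | D (p - q)].
have mDq : mble [set p | D (p - q)].
  exact: (@measurable_preimage _ _ (fun x => x + - q) _ (@translation_continuous _ _ _)).
have mS : mble S by apply: measurableI => //; exact: measurableD.
have SW : S `<=` W by move=> x [[]].
have Soo : (lam S < +oo)%E by exact: measure_sub_fin Woo.
have Doo : (lam D < +oo)%E by exact: measure_sub_fin Woo.
have Boo (E : set V) j : mble E -> (lam E < +oo)%E -> (lam (E `&` B j) < +oo)%E.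
  move=> mE; apply: measure_sub_fin => //; exact: measurableI.
have step j : (j.+1 < N)%N -> \r (D `&` B j) <= \r (D `&` B j.+1) + \r (S `&` B j.+1).
  move=> jN; rewrite -(@lebesgue_translate _ _ (- q) (D `&` B j)); last exact: measurableI.
  have mDB : mble (D `&` B j) by exact: measurableI.
  apply: fine_measure_leU; [|exact: measurableI|exact: measurableI| |exact: Boo|exact: Boo].
    exact: (@measurable_preimage _ _ (fun x => x + - q) _ (@translation_continuous _ _ _)).
  move=> x /= [Dx Bx]; have [] := H j _ jN Dx Bx; rewrite subrK => Wx Bx1.
  by have [Dx1|nDx1] := pselect (D x); [left|right].
have chain j : (j < N)%N ->
    \r (D `&` B 0%N) <= \r (D `&` B j) + \sum_(i < j) \r (S `&` B i.+1).
  elim: j => [|j IHj] jN; first by rewrite big_ord0 addr0.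
  rewrite big_ord_recr/=; have := IHj (ltnW jN); have := step j jN; lra.
have chain2 j : (j < N)%N -> \r (D `&` B 0%N) - \r S <= \r (D `&` B j).
  move=> jN; have := chain j jN.
  have : \sum_(i < j) \r (S `&` B i.+1) <= \r S.
    apply: (@fine_measure_sum _ (borelRm R m) _ _ S (fun i => B i.+1)) => //.
    by move=> i k _ _ /(tB i.+1 k.+1 I I) [].
  lra.
have : \sum_(j < N) (\r (D `&` B 0%N) - \r S) <= \r W.
  apply: (@le_trans _ _ (\sum_(j < N) \r (D `&` B j))).
    by apply: ler_sum => j _; exact: chain2.
  apply: (@le_trans _ _ (\r D)); last exact: fine_measure_le.
  exact: (@fine_measure_sum _ (borelRm R m)).
rewrite sumr_const card_ord -[leLHS]mulr_natl => h.
by rewrite -lerBlDl ler_pdivlMr ?ltr0n// mulrC.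
Qed.

End shift.

(** [N] is the integer part of [s^-1], the number of bands of height [s] that fit into a unit
    interval. As [N] is at least 1, rounding costs at most a factor 2. *)
Lemma exists_cell_number (R : realType) (s : R) : 0 < s -> s <= 1 ->
  exists N, [/\ (0 < N)%N, N%:R * s <= 1 & N%:R^-1 <= 2 * s].
Proof.
move=> s0 s1; exists (Num.truncn s^-1).
have si1 : 1 <= s^-1 by rewrite invr_ge1// unitfE gt_eqF.
have /andP[h1 h2] : (Num.truncn s^-1)%:R <= s^-1 < (Num.truncn s^-1).+1%:R.
  by apply: truncn_itv; rewrite invr_ge0 ltW.
have N0 : (0 < Num.truncn s^-1)%N by rewrite truncn_gt0.
have N0R : 1 <= (Num.truncn s^-1)%:R :> R by rewrite ler1n.
split => //; first by rewrite -ler_pdivlMr// div1r.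
rewrite -[leLHS]mul1r ler_pdivrMr ?(lt_le_trans _ N0R)//.
have : s * s^-1 < s * (Num.truncn s^-1).+1%:R by rewrite ltr_pM2l.
rewrite divff ?gt_eqF// -natr1.
by move: N0R; move: (Num.truncn _)%:R => N; nra.
Qed.

Lemma convex_average (R : realType) (V : lmodType R) (C : set V) (s : seq V) :
  (forall x y (t : R), 0 <= t <= 1 -> C x -> C y -> C ((1 - t) *: x + t *: y)) ->
  s != [::] -> {in s, forall x, C x} -> C ((size s)%:R^-1 *: \sum_(x <- s) x).
Proof.
move=> Cc; elim: s => // p s IHs _ sC.
have Cp : C p by apply: sC; rewrite mem_head.
have [->|s0] := eqVneq s [::].
  by rewrite big_seq1 invr1 scale1r.
have Cs := IHs s0 (fun x xs => sC x (mem_behead (s := p :: s) xs)).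
have k0 : 0 < (size s)%:R :> R by rewrite ltr0n lt0n size_eq0.
rewrite big_cons/= -natr1; move: (\sum_(x <- s) x) k0 Cs => S.
move: (size s)%:R => k k0 CS.
(* The new average gives the weight [(k + 1)^-1] to the new point and the rest to the old
   average. *)
have t01 : 0 <= (k + 1)^-1 <= 1.
  by rewrite invr_ge0 invf_le1 ?lerDr ?ltr_wpDl ?ltW// addr_gt0.
have := Cc _ _ _ t01 CS Cp; congr C.
rewrite scalerA addrC scalerDr; congr (_ + _ *: _).
by field; rewrite !gt_eqF// addr_gt0.
Qed.

Section growth.
Context (R : realType) (m : nat) (beta : R) (M : 'M[R]_m)
  (eta : m.-tuple 'cV[R]_m) (xi : 'cV[R]_m) (i0 : 'I_m).
Hypotheses (beta1 : 1 < beta) (Morth : orthogonal_mx M)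
  (eta_basis : basis_of fullv eta).
Local Notation V := ('cV[R]_m).
Local Notation X := (fundamental_domain eta xi).
Local Notation T := (rotbeta beta M eta xi).
Local Notation c := (cpt eta xi).
Local Notation mble := (@measurable _ (borelRm R m)).
Local Notation lam := (@lebesgue_Rm R m).
Local Notation rexpand := (rexpand beta M).
Local Notation rcontract := (rcontract beta M).
Local Notation dig := (dig beta M eta xi).
Local Notation itin := (itin beta M eta xi).

(** The form in which the tube hypothesis enters the estimates: inside [X], all cuts of [T] are
    level sets of one coordinate. *)
Definition single_cut := forall y z : V, X y -> X z ->
  Num.floor (c i0 (rexpand z)) = Num.floor (c i0 (rexpand y)) -> dig z = dig y.

Hypothesis H0 : single_cut.

Let beta0 : 0 < beta. Proof. exact: lt_trans beta1. Qed.

Local Notation g := (cgrad eta i0).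

Lemma cgrad_gt0 (i : 'I_m) : 0 < enorm (cgrad eta i).
Proof.
rewrite lt_def enorm_ge0 andbT; apply/eqP => g0.
have := coord_le eta i (cvec eta (fun j => (j == i)%:R)).
by rewrite coord_cvec// g0 mul0r eqxx normr1 ler10.
Qed.

Definition ndir : V := (enorm g)^-1 *: g.

Lemma coord_ndir : coord eta i0 ndir = enorm g.
Proof.
rewrite coord_dotp /ndir dotpZr -sqr_enorm expr2 mulrA mulVf ?mul1r//.
by rewrite gt_eqF// cgrad_gt0.
Qed.

Lemma enorm_ndir : enorm ndir = 1.
Proof.
rewrite enormZ ger0_norm ?invr_ge0 ?enorm_ge0// mulVf// gt_eqF//.
exact: cgrad_gt0.
Qed.

(* A countable family of unit vectors, so that the sets [deep] below are
   measurable; it is stable under [M^T] so that depth can be followed from one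
   iterate of [T] to the next. *)
Definition hdir (j : bool * nat * option 'I_m) : V :=
  (-1) ^+ j.1.1 *: iter j.1.2 (mulmx M^T)
    (if j.2 is Some i then delta_mx i ord0 else ndir).

Lemma enorm_delta i : enorm (delta_mx i ord0 : V) = 1.
Proof.
rewrite /enorm /dotp (bigD1 i)//= !mxE !eqxx mulr1 big1 ?addr0 ?sqrtr1//.
by move=> k ki; rewrite !mxE (negbTE ki) mul0r.
Qed.

Lemma enorm_hdir j : enorm (hdir j) = 1.
Proof.
rewrite /hdir enormZ normrX normrN1 expr1n mul1r.
elim: j.1.2 => [|k]/=; last by rewrite enorm_orthT.
by case: j.2 => [i|]; [exact: enorm_delta|exact: enorm_ndir].
Qed.

Lemma hdirT j : M^T *m hdir j = hdir (j.1.1, j.1.2.+1, j.2).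
Proof. by rewrite /hdir/= -scalemxAr. Qed.

Section cell.
Context (W : set V).
Hypotheses (mW : mble W) (WX : W `<=` X).
Hypothesis Wc : forall x y (t : R), 0 <= t <= 1 -> W x -> W y ->
  W ((1 - t) *: x + t *: y).

(** Depth is measured in the image: displacements of length [a] are pulled back by [rcontract], so
    membership says roughly that [iter n T x] is at distance at least [a] from the boundary of the
    image of its cell. *)
Definition deep n (a : R) : set V := [set x | W x /\
  forall j, W (x + a *: iter n rcontract (hdir j)) /\
            itin n (x + a *: iter n rcontract (hdir j)) = itin n x].

Lemma deep_sub n a : deep n a `<=` W.
Proof. by move=> x []. Qed.

Lemma measurable_same_itin n (h : V) : mble [set x | itin n (x + h) = itin n x].
Proof.
have mc s : mble (itin n @^-1` [set s]) by exact: measurable_itin.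
rewrite (_ : mkset _ = \bigcup_(s : seq {ffun 'I_m -> int})
   (itin n @^-1` [set s] `&` (fun x : V => x + h) @^-1` (itin n @^-1` [set s]))).
  apply: countable_bigcupT_measurable => [|s]; first exact: countableP.
  apply: measurableI => //.
  exact: (@measurable_preimage _ _ _ _ (@translation_continuous _ _ h)).
by apply/seteqP; split => [x xh|x [s _ [/= ->]]//]; exists (itin n x).
Qed.

Lemma measurable_deep n a : mble (deep n a).
Proof.
rewrite (_ : deep n a = W `&` ~` \bigcup_(j : bool * nat * option 'I_m)
    ~` ((fun x : V => x + a *: iter n rcontract (hdir j)) @^-1` W `&`
     [set x | itin n (x + a *: iter n rcontract (hdir j)) = itin n x])).
  apply: measurableI => //; apply: measurableC.
  apply: countable_bigcupT_measurable => [|j]; first exact: countableP.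
  apply: measurableC; apply: measurableI; last exact: measurable_same_itin.
  exact: (@measurable_preimage _ _ _ _ (@translation_continuous _ _ _)).
apply/seteqP; split => [x [Wx Dx]|x [Wx Dx]]; split => //.
  by move=> [j _]; apply; exact: Dx.
by move=> j; apply: contrapT => nD; apply: Dx; exists j.
Qed.

(** Position of the next image between two consecutive cuts: the fractional part of the coordinate
    [i0] of [rexpand (iter n T x)]. *)
Definition height n (x : V) : R := c i0 (iter n.+1 T x).

Lemma heightE n x : height n x = c i0 (rexpand (iter n T x)) -
  (Num.floor (c i0 (rexpand (iter n T x))))%:~R.
Proof. by rewrite /height/= rotbetaE// cptBcvec// ffunE. Qed.

Lemma height_itv n x : 0 <= height n x < 1.
Proof.
by have /(domainP xi eta_basis) := rotbeta_domain beta M xi eta_basis (iter n T x); exact.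
Qed.

(** One step multiplies depth by [beta]: [rcontract] of a test direction is [beta^-1] times another
    test direction, along which [x] was already deep. *)
Lemma deep_expand n a x j : deep n (a / beta) x ->
  let x' := x + a *: iter n.+1 rcontract (hdir j) in
  [/\ W x', itin n x' = itin n x &
      rexpand (iter n T x') = rexpand (iter n T x) + a *: hdir j].
Proof.
move=> [Wx Dx] x'.
have x'E : x' = x + (a / beta) *: iter n rcontract (hdir (j.1.1, j.1.2.+1, j.2)).
  rewrite /x' iterSr -hdirT rcontractE iter_contractZ scalerA//.
have [Wx' cx'] := Dx (j.1.1, j.1.2.+1, j.2); rewrite -x'E in Wx' cx'.
split => //; have -> : iter n T x' = iter n T x + a *: rcontract (hdir j).
  rewrite (itin_iter eta_basis (esym cx')); congr (_ + _).
  by rewrite /x' addrAC subrr add0r iterSr -iter_contractZ iter_contractK.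
by rewrite linearD linearZ/= rcontractK.
Qed.

(** Only the new digit can go wrong, and a displacement of length [e] changes the coordinate [i0] by
    at most [e * enorm g], too little to cross a cut. *)
Lemma deep_next n e x : deep n (e / beta) x -> 0 <= e ->
  e * enorm g <= height n x < 1 - e * enorm g -> deep n.+1 e x.
Proof.
move=> Dx e0 /andP[h1 h2]; split; first by case: Dx.
move=> j; have /= [Wx' cx' Ex'] := deep_expand j Dx.
split => //=; rewrite cx'; congr (_ :: _).
have Xx : X x by apply: WX; case: Dx.
apply: H0; [exact: iter_domain|apply: iter_domain => //; exact: WX|].
rewrite Ex' cptD linearZ/=; apply/floor_def; rewrite intrD.
have : `|e * coord eta i0 (hdir j)| <= e * enorm g.
  rewrite normrM ger0_norm// ler_wpM2l//.
  by apply: le_trans (coord_le _ _ _) _; rewrite enorm_hdir mulr1.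
move: h1 h2; rewrite heightE ler_norml.
move: (c i0 (rexpand (iter n T x))) (Num.floor _)%:~R => u z; lra.
Qed.

(** The move that carries one band to the next when [shift_bound] is applied: upwards from the lower
    cut, downwards from the upper one. *)
Lemma deep_shift n e x (b : bool) : deep n (e / beta) x ->
  let s := (-1) ^+ b : R in
  0 <= height n x + s * (e * enorm g) < 1 ->
  let x' := x + (s * e) *: iter n.+1 rcontract ndir in
  [/\ W x', itin n x' = itin n x & height n x' = height n x + s * (e * enorm g)].
Proof.
move=> Dx s h x'; have /= [Wx' cx' Ex'] := deep_expand (b, 0%N, None) Dx.
have x'E : x' = x + e *: rcontract (iter n rcontract (hdir (b, 0, None)))%N.
  rewrite /x' (_ : hdir _ = s *: ndir)// -[rcontract (iter n _ _)]iterS.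
  by rewrite iter_contractZ scalerA (mulrC s).
rewrite -x'E in Wx' cx' Ex'; split => //; rewrite [LHS]heightE Ex' cptD linearZ/=.
rewrite /hdir/= -/s linearZ/= coord_ndir.
move: h; rewrite heightE mulrCA; move: (c i0 (rexpand (iter n T x))) => u h.
rewrite (_ : Num.floor (u + e * (s * enorm g)) = Num.floor u) 1?addrAC//.
by apply/floor_def; rewrite intrD; move: h; move: (Num.floor u)%:~R => z; lra.
Qed.

(** Source of the factor 2: [p] is the midpoint of [p - q] and [p + q], which lie in the same cell,
    and depth passes to midpoints by convexity. Hence a shallow point is never reached from deep
    points on both sides. *)
Lemma shallow_disjoint n e p : W p -> let q := e *: iter n.+1 rcontract ndir in
  deep n (e / beta) (p - q) -> deep n (e / beta) (p + q) -> deep n (e / beta) p.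
Proof.
move=> Wp q Dm Dp; split => // j.
have qE : q = (e / beta) *: iter n rcontract (hdir (false, 1, None)%N).
  rewrite /q iterSr rcontractE iter_contractZ scalerA.
  by rewrite /hdir/= scale1r.
have qE' : - q = (e / beta) *: iter n rcontract (hdir (true, 1, None)%N).
  rewrite qE -scalerN -iter_contractN; congr (_ *: iter _ _ _).
  by rewrite /hdir/= scaleN1r scale1r.
have cm : itin n p = itin n (p - q).
  by have [_ /(_ (false, 1%N, None))] := Dm; rewrite -qE subrK => -[].
have cp : itin n p = itin n (p + q).
  by have [_ /(_ (true, 1%N, None))] := Dp; rewrite -qE' addrK => -[].
set h := (e / beta) *: iter n rcontract (hdir j).
have [_ /(_ j)[Wm cmh]] := Dm; have [_ /(_ j)[Wp' cph]] := Dp.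
rewrite -/h in Wm cmh Wp' cph.
have hE : p + h = (1 - 2^-1) *: (p - q + h) + 2^-1 *: (p + q + h).
  rewrite (_ : 1 - 2^-1 = 2^-1); last by lra.
  rewrite -scalerDr addrACA -(addrA p) [- q + _]addrCA (addrA p p) addNr addr0.
  have -> : p + p + (h + h) = 2 *: (p + h) by rewrite scaler_nat mulr2n addrACA.
  by rewrite scalerA mulVf ?scale1r ?pnatr_eq0.
have t01 : 0 <= (2^-1 : R) <= 1 by lra.
have [cc _] := itin_conv eta_basis t01
  (etrans cmh (etrans (esym cm) (etrans cp (esym cph)))).
by rewrite hE; split; [exact: Wc|rewrite cc cmh -cm].
Qed.

(** By convexity it is enough to test the coordinate directions: the perturbed point is the average
    of [m] points, each moved along one axis by [m%:R * h i ord0], which is at most [a] in size. *)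
Lemma deep_ball n a x h : (0 < m)%N -> 0 < a -> deep n a x ->
  m%:R * `|h| <= a ->
  W (x + iter n rcontract h) /\ itin n (x + iter n rcontract h) = itin n x.
Proof.
move=> m0 a0 Dx ha.
pose C := [set y | W y /\ itin n y = itin n x].
have Cc y z (t : R) : 0 <= t <= 1 -> C y -> C z -> C ((1 - t) *: y + t *: z).
  move=> t01 [Wy cy] [Wz cz]; split; first exact: Wc.
  by have [-> _] := itin_conv eta_basis t01 (etrans cy (esym cz)).
pose p i := x + iter n rcontract ((m%:R * h i ord0) *: delta_mx i ord0).
have Cp i : C (p i).
  have Cpm (b : bool) : C (x + a *: iter n rcontract ((-1) ^+ b *: delta_mx i ord0)).
    have [_ /(_ (b, 0%N, Some i))] := Dx; exact.
  (* The weight that places [p i] on the segment between the two test points at [- a] and [a]. *)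
  pose t := (1 + m%:R * h i ord0 / a) / 2.
  have hi : `|m%:R * h i ord0 / a| <= 1.
    rewrite !normrM normfV (gtr0_norm a0) ler_pdivrMr// mul1r normr_nat.
    by apply: le_trans ha; rewrite ler_wpM2l// le_norm_cV.
  have t01 : 0 <= t <= 1 by move: hi; rewrite ler_norml /t; lra.
  have := Cc _ _ t t01 (Cpm true) (Cpm false); congr C.
  rewrite /p /= expr0 expr1 scaleN1r scale1r iter_contractN iter_contractZ.
  rewrite scalerN scalerBr scalerDr !scalerA addrACA -scalerDl subrK scale1r.
  rewrite -scaleNr -scalerDl; congr (_ + _ *: _).
  by rewrite /t; field; rewrite gt_eqF.
have := @convex_average R _ C [seq p i | i <- enum 'I_m] Cc.
rewrite -size_eq0 size_map -cardE card_ord -lt0n m0 => /(_ isT).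
rewrite big_map big_enum/= => /(_ _)/= H.
have {}H : C (m%:R^-1 *: \sum_(i < m) p i).
  by apply: H => _ /mapP[i _ ->].
suff <- : m%:R^-1 *: \sum_(i < m) p i = x + iter n rcontract h by case: H.
have m0R : m%:R != 0 :> R by rewrite pnatr_eq0 -lt0n.
have rcontract_sum (F : 'I_m -> V) :
    \sum_i iter n rcontract (F i) = iter n rcontract (\sum_i F i).
  elim/big_ind2 : _ => // [|u v w z -> ->]; last by rewrite iter_contractD.
  by rewrite -(scale0r (0 : V)) iter_contractZ !scale0r.
rewrite big_split/= sumr_const card_ord rcontract_sum scalerDr -[x *+ m]scaler_nat scalerA.
rewrite mulVf// scale1r -iter_contractZ; congr (_ + iter _ _ _).
rewrite scaler_sumr [in RHS](matrix_sum_delta h); apply: eq_bigr => i _.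
by rewrite big_ord1 scalerA mulKf.
Qed.

Local Notation "\r A" := (fine (lam A)) (at level 10).

(** A point loses its depth only if it is shallow already or lies in one of the two bands next to a
    cut. Both bands together are charged once to the shallow points, plus two errors [\r W / N%:R],
    each at most [2 * tau * \r W]. *)
Lemma shallow_step n e : 0 < e -> 
  \r (W `\` deep n.+1 e) <=
  2 * \r (W `\` deep n (e / beta)) + 4 * enorm g * e * \r W.
Proof.
move=> e0; pose tau := e * enorm g.
have tau0 : 0 < tau by rewrite mulr_gt0// cgrad_gt0.
have Woo : (lam W < +oo)%E.
  apply: (measure_sub_fin mW (domain_measurable xi eta_basis) WX).
  exact: domain_lebesgue_fin.
have r0 := fine_measure_ge0 (@lebesgue_Rm R m).
have mD n' a := measurable_deep n' a.
have mWD n' a : mble (W `\` deep n' a) by exact: measurableD.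
have WDoo n' a : (lam (W `\` deep n' a) < +oo)%E.
  by apply: measure_sub_fin Woo => //; exact: subDsetl.
(* If [tau] exceeds 1 no band fits, but then the error term alone exceeds the volume of [W]. *)
have [tau1|/ltW tau1] := leP tau 1; last first.
  have : \r (W `\` deep n.+1 e) <= \r W.
    by apply: fine_measure_le => //; exact: subDsetl.
  have : 1 * \r W <= tau * \r W by rewrite ler_wpM2r// r0.
  rewrite /tau; have := r0 (W `\` deep n (e / beta)); have := r0 W; nra.
have [N [N0 Nt Ni]] := exists_cell_number tau0 tau1.
pose q := e *: iter n.+1 rcontract ndir.
pose D := deep n (e / beta).
pose Bu j : set V := [set x | j%:R * tau <= height n x < j.+1%:R * tau].
pose Bd j : set V := [set x | 1 - j.+1%:R * tau <= height n x < 1 - j%:R * tau].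
have mB a b : mble [set x | a <= height n x < b].
  rewrite (_ : mkset _ = iter n.+1 T @^-1` [set y | a <= c i0 y < b])//.
  apply: iter_rotbeta_measurable => //.
  by apply: measurable_itvco; exact: cpt_continuous.
have trivB (F : (set V)^nat) : (forall j k x, F j x -> F k x -> (j <= k)%N) ->
    trivIset setT F.
  move=> FF j k _ _ [x [Fj Fk]]; apply/eqP; rewrite eqn_leq.
  by rewrite (FF j k x)// (FF k j x).
have ltS (j k : nat) : j%:R * tau < k.+1%:R * tau -> (j <= k)%N.
  by rewrite ltr_pM2r// ltr_nat ltnS.
have S1 (j : nat) : j.+1%:R * tau = j%:R * tau + tau by rewrite -natr1 mulrDl mul1r.
have Nle j : (j.+1 < N)%N -> j.+2%:R * tau <= 1.
  by move=> jN; apply: le_trans Nt; rewrite ler_pM2r// ler_nat.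
have up : \r (D `&` Bu 0%N) <= \r ((W `\` D) `&` [set p | D (p - q)]) + \r W / N%:R.
  apply: shift_bound => //.
  - exact: mD.
  - exact: deep_sub.
  - by move=> j; exact: mB.
  - by apply: trivB => j k x /andP[h1 _] /andP[_ h2]; apply: ltS; lra.
  move=> j x jN Dx /andP[h1 h2].
  have := @deep_shift n e x false Dx; rewrite /= expr0 !mul1r -/tau -/q => H.
  have := Nle j jN; move: h1 h2; rewrite !S1 => h1 h2 h3.
  have [|Wx _ hx] := H.
    by apply/andP; have /andP[] := height_itv n x; split; lra.
  split => //; rewrite /Bu/= hx !S1.
  by apply/andP; split; lra.
have down : \r (D `&` Bd 0%N) <= \r ((W `\` D) `&` [set p | D (p - - q)]) + \r W / N%:R.
  apply: shift_bound => //.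
  - exact: mD.
  - exact: deep_sub.
  - by move=> j; exact: mB.
  - by apply: trivB => j k x /andP[_ h1] /andP[h2 _]; apply: ltS; lra.
  move=> j x jN Dx /andP[h1 h2].
  have := @deep_shift n e x true Dx; rewrite /= expr1 !mulN1r scaleNr -/tau -/q => H.
  have := Nle j jN; move: h1 h2; rewrite !S1 => h1 h2 h3.
  have [|Wx _ hx] := H.
    by apply/andP; have /andP[] := height_itv n x; split; lra.
  split => //; rewrite /Bd/= hx !S1.
  by apply/andP; split; lra.
have DW := @deep_sub n (e / beta).
have mDq (z : V) : mble [set p | D (p - z)].
  apply: (@measurable_preimage _ _ (fun x => x + - z) _ (@translation_continuous _ _ _)).
  exact: mD.
have sums : \r ((W `\` D) `&` [set p | D (p - q)]) +
    \r ((W `\` D) `&` [set p | D (p - - q)]) <= \r (W `\` D).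
  apply: fine_measure_disjoint => //.
  - by apply: measurableI => //; exact: mWD.
  - by apply: measurableI => //; exact: mWD.
  - exact: mWD.
  - rewrite -subset0 => p [[[Wp nDp] /= Dm] [_ /=]]; rewrite opprK => Dp.
    by apply: nDp; exact: shallow_disjoint Dm Dp.
  - by move=> p [[]|[]].
  - exact: WDoo.
have tot : \r (W `\` deep n.+1 e) <=
    \r (W `\` D) + (\r (D `&` Bu 0%N) + \r (D `&` Bd 0%N)).
  have mDB a b : mble (D `&` [set x | a <= height n x < b]).
    by apply: measurableI => //; exact: mD.
  have DBoo a b : (lam (D `&` [set x | (a <= height n x < b)%R]) < +oo)%E.
    by apply: measure_sub_fin Woo => // x [/DW].
  have mU : mble ((D `&` Bu 0%N) `|` (D `&` Bd 0%N)).
    by apply: measurableU; exact: mDB.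
  have hU : \r ((D `&` Bu 0%N) `|` (D `&` Bd 0%N)) <= \r (D `&` Bu 0%N) + \r (D `&` Bd 0%N).
    by apply: fine_measure_leU; [|exact: mDB|exact: mDB| |exact: DBoo|exact: DBoo].
  apply: le_trans (lerD (le_refl _) hU).
  apply: fine_measure_leU => //.
  - exact: mWD.
  - move=> x [Wx nDx]; have [Dx|nD] := pselect (D x); last by left.
    right; have /andP[h1 h2] := height_itv n x.
    have [hl|hl] := ltP (height n x) tau.
      by left; split => //; rewrite /Bu/= mul0r mul1r h1.
    have [hr|hr] := leP (1 - tau) (height n x).
      by right; split => //; rewrite /Bd/= mul0r mul1r subr0 hr.
    by exfalso; apply: nDx; apply: deep_next => //; [exact: ltW|rewrite hl].
  - exact: WDoo.
  - by apply: measure_sub_fin Woo => // x [[/DW]|[/DW]].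
have : \r W / N%:R <= \r W * (2 * tau).
  by rewrite ler_wpM2l ?r0.
move: up down sums tot; rewrite -/D (_ : 4 * enorm g * e = 4 * tau); last first.
  by rewrite /tau; ring.
move: (\r ((W `\` D) `&` _)) (\r ((W `\` D) `&` _)) (\r (D `&` _)) (\r (D `&` _)).
move: (\r (W `\` _)) (\r (W `\` _)) (\r W / _) => *; lra.
Qed.

Hypothesis beta2 : 2 < beta.

(** The solution of [G = (2 / beta) * G + 4 * enorm g], the fixed point of the recursion that
    [shallow_step] imposes on the coefficient of [e * \r W]. *)
Definition growth_const : R := 4 * enorm g / (1 - 2 / beta).

(** The two terms are kept apart because [C0] depends on the shape and size of [W], while the other
    one is proportional to the volume of [W] and survives for large [n]. *)
Lemma shallow_bound (C0 : R) : 0 <= C0 ->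
  (forall e, 0 < e -> \r (W `\` deep 0 e) <= C0 * e) ->
  forall n e, 0 < e ->
    \r (W `\` deep n e) <= ((2 / beta) ^+ n * C0 + growth_const * \r W) * e.
Proof.
move=> C00 H; have b1 : 2 / beta < 1 by rewrite ltr_pdivrMr// mul1r.
have G0 : 0 <= growth_const.
  by rewrite divr_ge0 ?subr_ge0 ?(ltW b1)// mulr_ge0 ?enorm_ge0.
have GE : growth_const * (2 / beta) + 4 * enorm g = growth_const.
  by rewrite /growth_const; field; rewrite !gt_eqF ?subr_gt0//.
elim=> [|n IHn] e e0.
  rewrite expr0 mul1r (le_trans (H e e0))//; apply: ler_wpM2r; first exact: ltW.
  rewrite lerDl.
  by rewrite mulr_ge0// fine_measure_ge0.
apply: le_trans (shallow_step n e0) _.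
have e'0 : 0 < e / beta by rewrite divr_gt0.
have := IHn _ e'0; rewrite -{2}GE exprS.
move: (\r (W `\` _)) (\r W) ((2 / beta) ^+ n) growth_const => z w b G.
have -> : ((2 / beta * b * C0) + (G * (2 / beta) + 4 * enorm g) * w) * e =
  2 * ((b * C0 + G * w) * (e / beta)) + 4 * enorm g * e * w.
  by field; rewrite gt_eqF.
lra.
Qed.

End cell.
End growth.

Lemma fine_measure_le_sum d (T : measurableType d) (R : realType)
    (mu : {measure set T -> \bar R}) (I : eqType) (s : seq I) (A : set T)
    (F : I -> set T) : measurable A -> (forall i, measurable (F i)) ->
  (forall i, (mu (F i) < +oo)%E) -> (forall x, A x -> exists2 i, i \in s & F i x) ->
  fine (mu A) <= \sum_(i <- s) fine (mu (F i)).
Proof.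
move=> mA mF Foo; elim: s A mA => [|i s IHs] A mA AF.
  rewrite big_nil (_ : A = set0) ?measure0// -subset0 => x /AF[j].
  by rewrite in_nil.
rewrite big_cons.
have [AFi|nAFi] := pselect (A `<=` F i).
  apply: (@le_trans _ _ (fine (mu (F i)))); first exact: fine_measure_le.
  by rewrite lerDl sumr_ge0// => j _; exact: fine_measure_ge0.
have mAF : measurable (A `\` F i) by exact: measurableD.
have AFs x : (A `\` F i) x -> exists2 j, j \in s & F j x.
  move=> [/AF[j]]; rewrite inE => /orP[/eqP -> //|js Fj _]; by exists j.
apply: le_trans (lerD (le_refl _) (IHs _ mAF AFs)).
apply: fine_measure_leU => //.
  by move=> x Ax; have [Fx|nFx] := pselect (F i x); [left|right].
apply: (@le_lt_trans _ _ (\sum_(j <- s) mu (F j))%E); last first.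
  by elim: (s) => [|j s' IHs']; rewrite ?big_nil// big_cons lte_add_pinfty.
elim: {IHs AF} s (A `\` F i) mAF AFs => [|j s IHs] B mB BF.
  rewrite big_nil (_ : B = set0) ?measure0// -subset0 => x /BF[j].
  by rewrite in_nil.
rewrite big_cons; apply: (@le_trans _ _ (mu (F j) + mu (B `\` F j))%E).
  apply: le_trans (measureU2 _ _ _) => //; last exact: measurableD.
  apply: le_measure; rewrite ?inE//; first by apply: measurableU => //; exact: measurableD.
  by move=> x Bx; have [Fx|nFx] := pselect (F j x); [left|right].
apply: leeD => //; apply: IHs; first exact: measurableD.
move=> x [/BF[k]]; rewrite inE => /orP[/eqP -> //|ks Fk _]; by exists k.
Qed.

(** * Dyadic cubes as initial cells *)

Section cubes.
Context (R : realType) (m : nat) (beta : R) (M : 'M[R]_m)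
  (eta : m.-tuple 'cV[R]_m) (xi : 'cV[R]_m) (i0 : 'I_m).
Hypotheses (m_gt0 : (0 < m)%N) (beta2 : 2 < beta) (Morth : orthogonal_mx M)
  (eta_basis : basis_of fullv eta).
Hypothesis H0 : single_cut beta M eta xi i0.
Local Notation V := ('cV[R]_m).
Local Notation X := (fundamental_domain eta xi).
Local Notation T := (rotbeta beta M eta xi).
Local Notation c := (cpt eta xi).
Local Notation mble := (@measurable _ (borelRm R m)).
Local Notation lam := (@lebesgue_Rm R m).
Local Notation rexpand := (rexpand beta M).
Local Notation rcontract := (rcontract beta M).
Local Notation itin := (itin beta M eta xi).
Local Notation deep := (deep beta M eta xi i0).
Local Notation "\r A" := (fine (lam A)) (at level 10).

Let beta1 : 1 < beta. Proof. by apply: lt_trans beta2; rewrite ltr1n. Qed.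

Section cube.
Context (k : nat) (v : {ffun 'I_m -> int}).
Let W := dkey c k @^-1` [set v].

Lemma cube_measurable : mble W.
Proof. by apply: measurable_dkey; exact: cpt_continuous. Qed.

Lemma cubeP x : W x <-> forall i, (v i)%:~R <= 2 ^+ k * c i x < (v i)%:~R + 1.
Proof.
split => [/= <- i|H].
  by have := floor_itv (2 ^+ k * c i x); rewrite ffunE intrD.
by apply/ffunP => i; rewrite ffunE; apply/floor_def; have := H i; rewrite intrD.
Qed.

Lemma cube_conv x y (t : R) : 0 <= t <= 1 -> W x -> W y ->
  W ((1 - t) *: x + t *: y).
Proof.
move=> t01 /= /ffunP Wx /ffunP Wy; apply/ffunP => i.
have := Wx i; have := Wy i; rewrite !ffunE => fy fx.
rewrite cpt_conv// mulrDr mulrCA [X in _ + X]mulrCA floor_conv//.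
by rewrite fx fy.
Qed.

Lemma cube_sub x : W x -> X x -> W `<=` X.
Proof.
rewrite domain_dkey// => Wx Xx y Wy; rewrite /= -Xx.
by apply: (@dkey_nest _ _ _ 0 k) => //; rewrite (_ : dkey c k y = v)// -Wx.
Qed.

Hypothesis Woo : (lam W < +oo)%E.

(** An instance of [shift_bound] with the whole cube as its deep set: nothing leaves the cube while
    moving inwards, so only the share [1 / N] remains. *)
Lemma slab_bound (i : 'I_m) (s : R) (b : bool) : 0 < s ->
  \r (W `&` [set x | if b then 2 ^+ k * c i x < (v i)%:~R + s
                     else (v i)%:~R + 1 - s <= 2 ^+ k * c i x]) <= 2 * s * \r W.
Proof.
move=> s0; have k0 : 0 < 2 ^+ k :> R by rewrite exprn_gt0.
have cc : continuous (fun x : V => 2 ^+ k * c i x).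
  by move=> x; exact: (cvgM (cvg_cst _) (@cpt_continuous _ _ eta xi i x)).
have mW := cube_measurable.
have mB : mble [set x | if b then 2 ^+ k * c i x < (v i)%:~R + s
                     else (v i)%:~R + 1 - s <= 2 ^+ k * c i x].
  by case: b; [exact: (measurable_lt _ cc)|exact: (measurable_ge _ cc)].
have [s1|/ltW s1] := leP s 1; last first.
  apply: (@le_trans _ _ (\r W)).
    by apply: fine_measure_le => //; exact: measurableI.
  by have := fine_measure_ge0 lam W; nra.
have [N [N0 Ns Ni]] := exists_cell_number s0 s1.
(* Inward shift by one band: up from the lower face if [b] holds, down from the upper face
   otherwise. *)
pose q : V := cvec eta (fun l => if l == i then (if b then s else - s) / 2 ^+ k else 0).
pose B j : set V := if b
  then [set x | (v i)%:~R + j%:R * s <= 2 ^+ k * c i x < (v i)%:~R + j.+1%:R * s]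
  else [set x | (v i)%:~R + 1 - j.+1%:R * s <= 2 ^+ k * c i x < (v i)%:~R + 1 - j%:R * s].
have -> : W `&` [set x | if b then 2 ^+ k * c i x < (v i)%:~R + s
     else (v i)%:~R + 1 - s <= 2 ^+ k * c i x] = W `&` B 0%N.
  rewrite /B; case: (b); apply/seteqP; split => x /=; rewrite mul0r mul1r ?addr0 ?subr0.
  - by move=> [/cubeP Wx h]; split; [exact/cubeP|rewrite h; case/andP: (Wx i) => ->].
  - by move=> [Wx /andP[]].
  - by move=> [/cubeP Wx h]; split; [exact/cubeP|rewrite h; case/andP: (Wx i) => _ ->].
  - by move=> [Wx /andP[]].
have S1 (j : nat) : j.+1%:R * s = j%:R * s + s by rewrite -natr1 mulrDl mul1r.
have ltS (j l : nat) : j%:R * s < l.+1%:R * s -> (j <= l)%N.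
  by rewrite ltr_pM2r// ltr_nat ltnS.
have := @shift_bound _ _ W W q B N mW mW (fun x h => h) Woo.
rewrite setDv set0I measure0 add0r => H.
apply: le_trans (H _ _ N0 _) _.
- by move=> j; rewrite /B; case: (b); exact: (measurable_itvco _ _ cc).
- move=> j l _ _ [x [Fj Fl]]; apply/eqP; rewrite eqn_leq.
  move: Fj Fl; rewrite /B; case: (b) => /= /andP[h1 h2] /andP[h3 h4];
  by apply/andP; split; apply: ltS; lra.
- move=> j x jN /cubeP Wx Bx.
  have jN1 : j.+2%:R * s <= 1 by apply: le_trans Ns; rewrite ler_pM2r// ler_nat.
  have cq l : 2 ^+ k * c l (x + q) = 2 ^+ k * c l x +
      (if l == i then (if b then s else - s) else 0).
    rewrite /q cptDcvec// mulrDr; case: eqP => _; last by rewrite mulr0.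
    by rewrite mulrCA divff ?mulr1// gt_eqF.
  rewrite !S1 in jN1.
  split.
    apply/cubeP => l; rewrite cq; have := Wx l.
    case: eqP => [->|_]; last by rewrite addr0.
    move: Bx; rewrite /B; case: (b) => /=; rewrite !S1;
    by move=> /andP[h1 h2] /andP[h3 h4]; have : 0 <= j%:R * s;
      rewrite ?mulr_ge0 ?(ltW s0)// => hj; apply/andP; split; lra.
  move: Bx; rewrite /B; case: (b) cq => cq /=; rewrite cq eqxx !S1 => /andP[h1 h2]; by apply/andP; split; lra.
by rewrite mulrC ler_wpM2r// fine_measure_ge0.
Qed.

(** At time 0 itineraries are empty, so a shallow point is merely close to one of the [2 * m]
    faces. *)
Lemma cube_shallow_bound : exists2 C0 : R, 0 <= C0 &
  forall e, 0 < e -> \r (W `\` deep W 0 e) <= C0 * e.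
Proof.
have k0 : 0 < 2 ^+ k :> R by rewrite exprn_gt0.
pose G i := enorm (cgrad eta i).
have G0 i : 0 < G i by exact: cgrad_gt0.
exists (\sum_(p <- enum (('I_m * bool)%type : finType)) 2 * (2 ^+ k * G p.1) * \r W).
  by apply: sumr_ge0 => p _; rewrite !mulr_ge0 ?fine_measure_ge0 ?ltW.
move=> e e0.
pose F (p : 'I_m * bool) : set V := W `&` [set x | if p.2
  then 2 ^+ k * c p.1 x < (v p.1)%:~R + 2 ^+ k * G p.1 * e
  else (v p.1)%:~R + 1 - 2 ^+ k * G p.1 * e <= 2 ^+ k * c p.1 x].
have mW := cube_measurable.
have mF p : mble (F p).
  have cc : continuous (fun x : V => 2 ^+ k * c p.1 x).
    by move=> x; exact: (cvgM (cvg_cst _) (@cpt_continuous _ _ eta xi p.1 x)).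
  apply: measurableI => //.
  by case: p.2; [exact: (measurable_lt _ cc)|exact: (measurable_ge _ cc)].
have Foo p : (lam (F p) < +oo)%E by apply: measure_sub_fin Woo => // x [].
apply: (@le_trans _ _ (\sum_(p <- enum (('I_m * bool)%type : finType)) \r (F p))).
  apply: fine_measure_le_sum => //.
    by apply: measurableD => //; exact: measurable_deep.
  move=> x [Wx nD]; apply: contrapT => nF; apply: nD.
  have xF i : (v i)%:~R + 2 ^+ k * G i * e <= 2 ^+ k * c i x <
      (v i)%:~R + 1 - 2 ^+ k * G i * e.
    apply/andP; split; rewrite ?leNgt ?ltNge; apply/negP => h; apply: nF.
      by exists (i, true); [rewrite mem_enum|split => //=; rewrite ltNge].
    by exists (i, false); [rewrite mem_enum|split].
  split => // j; split => //=; apply/cubeP => i; rewrite cptD mulrDr.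
  have : `|2 ^+ k * coord eta i (e *: hdir M eta i0 j)| <= 2 ^+ k * G i * e.
    rewrite normrM (gtr0_norm k0) -mulrA ler_wpM2l ?(ltW k0)//.
    apply: le_trans (coord_le _ _ _) _.
    by rewrite enormZ gtr0_norm// enorm_hdir// mulr1.
  by have /andP[h1 h2] := xF i; rewrite ler_norml => /andP[h3 h4]; apply/andP; split; lra.
rewrite mulr_suml; apply: ler_sum => p _.
have s0 : 0 < 2 ^+ k * G p.1 * e by rewrite !mulr_gt0.
have := slab_bound p.1 p.2 s0; rewrite -/(F p) => /le_trans; apply.
by rewrite le_eqVlt; apply/orP; left; apply/eqP; ring.
Qed.

End cube.
End cubes.

(** * Uniform integrability *)

Section mixing.
Context (R : realType) (m : nat) (beta : R) (M : 'M[R]_m)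
  (eta : m.-tuple 'cV[R]_m) (xi : 'cV[R]_m) (i0 : 'I_m).
Hypotheses (m_gt0 : (0 < m)%N) (beta2 : 2 < beta) (Morth : orthogonal_mx M)
  (eta_basis : basis_of fullv eta).
Hypothesis H0 : single_cut beta M eta xi i0.
Local Notation V := ('cV[R]_m).
Local Notation X := (fundamental_domain eta xi).
Local Notation T := (rotbeta beta M eta xi).
Local Notation c := (cpt eta xi).
Local Notation mble := (@measurable _ (borelRm R m)).
Local Notation lam := (@lebesgue_Rm R m).
Local Notation rexpand := (rexpand beta M).
Local Notation rcontract := (rcontract beta M).
Local Notation itin := (itin beta M eta xi).
Local Notation deep := (deep beta M eta xi i0).
Local Notation "\r A" := (fine (lam A)) (at level 10).

Let beta1 : 1 < beta. Proof. by apply: lt_trans beta2; rewrite ltr1n. Qed.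
Let mX : mble X. Proof. exact: domain_measurable. Qed.
Let Xoo : (lam X < +oo)%E. Proof. exact: domain_lebesgue_fin. Qed.
Let mR0 : 0 < m%:R :> R. Proof. by rewrite ltr0n. Qed.

Lemma iter_expand_continuous n : continuous (iter n rexpand).
Proof.
elim: n => [|n IHn]; first by move=> x; exact: cvg_id.
have -> : iter n.+1 rexpand = rexpand \o iter n rexpand by [].
move=> x; apply: continuous_comp; first exact: IHn.
exact: rexpand_continuous.
Qed.

Lemma measurable_affine n (t : V) (B : set V) : mble B ->
  mble [set x | B (iter n rexpand x + t)].
Proof.
move=> mB; apply: (@measurable_preimage _ _ (iter n rexpand) [set y | B (y + t)]).
  exact: iter_expand_continuous.
exact: (@measurable_preimage _ _ _ _ (@translation_continuous _ _ t)).
Qed.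

Lemma lebesgue_affine : exists2 kappa : R, 0 < kappa &
  forall n (t : V) (B : set V), mble B ->
    lam [set x | B (iter n rexpand x + t)] = ((kappa ^+ n)%:E * lam B)%E.
Proof.
have [kappa k0 kE] := lebesgue_expand beta1 Morth.
exists kappa => // n t B mB.
suff H (C : set V) : mble C -> lam [set x | C (iter n rexpand x)] = ((kappa ^+ n)%:E * lam C)%E.
  rewrite (H [set x | B (x + t)]).
    by rewrite -(lebesgue_translate t mB).
  exact: (@measurable_preimage _ _ _ _ (@translation_continuous _ _ t)).
elim: n C => [|n IHn] C mC; first by rewrite expr0 mul1e.
have mC' : mble (rexpand @^-1` C).
  by apply: measurable_preimage => //; exact: rexpand_continuous.
rewrite -[X in lam X]/[set x | (rexpand @^-1` C) (iter n rexpand x)] IHn// kE//.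
by rewrite muleA -EFinM exprSr.
Qed.

Lemma itin_affine n x0 x : itin n x = itin n x0 ->
  iter n T x = iter n rexpand x + (iter n T x0 - iter n rexpand x0).
Proof.
move=> /esym/(itin_iter eta_basis) ->.
have -> : iter n rexpand (x - x0) = iter n rexpand x - iter n rexpand x0.
  by apply/eqP; rewrite eq_sym subr_eq -iter_expandD subrK.
by rewrite addrCA.
Qed.

(** The image of a cell covers a ball around the image of each of its deep points. Writing this
    through the affine branch, for points [b] of the source, avoids inverting [T]. *)
Lemma cell_ball (W : set V) n a x0 b :
  (forall x y (t : R), 0 <= t <= 1 -> W x -> W y -> W ((1 - t) *: x + t *: y)) ->
  0 < a -> deep W n a x0 ->
  eball (iter n T x0) (a / m%:R) (iter n rexpand b + (iter n T x0 - iter n rexpand x0)) ->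
  W b /\ itin n b = itin n x0.
Proof.
move=> Wc a0 Dx; rewrite /eball/= => hb.
pose h := iter n rexpand b - iter n rexpand x0.
have hE : iter n rexpand b + (iter n T x0 - iter n rexpand x0) - iter n T x0 = h.
  by rewrite addrCA addrAC subrr add0r.
rewrite hE in hb.
have bE : b = x0 + iter n rcontract h.
  have := iter_contractD beta M n (iter n rexpand x0) h.
  rewrite addrC subrK !iter_expandK//.
rewrite bE; apply: deep_ball Dx _ => //.
rewrite -ler_pdivlMl// mulrC; apply: ltW; apply: le_lt_trans hb.
exact: norm_le_enorm.
Qed.

Lemma domain_conv x y (t : R) : 0 <= t <= 1 -> X x -> X y ->
  X ((1 - t) *: x + t *: y).
Proof. by rewrite domain_dkey//; exact: cube_conv. Qed.

Lemma domain_shallow : exists2 C : R, 0 <= C &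
  forall n e, 0 < e -> \r (X `\` deep X n e) <= C * e.
Proof.
have [C0 C00 H] : exists2 C0 : R, 0 <= C0 &
    forall e, 0 < e -> \r (X `\` deep X 0 e) <= C0 * e.
  move: Xoo; rewrite domain_dkey// => Qoo.
  exact: cube_shallow_bound.
have b1 : 2 / beta < 1 by rewrite ltr_pdivrMr ?mul1r// (lt_trans _ beta2).
have b0 : 0 <= 2 / beta by rewrite divr_ge0// ltW// (lt_trans _ beta2).
have G0 : 0 <= growth_const beta eta i0.
  by rewrite divr_ge0 ?subr_ge0 ?(ltW b1)// mulr_ge0 ?enorm_ge0.
exists (C0 + growth_const beta eta i0 * \r X).
  by rewrite addr_ge0// mulr_ge0// fine_measure_ge0.
move=> n e e0.
have := shallow_bound beta1 Morth eta_basis H0 mX (fun x h => h) domain_conv beta2 C00 H n e0.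
move=> /le_trans; apply; apply: ler_wpM2r; first exact: ltW.
by rewrite lerD2r ler_piMl// exprn_ile1// ltW.
Qed.

(** Shallow points cost at most [C * e]. On a cell with a deep point the branch has constant
    Jacobian and its image contains a ball of radius [e / m%:R], so the share of the cell sent into
    [A] is at most the volume of [A] over that of the ball. *)
Lemma uniformly_integrable : exists2 C : R, 0 <= C & forall e, 0 < e ->
  exists2 K : R, 0 <= K & forall n (A : set V), mble A -> A `<=` X ->
    \r (X `&` iter n T @^-1` A) <= C * e + K * \r A.
Proof.
have [C C0 CE] := domain_shallow; exists C => // e e0.
have [kappa k0 kE] := lebesgue_affine.
pose b := \r (eball (0 : V) (e / m%:R)).
have em0 : 0 < e / m%:R by rewrite divr_gt0.
have mb (y : V) r : mble (eball y r) by apply: measurable_open; exact: eball_open.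
have boo : (lam (eball (0 : V) (e / m%:R)) < +oo)%E.
  apply: (@bounded_lebesgue _ _ _ (e / m%:R)) => // x; rewrite /eball/= subr0 => h.
  exact: le_trans (norm_le_enorm x) (ltW h).
have b0 : 0 < b.
  rewrite /b fine_gt0// boo andbT.
  apply: (@open_lebesgue_gt0 _ _ _ 0); first exact: eball_open.
  by rewrite /eball/= subrr -(scale0r (0 : V)) enormZ normr0 mul0r.
exists (\r X / b); first by rewrite divr_ge0 ?fine_measure_ge0// ltW.
move=> n A mA AX.
have mTA : mble (iter n T @^-1` A) by exact: iter_rotbeta_measurable.
have mD : mble (deep X n e) by exact: measurable_deep.
have DX : deep X n e `<=` X by exact: deep_sub.
have Aoo : (lam A < +oo)%E by exact: (measure_sub_fin mA mX AX Xoo).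
have mDT : mble (deep X n e `&` iter n T @^-1` A) by exact: measurableI.
have key : (lam (deep X n e `&` iter n T @^-1` A) <= (\r A / b)%:E * lam X)%E.
  apply: (@le_measure_fibers _ (borelRm R m) _ lam _ (itin n)) => //.
  - by move=> s; exact: measurable_itin.
  - by rewrite divr_ge0 ?fine_measure_ge0// ltW.
  move=> s; have [[x0 [D0 s0]]|/nonemptyPn Ds] := pselect ((deep X n e `&` itin n @^-1` [set s]) !=set0);
    last first.
    rewrite (_ : _ `&` _ = set0) ?measure0.
      by rewrite mule_ge0// lee_fin divr_ge0 ?fine_measure_ge0// ltW.
    by rewrite -subset0 => x [[Dx _] sx]; rewrite -Ds.
  pose t := iter n T x0 - iter n rexpand x0.
  apply: (@le_trans _ _ (lam [set x | A (iter n rexpand x + t)])).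
    apply: le_measure; rewrite ?inE.
    - by apply: measurableI => //; exact: measurable_itin.
    - exact: measurable_affine.
    move=> x [[_ /= Ax] sx]; rewrite /t -itin_affine//.
    by rewrite sx.
  pose Bl : set V := [set x | eball (iter n T x0) (e / m%:R) (iter n rexpand x + t)].
  rewrite kE//; apply: (@le_trans _ _ ((\r A / b)%:E * lam Bl)%E).
    rewrite /Bl kE// (_ : lam (eball (iter n T x0) (e / m%:R)) = b%:E).
      rewrite -[lam A]fine_measureK// -!EFinM lee_fin.
      rewrite (_ : _ / b * _ = kappa ^+ n * \r A)//.
      by field; rewrite gt_eqF.
    rewrite /b fine_measureK// -(lebesgue_translate (iter n T x0) (mb _ _)).
    by congr (lam _); apply/seteqP; split => x; rewrite /eball/= addrK subr0.
  apply: lee_wpmul2l; first by rewrite lee_fin divr_ge0 ?fine_measure_ge0// ltW.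
  apply: le_measure; rewrite ?inE.
  - exact: measurable_affine.
  - by apply: measurableI => //; exact: measurable_itin.
  move=> x /= /(cell_ball domain_conv e0 D0)[Xx ->]; split => //.
have {}key : \r (deep X n e `&` iter n T @^-1` A) <= \r X / b * \r A.
  rewrite -lee_fin fine_measureK.
    rewrite (_ : \r X / b * \r A = \r A / b * \r X); last by ring.
    by rewrite EFinM [X in (_ <= _ * X)%E]fine_measureK.
  by apply: measure_sub_fin Xoo => // x [/DX].
apply: le_trans (lerD (CE n e e0) key).
apply: fine_measure_leU.
- exact: measurableI.
- exact: measurableD.
- by [].
- by move=> x [Xx Ax]; have [Dx|nD] := pselect (deep X n e x); [right|left].
- by apply: measure_sub_fin Xoo => //; exact: measurableD.
- by apply: measure_sub_fin Xoo => // x [/DX].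
Qed.

(* Dyadic density gives a cube almost filled by [C]; by the growth lemma, half
   of its mass sits deep inside cells of a high iterate of [T], and one such cell
   is mapped over a ball of fixed radius that [C] still almost fills. *)
Lemma almost_full_ball (C : set V) : mble C -> C `<=` X ->
  (forall x, C x -> C (T x)) -> (0 < lam C)%E ->
  exists2 r : R, 0 < r & forall d, 0 < d -> exists y : V,
    eball y r `<=` X /\ (lam (eball y r `\` C) <= d%:E)%E.
Proof.
move=> mC CX TC C0.
have [kappa k0 kE] := lebesgue_affine.
have b1 : 2 / beta < 1 by rewrite ltr_pdivrMr ?mul1r// (lt_trans _ beta2).
have b0 : 0 <= 2 / beta by rewrite divr_ge0// ltW// (lt_trans _ beta2).
have G0 : 0 < growth_const beta eta i0.
  by rewrite divr_gt0 ?subr_gt0// mulr_gt0// cgrad_gt0.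
(* Makes [growth_const * e] a quarter; with another quarter for the transient term, bounded below by
   the choice of [n], at least half of the cube is deep. *)
pose e := (4 * growth_const beta eta i0)^-1.
have e0 : 0 < e by rewrite invr_gt0 mulr_gt0.
have Ge : growth_const beta eta i0 * e = 4^-1.
  by rewrite /e; field; rewrite gt_eqF.
exists (e / m%:R) => [|d d0]; first by rewrite divr_gt0.
have rX0 : 0 < \r X by rewrite fine_gt0// domain_lebesgue_gt0.
(* The factor 4 pays for discarding the shallow half of the cube and for selecting a good cell;
   [\r X] bounds the volume of the image of that cell. *)
pose d1 : R := d / (4 * \r X).
have d10 : 0 < d1 by rewrite divr_gt0// mulr_gt0.
have [k [v [W0 WC]]] : exists k v, (0 < lam (X `&` dkey c k @^-1` [set v]))%E /\
    (lam (X `&` dkey c k @^-1` [set v] `\` C) <=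
     (d1)%:E * lam (X `&` dkey c k @^-1` [set v]))%E.
  apply: (dyadic_density (@cpt_continuous _ _ eta xi) (cpt_inv eta_basis)) => //.
  by rewrite setIidr.
set W := dkey c k @^-1` [set v] in W0 WC.
have [x1 [Xx1 Wx1]] : (X `&` W) !=set0.
  by apply/set0P/eqP => E; rewrite E measure0 ltxx in W0.
have WX : W `<=` X by exact: cube_sub Wx1 Xx1.
rewrite setIidr// in W0 WC.
have mW : mble W by exact: cube_measurable.
have Woo : (lam W < +oo)%E by exact: measure_sub_fin Xoo.
have [CW CW0 CWE] : exists2 CW : R, 0 <= CW &
    forall e, 0 < e -> \r (W `\` deep W 0 e) <= CW * e by exact: cube_shallow_bound.
have Wc x y (t : R) : 0 <= t <= 1 -> W x -> W y -> W ((1 - t) *: x + t *: y).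
  exact: cube_conv.
have rW0 : 0 < \r W by rewrite fine_gt0// W0.
have [n hn] : exists n, (2 / beta) ^+ n * CW * e <= \r W / 4.
  have : 0 < \r W / 4 by rewrite divr_gt0.
  have : (fun n => (2 / beta) ^+ n * (CW * e)) @ \oo --> (0 : R).
    rewrite -[X in _ --> X](mul0r (CW * e)); apply: cvgMr_tmp.
    by apply: cvg_expr; rewrite ger0_norm.
  move=> /cvgrPdist_le H w0; have [N _ HN] := H _ w0.
  exists N; have := HN N (leqnn N); rewrite /= sub0r normrN mulrA.
  by apply: le_trans; exact: ler_norm.
have mD : mble (deep W n e) by exact: measurable_deep.
have DW : deep W n e `<=` W by exact: deep_sub.
have Doo : (lam (deep W n e) < +oo)%E by exact: measure_sub_fin Woo.
have half : \r W / 2 <= \r (deep W n e).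
  have := shallow_bound beta1 Morth eta_basis H0 mW WX Wc beta2 CW0 CWE n e0.
  rewrite mulrDl [X in _ + X]mulrAC Ge => h1.
  have : \r W <= \r (W `\` deep W n e) + \r (deep W n e).
    apply: fine_measure_leU => //.
    - exact: measurableD.
    - by move=> x Wx; have [Dx|nD] := pselect (deep W n e x); [right|left].
    - by apply: measure_sub_fin Woo => //; exact: measurableD.
  lra.
have mWC : mble (W `\` C) by exact: measurableD.
have WC2 : (lam (W `\` C) <= (2 * d1)%:E * lam (deep W n e))%E.
  apply: le_trans WC _; rewrite -[lam W]fine_measureK// -[lam (deep W n e)]fine_measureK//.
  rewrite -!EFinM lee_fin; move: half d10.
  by move: (fine _) (fine _) => a b h1 h2; nra.
(* If the inequality failed on every cell, summation would bound the volume of the deep set by half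
   of itself. *)
have [s [x0 [D0 s0]] sC] : exists2 s, (deep W n e `&` itin n @^-1` [set s]) !=set0 &
    (lam ((W `\` C) `&` itin n @^-1` [set s]) <=
      (4 * d1)%:E * lam (deep W n e `&` itin n @^-1` [set s]))%E.
  apply: contrapT => nex.
  have d40 : 0 < 4 * d1 by rewrite mulr_gt0.
  have : (lam (deep W n e) <= ((4 * d1)^-1)%:E * lam (W `\` C))%E.
    apply: (@le_measure_fibers _ (borelRm R m) _ lam _ (itin n)) => //.
    - by move=> s; exact: measurable_itin.
    - by rewrite invr_ge0 ltW.
    move=> s; have [Ds|/nonemptyPn ->] := pselect ((deep W n e `&` itin n @^-1` [set s]) !=set0);
      last by rewrite measure0 mule_ge0// lee_fin invr_ge0 ltW.
    rewrite muleC lee_pdivlMr// muleC leNgt; apply/negP => /ltW sC.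
    by apply: nex; exists s.
  rewrite muleC lee_pdivlMr// => h; have := le_trans h WC2.
  rewrite -[lam (deep W n e)]fine_measureK// -!EFinM lee_fin leNgt => /negP; apply.
  have : 0 < \r (deep W n e) by apply: lt_le_trans half; rewrite divr_gt0.
  have hh (a : R) : 0 < a -> 2 * d1 * a < a * (4 * d1) by move: d10; nra.
  exact: hh.
pose t := iter n T x0 - iter n rexpand x0.
exists (iter n T x0); split.
  move=> y yB; pose b := iter n rcontract (y - t).
  have bE : iter n rexpand b + t = y by rewrite iter_contractK// subrK.
  have [Wb sb] : W b /\ itin n b = itin n x0.
    by apply: (cell_ball Wc e0 D0); rewrite -/t bE.
  rewrite -bE /t -itin_affine//; apply: iter_domain => //; exact: WX.
have mB : mble (eball (iter n T x0) (e / m%:R) `\` C).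
  by apply: measurableD => //; apply: measurable_open; exact: eball_open.
have kn0 : 0 < kappa ^+ n by rewrite exprn_gt0.
have iterC j x : C x -> C (iter j T x) by move=> Cx; elim: j => //= j; exact: TC.
have step1 : ((kappa ^+ n)%:E * lam (eball (iter n T x0) (e / m%:R) `\` C) <=
    lam ((W `\` C) `&` itin n @^-1` [set s]))%E.
  rewrite -(kE n t)//; apply: le_measure; rewrite ?inE.
  - exact: measurable_affine.
  - by apply: measurableI => //; exact: measurable_itin.
  move=> x [/= xB nC]; have [Wx sx] := cell_ball Wc e0 D0 xB.
  split; last by rewrite /= sx.
  by split => // Cx; apply: nC; rewrite /t -itin_affine//; exact: iterC.
have step2 : (lam (deep W n e `&` itin n @^-1` [set s]) <= (kappa ^+ n)%:E * lam X)%E.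
  rewrite -(kE n t)//; apply: le_measure; rewrite ?inE.
  - by apply: measurableI => //; exact: measurable_itin.
  - exact: measurable_affine.
  move=> x [Dx sx] /=; rewrite /t -itin_affine//; last by rewrite sx.
  by apply: iter_domain => //; apply: WX; exact: DW.
have : ((kappa ^+ n)%:E * lam (eball (iter n T x0) (e / m%:R) `\` C) <=
    (kappa ^+ n)%:E * d%:E)%E.
  apply: le_trans step1 _; apply: le_trans sC _.
  apply: (@le_trans _ _ ((4 * d1)%:E * ((kappa ^+ n)%:E * lam X))%E).
    by apply: lee_wpmul2l => //; rewrite lee_fin mulr_ge0// ltW.
  rewrite -[lam X]fine_measureK// -!EFinM lee_fin /d1.
  have hh (a : R) : 0 < a -> 4 * (d / (4 * a)) * (kappa ^+ n * a) <= kappa ^+ n * d.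
    move=> a0; rewrite le_eqVlt; apply/orP; left; apply/eqP; field.
    by rewrite gt_eqF.
  exact: hh.
by rewrite lee_pmul2l.
Qed.

End mixing.

(** * Spreading of forward invariant sets *)

Lemma ultra_bounded_cvg (R : realType) (F : set_system nat) (u : nat -> R) (B : R) :
  UltraFilter F -> (forall n, `|u n| <= B) -> exists2 l, `|l| <= B & u @ F --> l.
Proof.
move=> FU uB; have cB := @segment_compact R (- B) B.
have [|l [lB cl]] := cB (u @ F) _.
  by apply: (@filterS _ F _ setT) => [n _|]; [rewrite /= in_itv/= -ler_norml|exact: filterT].
exists l; first by move: lB; rewrite /= in_itv/= -ler_norml.
move=> A lA; have [//|FnA] := in_ultra_setVsetC (u @^-1` A) FU.
have [x [nAx Ax]] := cl (~` A) A FnA lA.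
by [].
Qed.

(** Replaces repeated extraction of subsequences: one filter gives limits for all coordinates of a
    sequence of centres, or for the averages of all measurable sets, at once. *)
Lemma exists_free_ultrafilter : exists F : set_system nat,
  UltraFilter F /\ forall N, F [set n | (N <= n)%N].
Proof.
have [F [FU EF]] := ultraFilterLemma eventually_filter.
by exists F; split => // N; apply: EF; exists N.
Qed.

Section spreading.
Context (R : realType) (m : nat) (beta : R) (M : 'M[R]_m)
  (eta : m.-tuple 'cV[R]_m) (xi : 'cV[R]_m) (i0 : 'I_m).
Hypotheses (m_gt0 : (0 < m)%N) (beta2 : 2 < beta) (Morth : orthogonal_mx M)
  (eta_basis : basis_of fullv eta).
Hypothesis H0 : single_cut beta M eta xi i0.
Local Notation V := ('cV[R]_m).
Local Notation X := (fundamental_domain eta xi).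
Local Notation T := (rotbeta beta M eta xi).
Local Notation c := (cpt eta xi).
Local Notation mble := (@measurable _ (borelRm R m)).
Local Notation lam := (@lebesgue_Rm R m).
Local Notation rexpand := (rexpand beta M).
Local Notation rcontract := (rcontract beta M).
Local Notation dig := (dig beta M eta xi).
Local Notation g := (cgrad eta i0).
Local Notation w := ((enorm g)^-1).
Local Notation "\r A" := (fine (lam A)) (at level 10).

Let beta1 : 1 < beta. Proof. by apply: lt_trans beta2; rewrite ltr1n. Qed.
Let beta0 : 0 < beta. Proof. by apply: lt_trans beta2. Qed.
Let mX : mble X. Proof. exact: domain_measurable. Qed.
Let Xoo : (lam X < +oo)%E. Proof. exact: domain_lebesgue_fin. Qed.
Let g0 : 0 < enorm g. Proof. exact: cgrad_gt0. Qed.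
Let mball y r : mble (eball y r).
Proof. by apply: measurable_open; exact: eball_open. Qed.

Lemma eball_center (y : V) r : 0 < r -> eball y r y.
Proof. by move=> r0; rewrite /eball/= subrr -(scale0r (0 : V)) enormZ normr0 mul0r. Qed.

Lemma eball_lebesgue_fin (y : V) r : (lam (eball y r) < +oo)%E.
Proof.
apply: (@bounded_lebesgue _ _ _ (r + `|y|)) => // x; rewrite /eball/= => h.
rewrite -{1}(subrK y x) (le_trans (ler_normD _ _))// lerD2r.
exact: le_trans (norm_le_enorm _) (ltW h).
Qed.

Lemma sub_dig_eq y z : dig z = dig y -> T z = T y + rexpand (z - y).
Proof.
move=> zy; rewrite !rotbetaE// zy addrAC linearB; congr (_ - _).
by rewrite addrC subrK.
Qed.

Section invariant.
Context (C : set V).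
Hypotheses (mC : mble C) (CX : C `<=` X) (TC : forall x, C x -> C (T x)).

Definition full_on_ball (r : R) := exists y : V,
  eball y r `<=` X /\ lam (eball y r `\` C) = 0%E.

(** The centres of balls whose defects tend to 0 accumulate at a point, and the ball of half the
    radius around it lies inside arbitrarily good ones. *)
Lemma exists_full_ball : (0 < lam C)%E -> exists2 r : R, 0 < r & full_on_ball r.
Proof.
move=> C0; have [r r0 H] := almost_full_ball m_gt0 beta2 Morth eta_basis H0 mC CX TC C0.
have r20 : 0 < r / 2 by rewrite divr_gt0.
exists (r / 2) => //.
have /choice[y yP] : forall k, exists y : V,
    eball y r `<=` X /\ (lam (eball y r `\` C) <= (k.+1%:R^-1)%:E)%E.
  by move=> k; apply: H; rewrite invr_gt0.
have [B B0 BX] := domain_bounded xi eta_basis.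
have [F [FU FN]] := exists_free_ultrafilter.
have yB k i : `|y k i ord0| <= B.
  apply: le_trans (le_norm_cV _ _) _; apply: BX.
  by have [yX _] := yP k; apply: yX; exact: eball_center.
have /choice[l lP] : forall i : 'I_m, exists l : R, (fun k => y k i ord0) @ F --> l.
  by move=> i; have [l _ ?] := ultra_bounded_cvg FU (fun k => yB k i); exists l.
pose z : V := \col_i l i.
(* Divided by [m] since the Euclidean norm is at most [m%:R] times the sup norm. *)
have near_z : F [set k | forall i, `|l i - y k i ord0| < r / 2 / m%:R].
  apply: filter_forall => i.
  by have /cvgrPdist_lt := lP i; apply; rewrite divr_gt0 ?ltr0n.
have pick N : exists2 k, (N <= k)%N & eball z (r / 2) `<=` eball (y k) r.
  have [k [kz kN]] := filter_ex (filterI near_z (FN N)).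
  exists k => // x; rewrite /eball/= => xz.
  rewrite -(subrK z x) -addrA (le_lt_trans (ler_enormD _ _))//.
  rewrite (splitr r) ltr_leD//; apply: le_trans (enorm_le_norm _) _.
  rewrite -ler_pdivlMl ?ltr0n// mulrC; apply: norm_cV_le.
    by rewrite divr_ge0// ltW.
  by move=> i; rewrite !mxE ltW// kz.
exists z; split.
  by have [k _ /subset_trans] := pick 0%N; apply; have [] := yP k.
apply/eqP; rewrite eq_le measure_ge0 andbT; apply/lee_addgt0Pr => e e0.
rewrite add0e; have [N Ne] : exists N : nat, N.+1%:R^-1 < e.
  have /ltr_add_invr[N] : 0 < e by []; by rewrite add0r; exists N.
have [k kN zk] := pick N; have [_ yk] := yP k.
apply: (@le_trans _ _ (lam (eball (y k) r `\` C))).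
  apply: le_measure; rewrite ?inE; [exact: measurableD|exact: measurableD|].
  by move=> x [/zk].
apply: le_trans yk _; rewrite lee_fin; apply: le_trans (ltW Ne).
by rewrite lef_pV2 ?posrE// ler_nat ltnS.
Qed.

(** With the digit of [y] kept fixed, the ball expands to radius [beta * r] around [T y]. Moving the
    centre along the normal by at most [s] places the ball of radius [s] between two consecutive
    cuts, and [2 * s <= beta * r] keeps it inside the expanded ball. *)
Lemma full_ball_grow r : 0 < r -> full_on_ball r ->
  full_on_ball (Num.min (w / 2) (beta * r / 2)).
Proof.
move=> r0 [y [yX yC]]; set s := Num.min _ _.
have s0 : 0 < s by rewrite lt_min !divr_gt0 ?invr_gt0 ?mulr_gt0.
have sw : s * enorm g <= 2^-1.
  rewrite -ler_pdivlMr// mulrC ge_min (_ : w / 2 = w * 2^-1)// lexx//.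
have sr : 2 * s <= beta * r.
  rewrite mulrC -ler_pdivlMr// /s ge_min lexx orbT//.
have Xy : X y by apply: yX; exact: eball_center.
pose h := c i0 (T y).
have h01 : 0 <= h < 1.
  by have /(domainP xi eta_basis) := rotbeta_domain beta M xi eta_basis y; exact.
pose u := s * enorm g.
have u0 : 0 < u by rewrite mulr_gt0.
(* Clamps the height of [T y] to the interval from [u] to [1 - u], nonempty because [u] is at most
   one half. *)
have [t [tu hu]] : exists t, u <= t <= 1 - u /\ `|t - h| <= u.
  have [hl|hl] := leP h u.
    by exists u; split; [rewrite /u; apply/andP; split; lra|rewrite ler_norml; apply/andP; split; lra].
  have [hr|hr] := leP (1 - u) h.
    by exists (1 - u); split; [rewrite /u; apply/andP; split; lra|rewrite ler_norml; apply/andP; split; lra].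
  by exists h; rewrite subrr normr0 (ltW hl) (ltW hr) ltW.
pose z := T y + ((t - h) / enorm g) *: ndir eta i0.
have cz : c i0 z = t.
  by rewrite /z cptD linearZ/= coord_ndir// divfK ?gt_eqF// -/h subrKC.
have key p : eball z s p -> exists x, [/\ eball y r x, T x = p & rexpand x + (T y - rexpand y) = p].
  rewrite /eball/= => pz.
  have dist : enorm (p - T y) < beta * r.
    apply: lt_le_trans sr; rewrite -(subrK z p) -addrA (le_lt_trans (ler_enormD _ _))//.
    rewrite mulr2n mulrDl mul1r ltr_leD// /z addrAC subrr add0r enormZ enorm_ndir//.
    rewrite mulr1 normrM normfV (gtr0_norm g0) ler_pdivrMr//.
  pose x := y + rcontract (p - T y).
  have ex : rexpand x = rexpand y + (p - T y) by rewrite /x linearD/= rcontractK//.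
  have yx : eball y r x.
    rewrite /eball/= /x addrAC subrr add0r rcontractE enormZ enorm_orthT//.
    by rewrite ger0_norm ?invr_ge0 ?(ltW beta0)// ltr_pdivrMl.
  have cp : `|c i0 p - t| < u.
    rewrite -cz sub_cpt; apply: le_lt_trans (coord_le _ _ _) _.
    by rewrite /u mulrC ltr_pM2r.
  have dx : dig x = dig y.
    apply: H0 => //; first exact: yX.
    rewrite ex cptD; apply/floor_def; rewrite intrD.
    have hE : h = c i0 (rexpand y) - (Num.floor (c i0 (rexpand y)))%:~R.
      by rewrite /h rotbetaE// cptBcvec// ffunE.
    have : coord eta i0 (p - T y) = c i0 p - h by rewrite /h sub_cpt.
    move: cp h01; rewrite ltr_norml hE => cp h01 ->.
    by move: (Num.floor _)%:~R cp h01 => F cp h01; apply/andP; split; lra.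
  exists x; split => //.
    have xy : x - y = rcontract (p - T y) by rewrite /x addrAC subrr add0r.
    by rewrite (sub_dig_eq dx) xy rcontractK// subrKC.
  have ab (a b : V) : a + (p - b) + (b - a) = p by rewrite addrC addrA subrK addrC subrK.
  by rewrite ex ab.
exists z; split.
  move=> p pz; have [x [_ <- _]] := key p pz; exact: rotbeta_domain.
have [kappa k0 kE] := lebesgue_affine beta2 Morth.
have mzC : mble (eball z s `\` C) by exact: measurableD.
have := kE 1%N (T y - rexpand y) _ mzC; rewrite /= expr1.
(* Pulled back through the branch of [y], a point outside [C] comes from a point of the original
   ball, which is outside [C] too by forward invariance. *)
rewrite (_ : lam [set x | _] = 0)%E; last first.
  apply/eqP; rewrite eq_le measure_ge0 andbT -yC; apply: le_measure; rewrite ?inE.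
  - exact: (@measurable_affine _ _ beta M 1%N _ (eball z s `\` C)).
  - exact: measurableD.
  move=> x [/= xz nC]; have [x' [yx' Tx' Ex']] := key _ xz.
  have xx : x = x'.
    have [rK _] := (rexpandK beta1 Morth, rcontractK beta1 Morth).
    by apply: (can_inj rK); apply: (addIr (T y - rexpand y)); rewrite Ex'.
  by rewrite xx; split => // Cx; apply: nC; rewrite -Tx'; exact: TC.
by move=> /esym/eqP; rewrite mule_eq0 eqe gt_eqF//= => /eqP.
Qed.

Lemma full_on_ballW r s : s <= r -> full_on_ball r -> full_on_ball s.
Proof.
move=> sr [y [yX yC]].
have sub : eball y s `<=` eball y r by move=> x; rewrite /eball/= => /lt_le_trans; exact.
exists y; split; first exact: subset_trans yX.
apply/eqP; rewrite eq_le measure_ge0 andbT -yC.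
by apply: le_measure; rewrite ?inE; [exact: measurableD|exact: measurableD|move=> x [/sub]].
Qed.

Lemma full_half_width : (0 < lam C)%E -> full_on_ball (w / 2).
Proof.
move=> C0; have [r r0 Hr] := exists_full_ball C0.
have b1 : 1 < beta / 2 by rewrite ltr_pdivlMr// mul1r.
have w0 : 0 < w / 2 by rewrite divr_gt0 ?invr_gt0.
have grow n : full_on_ball (Num.min (w / 2) ((beta / 2) ^+ n * r)).
  elim: n => [|n IHn].
    by apply: full_on_ballW Hr; rewrite expr0 mul1r ge_min lexx orbT.
  apply: full_on_ballW (full_ball_grow _ IHn); last first.
    by rewrite lt_min w0 mulr_gt0// exprn_gt0// (lt_trans _ b1).
  rewrite exprS [leRHS]minC le_min; apply/andP; split; last by rewrite ge_min lexx.
  rewrite -(mulrA (beta / 2)) [leRHS]mulrAC; set a := w / 2.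
  set b := (beta / 2) ^+ n * r.
  have [ab|ba] := leP a b.
    by rewrite ge_min; apply/orP; left; rewrite ler_peMl// ltW.
  by rewrite ge_min lexx orbT.
(* Bernoulli's inequality with [beta / 2 = 1 + (beta / 2 - 1)]. *)
have [n hn] : exists n, w / 2 / r <= (beta / 2) ^+ n.
  have d0 : 0 < beta / 2 - 1 by rewrite subr_gt0.
  pose a := w / 2 / r / (beta / 2 - 1).
  have a0 : 0 <= a by rewrite ltW// /a divr_gt0// divr_gt0.
  exists (Num.bound a).
  have : a * (beta / 2 - 1) <= (Num.bound a)%:R * (beta / 2 - 1).
    by rewrite ler_pM2r// ltW// archi_boundP.
  rewrite /a divfK ?gt_eqF// => /le_trans; apply.
  have -> : beta / 2 = 1 + (beta / 2 - 1) by rewrite subrKC.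
  rewrite [1 + _ - 1]addrAC subrr add0r.
  elim: (Num.bound _) => [|k IHk]; first by rewrite mul0r expr0.
  rewrite exprS -natr1 mulrDl mul1r [leRHS]mulrDl mul1r lerD//.
  by rewrite ler_peMr ?(ltW d0)// exprn_ege1// lerDl ltW.
apply: full_on_ballW (grow n); rewrite le_min lexx/=.
by rewrite -ler_pdivrMr.
Qed.

(** Encloses forward images in measurable sets. Each digit contributes an affine branch that
    multiplies volume by [kappa^-1], and different digits use disjoint parts of [A], so the volumes
    add up. *)
Lemma lebesgue_image : exists2 kappa : R, 0 < kappa & forall n (A : set V), mble A ->
  exists A' : set V, [/\ mble A', iter n T @` A `<=` A' &
    ((kappa ^+ n)%:E * lam A' <= lam A)%E].
Proof.
have [kappa k0 kE] := lebesgue_affine beta2 Morth.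
exists kappa => //; elim=> [|n IHn] A mA.
  by exists A; split => //; [move=> _ [x Ax <-]|rewrite expr0 mul1e].
have [A1 [mA1 AA1 lA1]] := IHn A mA.
suff [A2 [mA2 AA2 lA2]] : exists A2 : set V, [/\ mble A2, T @` A1 `<=` A2 &
    (kappa%:E * lam A2 <= lam A1)%E].
  exists A2; split => //.
    by move=> _ [x Ax <-]; apply: AA2; exists (iter n T x) => //; apply: AA1; exists x.
  rewrite exprSr EFinM -muleA; apply: le_trans lA1.
  by apply: lee_wpmul2l; rewrite // lee_fin exprn_ge0// ltW.
pose E (k : {ffun 'I_m -> int}) : set V := [set p | X p /\ A1 (rcontract (p + dvec eta k))].
have mE k : mble (E k).
  apply: measurableI => //.
  apply: (@measurable_preimage _ _ (fun p => p + dvec eta k) (rcontract @^-1` A1)).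
    exact: translation_continuous.
  by apply: measurable_preimage => //; exact: rcontract_continuous.
have lE k : (kappa%:E * lam (E k))%E = lam (A1 `&` dig @^-1` [set k]).
  have := kE 1%N (- dvec eta k) _ (mE k); rewrite expr1 => <-; congr (lam _).
  apply/seteqP; split => x /=.
    by move=> [Xx]; rewrite subrK rexpandK// => A1x; split => //; exact: dig_unique.
  by move=> [A1x <-]; split; [exact: sub_dig_domain|rewrite subrK rexpandK].
pose F n : set V := [set p | exists2 k, pickle k = n & E k p].
have FE j : (exists2 k, pickle k = j & F j = E k) \/
    ((forall k : {ffun 'I_m -> int}, pickle k <> j) /\ F j = set0).
  have [[k kj]|nk] := pselect (exists k : {ffun 'I_m -> int}, pickle k = j).
    left; exists k => //; apply/seteqP; split => [p [k' k'j]|p Ep]; last by exists k.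
    by have -> : k' = k by apply: (pcan_inj pickleK); rewrite k'j kj.
  right; split => [k kj|]; first by apply: nk; exists k.
  by rewrite -subset0 => p [k kj _]; apply: nk; exists k.
have mF j : mble (F j).
  by have [[k _ ->]|[_ ->]] := FE j; [exact: mE|exact: measurable0].
exists (\bigcup_j F j); split.
- exact: bigcupT_measurable.
- move=> _ [x A1x <-]; exists (pickle (dig x)) => //; exists (dig x) => //.
  split; first exact: rotbeta_domain.
  by rewrite rotbetaE// subrK rexpandK.
apply: (@le_trans _ _ (kappa%:E * \sum_(0 <= j <oo) lam (F j))%E).
  apply: lee_wpmul2l; first by rewrite lee_fin ltW.
  apply: measure_sigma_subadditive => //; exact: bigcupT_measurable.
rewrite -nneseriesZl//; have md k : mble (dig @^-1` [set k]) by exact: measurable_dig.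
rewrite (measure_fibers lam md mA1); apply: lee_nneseries => [*|j _].
  by rewrite mule_ge0// lee_fin ltW.
have [[k kj ->]|[_ ->]] := FE j; last by rewrite measure0 mule0.
rewrite [leLHS]lE; apply: le_measure; rewrite ?inE.
- by apply: measurableI.
- apply: measurableI => //.
  exact: (@countable_fun_measurable _ (borelRm R m) _ _ md [set i | pickle i = j]).
by move=> x [Ax /= ->].
Qed.

Hypothesis cover : forall z : V, X z -> exists n : nat,
  (2%:E * covering_radius (minkowski_sum (iter_fiber beta M eta xi n z) (lattice eta))
   <= beta%:E * width X)%E.

(** The faces of [X] where the coordinate [i0] is 0 and 1 bound a strip of normal [g]; the points
    where its two hyperplanes meet the line spanned by [g] are at distance [w]. *)
Lemma width_le : (width X <= w%:E)%E.
Proof.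
pose a := dotp g xi.
apply: (@le_trans _ _ (strip_width g a (a + 1))).
  apply: ereal_inf_lbound; exists g, a, (a + 1); split => //.
  - by apply/eqP => gE; move: g0; rewrite gE -(scale0r (0 : V)) enormZ normr0 mul0r ltxx.
  - by rewrite lerDl.
  move=> x /(domainP xi eta_basis)/(_ i0).
  have -> : c i0 x = dotp g x - a by rewrite /cpt coord_dotp dotpDr -scaleN1r dotpZr mulN1r.
  by rewrite /strip/=; lra.
apply: ereal_inf_lbound.
have gg : dotp g g != 0 by rewrite -sqr_enorm expf_neq0// gt_eqF.
pose x := (a / dotp g g) *: g; pose y := ((a + 1) / dotp g g) *: g.
exists x; first by rewrite /hyperplane/= dotpZr divfK.
exists y; first by rewrite /hyperplane/= dotpZr divfK.
rewrite /x /y -scalerBl -mulrBl opprD addrA subrr add0r enormZ -sqr_enorm.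
rewrite mulN1r normrN ger0_norm ?invr_ge0 ?sqr_ge0// expr2 invfM -mulrA mulVf ?mulr1//.
by rewrite gt_eqF.
Qed.

(** By the covering hypothesis some [u + d], with [u] in the fiber and [d] in the lattice, is close
    to [rexpand y]. As [u] lies in [X], the point [rcontract (u + d)] is sent to [u] by [T]; this is
    the extra step in [n.+1]. The slack [s] is there because the infimum need not be attained. *)
Lemma covering_time z : X z -> exists n, forall y (s : R), 1 < s ->
  exists2 x, eball y (s * (w / 2)) x & iter n.+1 T x = z.
Proof.
move=> /cover[n cn]; exists n => y s s1.
set P := minkowski_sum _ _ in cn.
have w0 : 0 < w by rewrite invr_gt0.
have c1 : (covering_radius P <= (beta * w / 2)%:E)%E.
  have : (2%:E * covering_radius P <= 2%:E * (beta * w / 2)%:E)%E.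
    apply: le_trans cn _; rewrite -EFinM mulrCA divff// mulr1 EFinM.
    by apply: lee_wpmul2l; [rewrite lee_fin ltW|exact: width_le].
  by rewrite lee_pmul2l.
have c2 : (ereal_inf [set (enorm (rexpand y - p))%:E | p in P] < (s * (beta * w / 2))%:E)%E.
  apply: (@le_lt_trans _ _ (covering_radius P)).
    by apply: ereal_sup_ubound; exists (rexpand y).
  by apply: le_lt_trans c1 _; rewrite lte_fin ltr_pMl// divr_gt0// mulr_gt0.
have [_ [p [u [Xu Tu] [d ld up]] <-] hp] := ereal_inf_lt c2.
have [k dk] := latticeP ld.
pose x := rcontract p.
have ex : rexpand x = p by rewrite rcontractK.
exists x.
  rewrite /eball/= -(ltr_pM2l beta0) -(enorm_expand beta1 Morth) linearB/= ex -enormN opprB.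
  by move: hp; rewrite lte_fin; congr (_ < _); ring.
rewrite iterSr (_ : T x = u)//.
rewrite (@rotbeta_eq _ _ beta M eta xi eta_basis x k); rewrite ex -dk -up addrK//.
Qed.

(** A point of [X] outside [C] is reached from arbitrarily small enlargements of the full ball, at a
    time that does not depend on the enlargement, and only from points outside [C]. These points
    form sets [N j] of volume tending to 0, whose images at a fixed time therefore have a null
    intersection. *)
Lemma full_measure : (0 < lam C)%E -> lam (X `\` C) = 0%E.
Proof.
move=> C0; have [y [yX yC]] := full_half_width C0.
have w0 : 0 < w / 2 by rewrite divr_gt0 ?invr_gt0.
have [kappa k0 kI] := lebesgue_image.
pose s j : R := 1 + j.+1%:R^-1.
have s1 j : 1 < s j by rewrite ltrDl invr_gt0.
pose N j := eball y (s j * (w / 2)) `\` (C `&` eball y (w / 2)).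
have mN j : mble (N j) by apply: measurableD => //; exact: measurableI.
have /choice[A AP] : forall nj : nat * nat, exists A' : set V,
    [/\ mble A', iter nj.1.+1 T @` N nj.2 `<=` A' &
    ((kappa ^+ nj.1.+1)%:E * lam A' <= lam (N nj.2))%E].
  by move=> nj; exact: kI.
pose b := \r (eball y (w / 2)).
have bE : lam (eball y (w / 2)) = b%:E by rewrite fine_measureK// eball_lebesgue_fin.
have lN j : (lam (N j) <= ((s j ^+ m - 1) * b)%:E)%E.
  have sub : eball y (w / 2) `<=` eball y (s j * (w / 2)).
    by move=> x; rewrite /eball/= => /lt_le_trans; apply; rewrite ler_peMl ?ltW.
  have mD : mble (eball y (s j * (w / 2)) `\` eball y (w / 2)) by exact: measurableD.
  apply: (@le_trans _ _ (lam ((eball y (s j * (w / 2)) `\` eball y (w / 2)) `|`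
      (eball y (w / 2) `\` C)))%E).
    apply: le_measure; rewrite ?inE//.
      by apply: measurableU => //; exact: measurableD.
    move=> x [xs nC]; have [xw|nw] := pselect (eball y (w / 2) x).
      by right; split => // Cx; apply: nC.
    by left.
  apply: le_trans (measureU2 _ _ _) _ => //; first exact: measurableD.
  have h2 : lam (eball y (s j * (w / 2)) `\` eball y (w / 2)) = ((s j ^+ m - 1) * b)%:E.
    rewrite [LHS]measureD//; last exact: eball_lebesgue_fin.
    rewrite (setIidr sub) [X in (X - _)%E]lebesgue_eball_scale ?(lt_trans _ (s1 j))//.
    by rewrite [X in (_ - X)%E]bE bE -EFinM -EFinB mulrBl mul1r.
  by rewrite [X in (X + _)%E]h2 [X in (_ + X)%E]yC adde0.
have b0 : 0 <= b by exact: fine_measure_ge0.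
have null n : lam.-negligible (\bigcap_j A (n, j)).
  exists (\bigcap_j A (n, j)); split => //.
    by apply: bigcapT_measurable => j; have [] := AP (n, j).
  apply/eqP; rewrite eq_le measure_ge0 andbT.
  have kn0 : 0 < kappa ^+ n.+1 by rewrite exprn_gt0.
  rewrite -(@lee_pmul2l _ (kappa ^+ n.+1)%:E)// mule0.
  apply/lee_addgt0Pr => e e0; rewrite add0e.
  have : (fun j => (s j ^+ m - 1) * b) @ \oo --> (0 : R).
    rewrite -[X in _ --> X](mul0r b); apply: cvgMr_tmp.
    rewrite -[X in _ --> X](subrr (1 : R)); apply: cvgB; last exact: cvg_cst.
    elim: (m) => [|k IHk]; first exact: cvg_cst.
    rewrite -[X in _ --> X](mulr1 (1 : R)).
    under eq_fun do rewrite exprS.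
    apply: cvgM IHk; rewrite -[X in _ --> X](addr0 (1 : R)).
    by apply: cvgD; [exact: cvg_cst|exact: cvg_harmonic].
  move=> /cvgrPdist_le/(_ e e0)[J _ HJ].
  have [mA _ lA] := AP (n, J).
  apply: (@le_trans _ _ ((kappa ^+ n.+1)%:E * lam (A (n, J)))%E).
    apply: lee_wpmul2l; first by rewrite lee_fin ltW.
    apply: le_measure; rewrite ?inE//.
      by apply: bigcapT_measurable => j; have [] := AP (n, j).
    by move=> x; exact.
  apply: le_trans lA _; apply: le_trans (lN J) _; rewrite lee_fin.
  by have := HJ J (leqnn J); rewrite /= sub0r normrN => /(le_trans (ler_norm _)).
apply: measure_negligible; first exact: measurableD.
apply: negligibleS (negligible_bigcup null) => z [Xz nCz].
have [n zn] := covering_time Xz; exists n => // j _.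
have [_ AN _] := AP (n, j); apply: AN => /=.
have [x xs xz] := zn y _ (s1 j); exists x => //; split => // -[Cx _].
apply: nCz; rewrite -xz.
by elim: n.+1 => //= k; exact: TC.
Qed.

End invariant.
End spreading.

(** * Cesaro limits and invariant probabilities *)

Section probability_of_content.
Context d (S : measurableType d) (R : realType) (L : set S -> R).
Hypotheses (L_ge0 : forall A, 0 <= L A) (L_setT : L setT = 1)
  (L_setU : forall A B, measurable A -> measurable B -> A `&` B = set0 ->
     L (A `|` B) = L A + L B)
  (L_cvg0 : forall F : (set S)^nat, (forall n, measurable (F n)) ->
     nonincreasing_seq F -> \bigcap_n F n = set0 -> L \o F @ \oo --> (0 : R)).

Definition content_measure (A : set S) : \bar R := (L A)%:E.

Let L_set0 : L set0 = 0.
Proof.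
have := L_setU measurable0 measurable0 (setI0 set0).
by rewrite setU0 => /eqP; rewrite addrC -subr_eq subrr => /eqP.
Qed.

Let content_measure0 : content_measure set0 = 0%E.
Proof. by rewrite /content_measure L_set0. Qed.

Let content_measure_ge0 A : (0 <= content_measure A)%E.
Proof. by rewrite lee_fin. Qed.

Let content_measure_sigma : semi_sigma_additive content_measure.
Proof.
move=> F mF tF mUF.
pose U n := \big[setU/set0]_(i < n) F i.
have mU n : measurable (U n) by exact: bigsetU_measurable.
have LU n : \sum_(0 <= i < n) L (F i) = L (U n).
  elim: n => [|n IHn]; first by rewrite big_nil /U big_ord0 L_set0.
  rewrite big_nat_recr//= IHn /U big_ord_recr/= L_setU//.
    exact: (mU n).
  rewrite setIC -subset0 => x [Fx]; rewrite -bigcup_mkord => -[i /= ni Fi].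
  have /trivIsetP/(_ i n I I) := tF.
  by rewrite neq_ltn ni => /(_ isT); rewrite -subset0 => /(_ x); apply.
pose G n := \bigcup_k F k `\` U n.
have UF n : U n `<=` \bigcup_k F k.
  by move=> x; rewrite /U -bigcup_mkord => -[i /= _ Fi]; exists i.
have LG n : L (U n) = L (\bigcup_k F k) - L (G n).
  apply/eqP; rewrite eq_sym subr_eq -L_setU ?setDUK//; first exact: measurableD.
  by rewrite -subset0 => x [Ux []].
have G0 : L \o G @ \oo --> (0 : R).
  apply: L_cvg0 => [n|n k nk|]; first exact: measurableD.
    apply/subsetPset => x [Fx nU]; split => // Ux; apply: nU.
    move: Ux; rewrite /U -!bigcup_mkord => -[i /= ni Fi].
    by exists i => //=; exact: leq_trans nk.
  rewrite -subset0 => x Gx; have [[k _ Fk] _] := Gx 0%N I.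
  have [_] := Gx k.+1 I; apply; rewrite /U -bigcup_mkord.
  by exists k => /=.
rewrite (_ : (fun n => _) = EFin \o (fun n => L (\bigcup_k F k) - (L \o G) n)).
  apply/cvg_EFin; first exact: nearW.
  rewrite -[X in _ --> X]subr0; apply: cvgB => //; exact: cvg_cst.
by apply/funext => n; rewrite /= -LG -LU sumEFin.
Qed.

HB.instance Definition _ := isMeasure.Build _ _ _ content_measure
  content_measure0 content_measure_ge0 content_measure_sigma.

Let content_measureT : content_measure setT = 1%E.
Proof. by rewrite /content_measure L_setT. Qed.

HB.instance Definition _ := Measure_isProbability.Build _ _ _ content_measure
  content_measureT.

(** Countable additivity follows from continuity at the empty set, because the tails of a disjoint
    union decrease to it. *)
Lemma probability_of_content :
  exists mu : probability S R, forall A, mu A = (L A)%:E.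
Proof. by exists content_measure. Qed.

End probability_of_content.

Section cesaro.
Context d (S : measurableType d) (R : realType) (a : nat -> set S -> R).
Hypotheses (a_ge0 : forall k A, 0 <= a k A) (a_setT : forall k, a k setT = 1)
  (a_setU : forall k A B, measurable A -> measurable B -> A `&` B = set0 ->
     a k (A `|` B) = a k A + a k B)
  (a_unif0 : forall F : (set S)^nat, (forall n, measurable (F n)) ->
     nonincreasing_seq F -> \bigcap_n F n = set0 ->
     forall e, 0 < e -> exists N, forall n k, (N <= n)%N -> a k (F n) <= e).

Let av A n : R := (\sum_(k < n.+1) a k A) / n.+1%:R.

Let a_le1 k A : measurable A -> a k A <= 1.
Proof.
move=> mA; rewrite -(a_setT k) -(setUv A) a_setU ?setICr ?lerDl//.
exact: measurableC.
Qed.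

Let av_ge0 A n : 0 <= av A n.
Proof. by rewrite divr_ge0// sumr_ge0. Qed.

Let av_le A n e : (forall k, a k A <= e) -> av A n <= e.
Proof.
move=> aA; rewrite ler_pdivrMr ?ltr0n//.
apply: (@le_trans _ _ (\sum_(k < n.+1) e)); first by apply: ler_sum.
by rewrite sumr_const card_ord mulr_natr.
Qed.

(** Continuity at the empty set survives the limit because it is uniform in [k]. The shift rule
    holds because the averages of [B] and [A] differ only by two end terms divided by [n.+1]. *)
Lemma cesaro_probability : exists mu : probability S R,
  (forall A, measurable A -> (forall k, a k A = 0) -> mu A = 0%E) /\
  (forall A B, measurable A -> measurable B -> (forall k, a k B = a k.+1 A) ->
     mu B = mu A).
Proof.
have [F [FU FN]] := exists_free_ultrafilter.
(* On nonmeasurable sets [L] takes the default value 0; additivity is claimed for measurable sets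
   alone. *)
have /choice[L LP] : forall A : set S, exists l : R,
    0 <= l /\ (measurable A -> av A @ F --> l).
  move=> A; have [mA|nA] := pselect (measurable A); last by exists 0.
  have [|l _ lA] := @ultra_bounded_cvg R F (av A) 1 FU.
    by move=> n; rewrite ger0_norm// av_le// => k; exact: a_le1.
  exists l; split => //; rewrite -(cvg_lim (@Rhausdorff R) lA).
  by apply: limr_ge; [apply/cvg_ex; exists l|exact: nearW].
have avL A : measurable A -> av A @ F --> L A by have [] := LP A.
have L_uniq A l : measurable A -> av A @ F --> l -> L A = l.
  by move=> mA; apply: (cvg_unique (@Rhausdorff R)); exact: avL.
have L_le A e : measurable A -> (forall k, a k A <= e) -> L A <= e.
  move=> mA aA; rewrite -(cvg_lim (@Rhausdorff R) (avL A mA)).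
  apply: limr_le; first by apply/cvg_ex; exists (L A); exact: avL.
  by apply: nearW => n; exact: av_le.
have LT : L setT = 1.
  apply: L_uniq; first exact: measurableT.
  rewrite (_ : av setT = cst 1); first exact: cvg_cst.
  apply/funext => n; rewrite /av (eq_bigr (fun=> 1)) => [|k _]; last exact: a_setT.
  by rewrite sumr_const card_ord divff.
have LU A B : measurable A -> measurable B -> A `&` B = set0 ->
    L (A `|` B) = L A + L B.
  move=> mA mB AB; apply: L_uniq; first exact: measurableU.
  rewrite (_ : av (A `|` B) = av A \+ av B); first by apply: cvgD; exact: avL.
  apply/funext => n; rewrite /av /= -mulrDl -big_split/=.
  by congr (_ / _); apply: eq_bigr => k _; exact: a_setU.
have L0 A : 0 <= L A by have [] := LP A.
have Lc (G : (set S)^nat) : (forall n, measurable (G n)) ->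
    nonincreasing_seq G -> \bigcap_n G n = set0 -> L \o G @ \oo --> (0 : R).
  move=> mG dG G0; apply/cvgrPdist_le => e e0.
  have [N HN] := a_unif0 mG dG G0 e0; exists N => // n /= Nn.
  by rewrite sub0r normrN ger0_norm// L_le// => k; exact: HN.
have [mu muE] := probability_of_content L0 LT LU Lc; exists mu; split.
  move=> A mA aA; rewrite muE; congr EFin; apply/eqP.
  by rewrite eq_le L0 andbT L_le// => k; rewrite aA.
move=> A B mA mB AB; rewrite !muE; congr EFin; apply: L_uniq => //.
have -> : av B = fun n => av A n + (av B n - av A n).
  by apply/funext => n; rewrite subrKC.
rewrite -[X in _ --> X]addr0; apply: cvgD; first exact: avL.
apply/cvgrPdist_le => e e0.
have /ltr_add_invr[N] : 0 < e by []; rewrite add0r => Ne.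
apply: filterS (FN N) => n /= Nn.
have -> : av B n - av A n = (a n.+1 A - a 0%N A) / n.+1%:R.
  rewrite /av -mulrBl; congr (_ / _).
  rewrite (eq_bigr (fun k : 'I_n.+1 => a k.+1 A))//.
  by rewrite [X in X - _]big_ord_recr [X in _ - X]big_ord_recl/=; ring.
rewrite sub0r normrN normrM normfV [X in _ / X]ger0_norm//.
apply: (@le_trans _ _ (1 / n.+1%:R)).
  rewrite ler_pM2r ?invr_gt0 ?ltr0n// ler_norml.
  have := a_le1 0 mA; have := a_le1 n.+1 mA; have := a_ge0 0 A; have := a_ge0 n.+1 A.
  by lra.
rewrite mul1r; apply: le_trans (ltW Ne).
by rewrite lef_pV2 ?posrE ?ltr0n// ler_nat ltnS.
Qed.

End cesaro.

Section invariant_probability.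
Context d (S : measurableType d) (R : realType) (f : S -> S) (X : set S).
Hypotheses (mf : forall A, measurable A -> measurable (f @^-1` A))
  (mX : measurable X) (fX : forall x, X x -> X (f x)).

Lemma iter_preimage_measurable n A : measurable A -> measurable (iter n f @^-1` A).
Proof. by elim: n A => //= n IHn A mA; exact: (IHn _ (mf mA)). Qed.

Lemma probability_setI1 (mu : probability S R) A : mu X = 1%E -> measurable A ->
  mu (X `&` A) = mu A.
Proof.
move=> X1 mA; rewrite [in RHS](measureDI _ mA mX) setIC.
suff h : mu (A `\` X) = 0%E by rewrite [X in _ = (X + _)%E]h add0e.
apply/eqP; rewrite eq_le measure_ge0 andbT.
apply: (@le_trans _ _ (mu (~` X))).
  by apply: le_measure; rewrite ?inE; [exact: measurableD|exact: measurableC|move=> x []].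
by rewrite probability_setC// X1 subee.
Qed.

Lemma iter_invariant (mu : probability S R) n A : mu X = 1%E ->
  (forall A, measurable A -> mu (X `&` f @^-1` A) = mu A) ->
  measurable A -> mu (X `&` iter n f @^-1` A) = mu A.
Proof.
move=> X1 inv; elim: n A => [|n IHn] A mA; first exact: probability_setI1.
rewrite (_ : iter n.+1 f @^-1` A = iter n f @^-1` (f @^-1` A))//.
by rewrite IHn; [rewrite -(probability_setI1 X1) ?inv//; exact: mf|exact: mf].
Qed.

(* The positive part [P] of a Hahn decomposition of [mu - nu] agrees, up to sets on
   which [mu] and [nu] coincide, with the invariant set of the points whose whole
   orbit lies in [P]. *)
Lemma ergodic_le (mu nu : probability S R) : mu X = 1%E -> nu X = 1%E ->
  (forall A, measurable A -> mu (X `&` f @^-1` A) = mu A) ->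
  (forall A, measurable A -> nu (X `&` f @^-1` A) = nu A) ->
  (forall C, measurable C -> C `<=` X -> (forall x, C x -> C (f x)) ->
     (0 < mu C)%E -> nu C = 1%E) ->
  forall A, measurable A -> (mu A <= nu A)%E.
Proof.
move=> muX nuX muI nuI erg A mA; rewrite leNgt; apply/negP => Alt.
have [P [N [[mP posP] [mN negN] PN _]]] :=
  Hahn_decomposition (cadd (charge_of_finite_measure mu)
    (cscale (-1) (charge_of_finite_measure nu))).
pose p B := fine (mu B); pose q B := fine (nu B).
have muE B : measurable B -> mu B = (p B)%:E.
  by move=> mB; rewrite fineK// fin_num_measure.
have nuE B : measurable B -> nu B = (q B)%:E.
  by move=> mB; rewrite fineK// fin_num_measure.
have pDI B D : measurable B -> measurable D -> p B = p (B `\` D) + p (B `&` D).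
  move=> mB mD; apply: EFin_inj; rewrite EFinD -!muE ?(measureDI _ mB mD)//.
    exact: measurableI.
  exact: measurableD.
have qDI B D : measurable B -> measurable D -> q B = q (B `\` D) + q (B `&` D).
  move=> mB mD; apply: EFin_inj; rewrite EFinD -!nuE ?(measureDI _ mB mD)//.
    exact: measurableI.
  exact: measurableD.
have caddE B : measurable B -> cadd (charge_of_finite_measure mu)
    (cscale (-1) (charge_of_finite_measure nu)) B = (p B - q B)%:E.
  by move=> mB; rewrite /cadd/= /cscale/= /charge_of_finite_measure muE// nuE// -EFinM mulN1r.
have qp B : measurable B -> B `<=` P -> q B <= p B.
  by move=> mB BP; rewrite -subr_ge0 -lee_fin -caddE//; exact: posP.
have pq B : measurable B -> B `<=` ~` P -> p B <= q B.
  move=> mB BP; have BN : B `<=` N.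
    move=> x Bx; have : setT x by []; rewrite -PN => -[/(BP x Bx)|]//.
  by rewrite -subr_le0 -lee_fin -caddE//; exact: negN.
have sP : q P < p P.
  have mAP := measurableI _ _ mA mP; have mAD := measurableD mA mP.
  have mPD := measurableD mP mA; have mPA := measurableI _ _ mP mA.
  have h1 : p (A `\` P) <= q (A `\` P) by apply: pq => // x [].
  have h2 : q (P `\` A) <= p (P `\` A) by apply: qp => // x [].
  move: Alt; rewrite muE// nuE// lte_fin (pDI _ _ mA mP) (qDI _ _ mA mP).
  rewrite (pDI _ _ mP mA) (qDI _ _ mP mA) (setIC P A).
  by move: h1 h2; lra.
pose Pk k := X `&` iter k f @^-1` P.
have mPk k : measurable (Pk k).
  by apply: measurableI => //; exact: iter_preimage_measurable.
(* By invariance [mu - nu] has the same mass on [P] and on [Pk k], hence on the two differences. It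
   is nonnegative on one and nonpositive on the other, so it vanishes on both and, by its sign, on
   every measurable part of the first. *)
have null k B : measurable B -> B `<=` P `\` Pk k -> mu B = nu B.
  move=> mB Bk; rewrite muE// nuE//; congr EFin.
  have BP : B `<=` P by move=> x /Bk[].
  have mD := measurableD mP (mPk k); have mI := measurableI _ _ mP (mPk k).
  have mD' := measurableD (mPk k) mP; have mDB := measurableD mD mB.
  have h1 : q B <= p B by exact: qp.
  have h2 : q ((P `\` Pk k) `\` B) <= p ((P `\` Pk k) `\` B).
    by apply: qp => // x [[]].
  have h3 : p (Pk k `\` P) <= q (Pk k `\` P) by apply: pq => // x [].
  have e1 := pDI _ _ mP (mPk k); have e2 := qDI _ _ mP (mPk k).
  have e3 := pDI _ _ (mPk k) mP; have e4 := qDI _ _ (mPk k) mP.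
  have e5 := pDI _ _ mD mB; have e6 := qDI _ _ mD mB.
  rewrite (setIidr Bk) in e5; rewrite (setIidr Bk) in e6.
  rewrite (setIC P) in e1; rewrite (setIC P) in e2.
  have e7 : p (Pk k) = p P by rewrite /p iter_invariant.
  have e8 : q (Pk k) = q P by rewrite /q iter_invariant.
  apply/eqP; rewrite eq_le h1 andbT; move: h2 h3 e1 e2 e3 e4 e5 e6 e7 e8.
  move: (p _) (p _) (p _) (p _) (p _) (p _) (p _) (q _) (q _) (q _) (q _) (q _) (q _) (q _).
  by clear; move=> *; lra.
pose D := \bigcup_k (P `\` Pk k); pose C := P `\` D.
have mF k : measurable (P `\` Pk k) by exact: measurableD.
have mD : measurable D by exact: bigcupT_measurable.
have mC : measurable C by exact: measurableD.
have mS k : measurable (seqDU (fun k => P `\` Pk k) k).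
  by apply: measurableD => //; exact: bigsetU_measurable.
have muD : mu D = nu D.
  rewrite /D seqDU_bigcup_eq !measure_bigcup//; [|exact: trivIset_seqDU..].
  by apply: eq_eseriesr => k _; apply: (null k) => // x [].
have CP x : C x <-> X x /\ forall k, P (iter k f x).
  split=> [[Px nD]|[Xx Pi]].
    have h k : Pk k x by apply: contrapT => nk; apply: nD; exists k.
    by split => [|k]; [have [] := h 0%N|have [] := h k].
  by split; [exact: (Pi 0%N)|move=> [k _ [_]]; apply; split => //=; exact: Pi].
have sC : q C < p C.
  have DP : D `<=` P by move=> x [k _ []].
  have e1 := pDI _ _ mP mD; have e2 := qDI _ _ mP mD.
  rewrite (setIidr DP) in e1; rewrite (setIidr DP) in e2.
  have e3 : p D = q D by rewrite /p muD.
  by move: sP; rewrite e1 e2 e3 ltrD2r.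
have C1 : nu C = 1%E.
  apply: erg => //; first by move=> x /CP[].
    move=> x /CP[Xx Px]; apply/CP; split => [|k]; first exact: fX.
    by rewrite -iterSr; exact: Px.
  by rewrite muE// lte_fin; apply: le_lt_trans sC; exact: fine_ge0.
have := probability_le1 mu mC; rewrite muE// lee_fin leNgt => /negP; apply.
by move: sC; rewrite /q C1.
Qed.

End invariant_probability.

(** * Absolutely continuous invariant measures *)

Section acim.
Context (R : realType) (m : nat) (beta : R) (M : 'M[R]_m)
  (eta : m.-tuple 'cV[R]_m) (xi : 'cV[R]_m).
Hypotheses (m_gt0 : (0 < m)%N) (beta2 : 2 < beta) (Morth : orthogonal_mx M)
  (eta_basis : basis_of fullv eta).
Local Notation V := ('cV[R]_m).
Local Notation X := (fundamental_domain eta xi).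
Local Notation T := (rotbeta beta M eta xi).
Local Notation c := (cpt eta xi).
Local Notation mble := (@measurable _ (borelRm R m)).
Local Notation lam := (@lebesgue_Rm R m).
Local Notation rexpand := (rexpand beta M).
Local Notation dig := (dig beta M eta xi).
Local Notation "\r A" := (fine (lam A)) (at level 10).
Local Notation probRm := (probability (borelRm R m) R).

Let beta1 : 1 < beta. Proof. by apply: lt_trans beta2; rewrite ltr1n. Qed.
Let mX : mble X. Proof. exact: domain_measurable. Qed.
Let Xoo : (lam X < +oo)%E. Proof. exact: domain_lebesgue_fin. Qed.
Let mT A : mble A -> mble (T @^-1` A). Proof. exact: rotbeta_measurable. Qed.
Let mTn n A : mble A -> mble (iter n T @^-1` A).
Proof. exact: iter_rotbeta_measurable. Qed.

(** All digits are integer multiples of one lattice vector, so any coordinate in which this vector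
    does not vanish determines the multiple. If the vector is 0, all digits are 0 and every index
    serves. *)
Lemma tube_single_cut (e : V) : lattice eta e ->
  [set beta *: (M *m z) | z in X] `<=`
    \bigcup_(j in [set: int]) translate X (j%:~R *: e) ->
  exists i0, single_cut beta M eta xi i0.
Proof.
move=> /latticeP[k ->] tube.
have key z : X z -> exists j : int, dig z = [ffun i => j * k i].
  move=> Xz; have [j _ [x Xx xE]] := tube _ (ex_intro2 _ _ z Xz erefl).
  exists j; apply: dig_unique => //.
  rewrite (_ : dvec eta _ = j%:~R *: dvec eta k) ?rexpandE -?xE ?addrK//.
  rewrite /dvec /cvec scaler_sumr; apply: eq_bigr => i _.
  by rewrite ffunE intrM scalerA.
have [[i ki]|k0] := pselect (exists i, k i != 0).
  exists i => y z /key[j jE] /key[l lE] yz; rewrite jE lE; apply/ffunP => i'.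
  rewrite !ffunE; congr (_ * _); apply: (mulIf ki).
  by move/ffunP : jE => /(_ i); move/ffunP : lE => /(_ i); rewrite !ffunE yz => -> ->.
exists (Ordinal m_gt0) => y z /key[j ->] /key[l ->] _; apply/ffunP => i.
rewrite !ffunE (_ : k i = 0) ?mulr0//.
by apply/eqP; apply: contrapT => /negP ki; apply: k0; exists i.
Qed.

Context (i0 : 'I_m).
Hypothesis H0 : single_cut beta M eta xi i0.

Lemma acim_exists : exists mu : probRm, is_ACIM beta M eta xi mu.
Proof.
have rX : 0 < \r X by rewrite fine_gt0// domain_lebesgue_gt0//.
(* The law of [iter k T x] for [x] uniformly distributed in [X]. *)
pose a k (A : set V) := \r (X `&` iter k T @^-1` A) / \r X.
have mXT k (A : set V) : mble A -> mble (X `&` iter k T @^-1` A).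
  by move=> mA; apply: measurableI => //; exact: mTn.
have XToo k (A : set V) : mble A -> (lam (X `&` iter k T @^-1` A) < +oo)%E.
  move=> mA; apply: (@measure_sub_fin _ (borelRm R m) R lam _ X) => //; exact: mXT.
have restr k (A : set V) :
    X `&` iter k T @^-1` (X `&` A) = X `&` iter k T @^-1` A.
  apply/seteqP; split => [x [Xx [_ Ax]]//|x [Xx Ax]].
  by split => //; split => //; exact: iter_domain.
have a0 k A : 0 <= a k A by rewrite divr_ge0// ?fine_measure_ge0// ltW.
have aT k : a k setT = 1 by rewrite /a preimage_setT setIT divff// gt_eqF.
have aU k A B : mble A -> mble B -> A `&` B = set0 -> a k (A `|` B) = a k A + a k B.
  move=> mA mB AB; rewrite /a -mulrDl; congr (_ / _); apply: EFin_inj.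
  rewrite EFinD !fine_measureK ?XToo//; last exact: measurableU.
  rewrite preimage_setU setIUr measureU//; [exact: mXT|exact: mXT|].
  rewrite -subset0 => x [[_ Ax] [_ Bx]].
  by have : (A `&` B) (iter k T x) by []; rewrite AB.
have [C C0 CK] := uniformly_integrable m_gt0 beta2 Morth eta_basis H0.
have ab e : 0 < e -> exists2 K, 0 <= K &
    forall k A, mble A -> a k A * \r X <= e + K * \r (X `&` A).
  move=> e0; have C1 : 0 < C + 1 by rewrite ltr_wpDl.
  have [K K0 KE] := CK (e / (C + 1)) (divr_gt0 e0 C1); exists K => // k A mA.
  rewrite /a divfK ?gt_eqF// -restr.
  apply: (le_trans (KE k (X `&` A) _ _)); [exact: measurableI|by move=> x []|].
  rewrite lerD2r mulrCA ler_piMr ?(ltW e0)// ler_pdivrMr// mul1r lerDl//.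
have aunif (F : (set (borelRm R m))^nat) : (forall n, mble (F n)) ->
    nonincreasing_seq F -> \bigcap_n F n = set0 ->
    forall e, 0 < e -> exists N, forall n k, (N <= n)%N -> a k (F n) <= e.
  move=> mF dF F0 e e0.
  have e20 : 0 < e * \r X / 2 by rewrite divr_gt0// mulr_gt0.
  have [K K0 KE] := ab _ e20.
  have : lam \o (fun n => X `&` F n) @ \oo --> lam (\bigcap_n (X `&` F n)).
    apply: nonincreasing_cvg_mu => //.
    - by apply: (@measure_sub_fin _ (borelRm R m) R lam _ X) => //; exact: measurableI.
    - by move=> n; exact: measurableI.
    - by apply: bigcapT_measurable => n; exact: measurableI.
    - move=> n k nk; apply/subsetPset; apply: setIS; apply/subsetPset; exact: dF.
  rewrite (_ : \bigcap_n (X `&` F n) = set0); last first.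
    rewrite -subset0 => x Fx; rewrite -F0 => n _; by have [] := Fx n I.
  rewrite measure0 => /fine_cvgP[_ /cvgrPdist_le].
  have K1 : 0 < K + 1 by rewrite ltr_wpDl.
  move=> /(_ _ (divr_gt0 e20 K1))[N _ HN]; exists N => n k Nn.
  rewrite -(ler_pM2r rX); apply: le_trans (KE k _ (mF n)) _.
  have := HN n Nn; rewrite /= sub0r normrN ger0_norm ?fine_measure_ge0// => h.
  rewrite [leRHS](splitr (e * \r X)) lerD2l.
  apply: le_trans (ler_wpM2l K0 h) _.
  by rewrite mulrCA ler_piMr ?(ltW e20)// ler_pdivrMr// mul1r lerDl.
have [mu [mu0 muI]] :=
  @cesaro_probability _ (borelRm R m) R a a0 aT aU aunif.
have muXC : mu (~` X) = 0%E.
  apply: mu0 => [|k]; first exact: measurableC.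
  rewrite /a (_ : _ `&` _ = set0) ?measure0 ?mul0r//.
  by rewrite -subset0 => x [Xx]; apply; exact: iter_domain.
exists mu; split.
- by rewrite -(setCK X) probability_setC ?muXC ?sube0//; exact: measurableC.
- move=> A mA; apply: muI => //; first by apply: measurableI => //; exact: mT.
  by move=> k; rewrite /a restr.
move=> N nN A mA AN; apply: mu0 => // k.
have A0 : \r (X `&` A) = 0.
  have : (lam (X `&` A) <= 0)%E.
    by rewrite -(nN A mA AN); apply: le_measure; rewrite ?inE//; exact: measurableI.
  by rewrite measure_le0 => /eqP ->.
apply/eqP; rewrite eq_le a0 andbT -(ler_pM2r rX) mul0r.
apply/ler_addgt0Pr => e e0; have [K _ KE] := ab e e0.
by have := KE k A mA; rewrite A0 mulr0 addr0 add0r.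
Qed.

Hypothesis cover : forall z : V, X z -> exists n : nat,
  (2%:E * covering_radius (minkowski_sum (iter_fiber beta M eta xi n z) (lattice eta))
   <= beta%:E * width X)%E.

Lemma acim_null_domain (mu : probRm) (A : set V) : is_ACIM beta M eta xi mu ->
  mble A -> lam (X `&` A) = 0%E -> mu A = 0%E.
Proof.
move=> [muX _ mulam] mA XA0; rewrite -(probability_setI1 mX muX mA).
have mXA : mble (X `&` A) by exact: measurableI.
apply: (mulam (X `&` A)) => // B mB BA; apply/eqP.
by rewrite -measure_le0 -XA0; apply: le_measure; rewrite ?inE.
Qed.

(** Positive [mu]-mass forces positive volume, hence full volume in [X] by spreading; what is left
    is Lebesgue-null and so null for every ACIM. *)
Lemma acim_invariant_full (mu nu : probRm) (C : set V) :
  is_ACIM beta M eta xi mu -> is_ACIM beta M eta xi nu ->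
  mble C -> C `<=` X -> (forall x, C x -> C (T x)) -> (0 < mu C)%E ->
  lam (X `\` C) = 0%E /\ nu C = 1%E.
Proof.
move=> muP nuP mC CX TC muC.
have lC : lam (X `\` C) = 0%E.
  apply: (full_measure m_gt0 beta2 Morth eta_basis H0 mC CX TC cover).
  rewrite lt0e measure_ge0 andbT; apply/eqP => C0; move: muC.
  by rewrite (@acim_null_domain mu)// ?ltxx// (setIidr CX).
split => //; have [nuX _ _] := nuP.
have mXC : mble (X `\` C) by exact: measurableD.
rewrite -nuX [in RHS](measureDI _ mX mC) (setIidr CX).
have h : nu (X `\` C) = 0%E.
  by apply: acim_null_domain => //; rewrite setIidr// => x [].
by rewrite [X in _ = (X + _)%E]h add0e.
Qed.

Lemma acim_unique (mu nu : probRm) : is_ACIM beta M eta xi mu ->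
  is_ACIM beta M eta xi nu -> forall A, mble A -> nu A = mu A.
Proof.
have le (p q : probRm) : is_ACIM beta M eta xi p -> is_ACIM beta M eta xi q ->
    forall A, mble A -> (p A <= q A)%E.
  move=> pP qP; have [[pX pI _] [qX qI _]] := (pP, qP).
  apply: (@ergodic_le _ (borelRm R m) R T X) => //.
    by move=> x _; exact: rotbeta_domain.
  by move=> C mC CX TC C0; have [] := acim_invariant_full pP qP mC CX TC C0.
by move=> muP nuP A mA; apply/eqP; rewrite eq_le !le.
Qed.

Lemma acim_equivalent (mu : probRm) : is_ACIM beta M eta xi mu ->
  lebesgue_on_domain eta xi `<< mu.
Proof.
move=> muP N nN A mA AN; have [muX muI mulam] := muP.
(* The union over all times makes [C] forward invariant; its term [n = 0] keeps [A] itself out of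
   [C]. *)
pose B := \bigcup_n (X `&` iter n T @^-1` A); pose C := X `\` B.
have mXT n : mble (X `&` iter n T @^-1` A) by apply: measurableI => //; exact: mTn.
have mB : mble B by exact: bigcupT_measurable.
have mC : mble C by exact: measurableD.
have BX : B `<=` X by move=> x [n _ []].
have muB : mu B = 0%E.
  apply: measure_negligible => //; apply: negligible_bigcup => n.
  exists (X `&` iter n T @^-1` A); split => //.
  have h := @iter_invariant _ (borelRm R m) R T X mT mX mu n A muX muI mA.
  by rewrite [LHS]h; exact: nN.
have TC x : C x -> C (T x).
  move=> [Xx nB]; split => [|[n _ [_ An]]]; first exact: rotbeta_domain.
  by apply: nB; exists n.+1 => //; split => //=; rewrite -iterS iterSr.
have [|lC _] := acim_invariant_full muP muP mC (@subDsetl _ X B) TC.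
  have := muX; rewrite [X in X = _](measureDI _ mX mB) (setIidr BX).
  by rewrite [X in (_ + X)%E = _]muB adde0 => ->; rewrite lte01.
apply/eqP; rewrite -measure_le0 -lC; apply: le_measure; rewrite ?inE.
- exact: measurableI.
- exact: measurableD.
by move=> x [Ax Xx]; split => // -[_]; apply; exists 0%N.
Qed.

End acim.

Theorem theorem1p4 (R : realType) (m : nat) (beta : R) (M : 'M[R]_m)
    (eta : m.-tuple 'cV[R]_m) (xi : 'cV[R]_m) :
  (1 <= m)%N ->
  1 < beta ->
  orthogonal_mx M ->
  basis_of fullv eta ->
  (forall z : 'cV[R]_m, fundamental_domain eta xi z ->
     exists n : nat,
       (2%:E * covering_radius
                 (minkowski_sum (iter_fiber beta M eta xi n z) (lattice eta))
        <= beta%:E * width (fundamental_domain eta xi))%E) ->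
  (exists2 e : 'cV[R]_m, lattice eta e &
     [set beta *: (M *m z) | z in fundamental_domain eta xi] `<=`
     \bigcup_(j in [set: int])
       translate (fundamental_domain eta xi) (j%:~R *: e)) ->
  2 < beta ->
  exists mu : probability (borelRm R m) R,
    [/\ is_ACIM beta M eta xi mu,
        forall nu : probability (borelRm R m) R, is_ACIM beta M eta xi nu ->
          forall A : set (borelRm R m), measurable A -> nu A = mu A,
        mu `<< lebesgue_on_domain eta xi
      & lebesgue_on_domain eta xi `<< mu].
Proof.
move=> m_gt0 _ Morth eta_basis cover [e le tube] beta2.
have [i0 H0] := tube_single_cut m_gt0 eta_basis le tube.
have [mu muP] := acim_exists m_gt0 beta2 Morth eta_basis H0.
exists mu; split => //.
- by move=> nu nuP; exact: (acim_unique m_gt0 beta2 Morth eta_basis H0 cover muP nuP).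
- move=> N nN A mA AN; apply: (acim_null_domain eta_basis muP mA).
  by rewrite setIC; exact: nN.
- exact: (acim_equivalent m_gt0 beta2 Morth eta_basis H0 cover muP).
Qed.
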